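(* If $C^e\in\mathcal{S}$ (the distribution of $C^e$ is subexponential), then there exist $\eta>0$ and a finite constant $K$, not depending on $\epsilon$ or $u$, such that for all $\epsilon<\eta$ and all $u\ge0$ the relative error $R_{d,\epsilon}(u)=1-\tilde\psi_{d,\epsilon}(u)/\psi_\epsilon(u)$ of the corrected discard approximation satisfies $$R_{d,\epsilon}(u)\le\frac{\epsilon\theta}{1-\delta+\epsilon\delta}\,H_\epsilon(u)+\epsilon^2K,$$ where $$H_\epsilon(u)=\frac{\mathbb{P}(M^\bullet_{\epsilon,0}+M^\bullet_{\epsilon,1}+M^\bullet_{\epsilon,2}+C^e_1+C^e_2>u)}{\mathbb{P}(M^\bullet_{\epsilon,0}+M^\bullet_{\epsilon,1}+C^e_1>u)}-1 .$$
   Context: Fix $\lambda>0$. Let $B$ be a nonnegative random variable with a phase-type distribution and $C$ a nonnegative random variable with a heavy-tailed distribution ($\mathbb{E}e^{rC}=\infty$ for all $r>0$), both with finite positive means. Let $\epsilon\in[0,1]$ be a (perturbation) parameter. Classical Cramér–Lundberg model: premiums flow in at rate 1, claims arrive according to a Poisson process $\{N_\epsilon(t)\}$ of rate $\lambda$, and the claim sizes $U_{\epsilon,i}$ are i.i.d., independent of $N_\epsilon$, distributed as $B$ with probability $1-\epsilon$ and as $C$ with probability $\epsilon$. Let $M_\epsilon=\sup_{t\ge0}\big(\sum_{i=1}^{N_\epsilon(t)}U_{\epsilon,i}-t\big)$ and let $\psi_\epsilon(u)=\mathbb{P}(M_\epsilon>u)$ be the ruin probability with initial capital $u\ge0$.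 Put $\delta=\lambda\mathbb{E}B$, $\theta=\lambda\mathbb{E}C$, $\rho_\epsilon=(1-\epsilon)\delta+\epsilon\theta$. Standing assumptions: $\delta<1$, and only values of $\epsilon\in[0,1]$ with $\rho_\epsilon<1$ are considered. For a nonnegative random variable with distribution $F$ and mean $\mu_F\in(0,\infty)$, its stationary excess distribution is $F^e(u)=\frac1{\mu_F}\int_0^u(1-F(t))\,dt$; $C^e$ has the stationary excess distribution of $C$. Discard base model: $M^\bullet_\epsilon$ is the supremum over $t\ge 0$ of (total claims up to $t$) $-\,t$ when claims arrive as a Poisson process of rate $(1-\epsilon)\lambda$ with i.i.d. sizes distributed as $B$; $\psi^\bullet_\epsilon(u)=\mathbb{P}(M^\bullet_\epsilon>u)$. The $M^\bullet_{\epsilon,i}$ are copies of $M^\bullet_\epsilon$, the $C^e_i$ are copies of $C^e$, all mutually independent. Corrected discard approximation: $$\tilde\psi_{d,\epsilon}(u)=\psi^\bullet_\epsilon(u)+\frac{\epsilon\theta}{1-\delta+\epsilon\delta}\big(\mathbb{P}(M^\bullet_{\epsilon,0}+M^\bullet_{\epsilon,1}+C^e_1>u)-\mathbb{P}(M^\bullet_{\epsilon,0}>u)\big).$$ A distribution $F$ on $[0,\infty)$ belongs to the class $\mathcal{S}$ of subexponential distributions iff $\lim_{u\to\infty}\frac{1-F^{*n}(u)}{1-F(u)}=n$ for $n=1,2,\dots$, where $F^{*n}$ is the $n$-fold convolution. *)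

(* Defs.v *)
From HB Require Import structures.
From mathcomp Require Export all_boot all_order all_algebra.
From mathcomp Require Export all_classical all_reals all_analysis.
(* Not re-exported by [all_analysis]: the measurable structure of [\bar R]. *)
From mathcomp Require Export measurable_realfun.

Set Implicit Arguments.
Unset Strict Implicit.
Unset Printing Implicit Defensive.

Import Order.TTheory GRing.Theory Num.Theory.
Import numFieldNormedType.Exports.

Local Open Scope classical_set_scope.
Local Open Scope ring_scope.

Definition same_law (R : realType) (d d' dS : measure_display)
    (T : measurableType d) (T' : measurableType d') (S : measurableType dS)
    (P : probability T R) (P' : probability T' R)
    (X : T -> S) (Y : T' -> S) : Prop :=
  forall A : set S, measurable A -> P (X @^-1` A) = P' (Y @^-1` A).

Definition mutually_independent (R : realType) (d dS : measure_display)
    (T : measurableType d) (S : measurableType dS) (P : probability T R)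
    (I : eqType) (X : I -> T -> S) : Prop :=
  forall (s : seq I) (A : I -> set S), uniq s ->
    (forall i, measurable (A i)) ->
    P (\big[setI/setT]_(i <- s) (X i @^-1` A i)) =
    (\prod_(i <- s) P (X i @^-1` A i))%E.

Definition generated_sigma_algebra (dS : measure_display) (T J : Type)
    (S : measurableType dS) (D : set J) (X : J -> T -> S) : set (set T) :=
  <<s \bigcup_(j in D) preimage_set_system setT (X j) measurable >>.

Definition independent_classes (R : realType) (d : measure_display)
    (T : measurableType d) (P : probability T R) (F G : set (set T)) : Prop :=
  forall A B, F A -> G B -> P (A `&` B) = (P A * P B)%E.

Definition tail (R : realType) (d : measure_display) (T : measurableType d)
    (P : probability T R) (X : T -> \bar R) (u : R) : R :=
  fine (P [set w | (u%:E < X w)%E]).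

Definition mexp (R : realType) (m : nat) (A : 'M[R]_m.+1) : 'M[R]_m.+1 :=
  \matrix_(i, j) limn (series (fun k => (A ^+ k) i j / k`!%:R)).

(* The row vector [alpha] is the initial law on the [m.+1] transient states of
   a Markov jump process with one further, absorbing, state; its missing mass
   is the probability of starting in the absorbing state.  [G] is the
   subintensity matrix, invertible exactly when all these states are transient,
   and [alpha *m mexp (x *: G)] is the law at time [x] on the event that
   absorption has not occurred yet. *)
Definition phase_type (R : realType) (d : measure_display)
    (T : measurableType d) (P : probability T R) (X : {RV P >-> R}) : Prop :=
  exists (m : nat) (alpha : 'rV[R]_m.+1) (G : 'M[R]_m.+1),
    [/\ (forall i, 0 <= alpha 0 i) /\ \sum_i alpha 0 i <= 1,
        forall i j, i != j -> 0 <= G i j,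
        forall i, \sum_j G i j <= 0,
        G \in unitmx &
        forall x, 0 <= x ->
          ccdf X x = (\sum_i (alpha *m mexp (x *: G)) 0 i)%:E].

Definition heavy_tailed (R : realType) (d : measure_display)
    (T : measurableType d) (P : probability T R) (X : {RV P >-> R}) : Prop :=
  forall r : R, 0 < r -> 'M_P X r = +oo%E.

Definition has_stationary_excess_law (R : realType) (d d' : measure_display)
    (T : measurableType d) (T' : measurableType d')
    (P : probability T R) (P' : probability T' R)
    (X : {RV P >-> R}) (Y : {RV P' >-> R}) : Prop :=
  forall u : R, 0 <= u ->
    cdf Y u = ((fine 'E_P[X])^-1%:E *
      \int[lebesgue_measure]_(t in `[0%R, u]) (1 - cdf X t))%E.

(* The distribution function of the [n]-fold convolution of [mu], through
   F^{*(n+1)}(u) = \int F^{*n}(u - y) dF(y), starting from the unit mass at 0. *)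
Fixpoint conv_cdf (R : realType) (mu : probability R R)
    (n : nat) (u : R) : \bar R :=
  if n is n'.+1 then (\int[mu]_y conv_cdf mu n' (u - y)%R)%E
  else \d_(0 : R) `]-oo, u]%classic.

Definition subexponential (R : realType)
    (mu : probability R R) : Prop :=
  mu `]-oo, 0%R[%classic = 0%E /\
  forall n : nat, (0 < n)%N ->
    (1 - fine (conv_cdf mu n u)) / (1 - fine (mu `]-oo, u]%classic)) @[u --> +oo]
      --> (n%:R : R).

(* A Poisson process is the counting process of a renewal sequence with i.i.d.
   exponential interarrival times: [n <= N t] iff the [n]-th arrival epoch is
   at most [t].  Asking this for every outcome rather than almost every one
   makes all paths finite-valued and right-continuous. *)
Definition poisson_process (R : realType) (d : measure_display)
    (T : measurableType d) (P : probability T R) (rate : R)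
    (N : R -> T -> nat) : Prop :=
  exists E : nat -> {RV P >-> R},
    [/\ forall k (A : set R), measurable A ->
          P (E k @^-1` A) = exponential_prob rate A,
        mutually_independent P (fun k => E k : T -> R) &
        forall t w n, 0 <= t -> (n <= N t w)%N = (\sum_(k < n) E k w <= t)].

Definition cramer_lundberg (R : realType) (d : measure_display)
    (T : measurableType d) (P : probability T R) (rate : R)
    (claim_law : set R -> \bar R) (N : R -> T -> nat)
    (U : nat -> {RV P >-> R}) : Prop :=
  [/\ poisson_process P rate N,
      forall i (A : set R), measurable A -> P (U i @^-1` A) = claim_law A,
      mutually_independent P (fun i => U i : T -> R) &
      independent_classes P
        (generated_sigma_algebra [set t : R | 0 <= t] N)
        (generated_sigma_algebra setT (fun i => U i : T -> R))].

(* The supremum is taken in the extended reals, so that no almost-sure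
   finiteness is presupposed. *)
Definition net_loss_sup (R : realType) (T : Type)
    (N : R -> T -> nat) (U : nat -> T -> R) (w : T) : \bar R :=
  ereal_sup [set (\sum_(i < N t w) U i w - t)%:E | t in [set t : R | 0 <= t]].

Definition mixture (R : realType) (T : Type) (eps : R)
    (mu nu : set T -> \bar R) (A : set T) : \bar R :=
  ((1 - eps)%:E * mu A + eps%:E * nu A)%E.

(* [M] and [Ce] are mutually independent sequences of copies of the supremum
   [Mb] of the discard base model and of the excess variable [C0]. *)
Definition discard_copies (R : realType) (db dc dq : measure_display)
    (Tb : measurableType db) (Tc : measurableType dc) (Tq : measurableType dq)
    (Pb : probability Tb R) (Pc : probability Tc R) (Q : probability Tq R)
    (Mb : Tb -> \bar R) (C0 : {RV Pc >-> R})
    (M : nat -> Tq -> \bar R) (Ce : nat -> {RV Q >-> R}) : Prop :=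
  [/\ forall i, measurable_fun setT (M i),
      forall i, same_law Q Pb (M i) Mb,
      forall i, same_law Q Pc (Ce i) C0 &
      mutually_independent Q
        (fun (k : nat + nat) (w : Tq) =>
           match k with inl i => M i w | inr i => (Ce i w)%:E end)].

Definition discard_coef (R : realType) (delta theta eps : R) : R :=
  eps * theta / (1 - delta + eps * delta).

Definition corrected_discard (R : realType) (db dq : measure_display)
    (Tb : measurableType db) (Tq : measurableType dq)
    (Pb : probability Tb R) (Q : probability Tq R) (delta theta eps : R)
    (Mb : Tb -> \bar R) (M : nat -> Tq -> \bar R) (Ce : nat -> Tq -> R)
    (u : R) : R :=
  tail Pb Mb u + discard_coef delta theta eps *
    (tail Q (fun w => M 0%N w + M 1%N w + (Ce 1%N w)%:E)%E u
     - tail Q (M 0%N) u).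

Definition discard_H (R : realType) (dq : measure_display)
    (Tq : measurableType dq) (Q : probability Tq R)
    (M : nat -> Tq -> \bar R) (Ce : nat -> Tq -> R) (u : R) : R :=
  tail Q (fun w => M 0%N w + M 1%N w + M 2%N w
                   + (Ce 1%N w)%:E + (Ce 2%N w)%:E)%E u
  / tail Q (fun w => M 0%N w + M 1%N w + (Ce 1%N w)%:E)%E u - 1.

(* Main.v *)
(** The net loss process changes only at claim epochs, so the tail of its supremum
    is the limit of the tails of finite Lindley recursions, and satisfies a
    fixed-point equation in which the exponential interarrival density can be
    eliminated: this gives the Pollaczek-Khinchine renewal equation
    g = (1 - rho) I + b * g with I the indicator of (-oo, 0) and
    b(s) = lambda P(U > s) for s >= 0.  Comparing the equations of the base and
    of the perturbed model yields psi = (1 - k) p0 + k T psi, where p0 is the base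
    tail, k is the correction coefficient and T is convolution with the law of
    M + C^e.  Iterating three times, psi minus the approximation equals
    k^2 (T^2 p0 - T p0) + k^3 (T^3 psi - T^2 p0), while psi >= k T p0.
    It remains to bound T^3 psi by a constant multiple of T p0, uniformly in the
    perturbation.  A subexponential law is long-tailed, so its tail F decays more
    slowly than every exponential, whereas p0 decays exponentially at a rate valid
    for all perturbations because B is phase-type; together with F * F <= A F this
    gives T F <= A F, and psi <= 2 A F as soon as 2 k A <= 1. *)

From HB Require Import structures.
From mathcomp Require Import ring lra zify.
Require Import Defs.
Import Order.TTheory GRing.Theory Num.Theory.
Import numFieldNormedType.Exports.
Set Implicit Arguments.
Unset Strict Implicit.
Unset Printing Implicit Defensive.
Local Open Scope classical_set_scope.
Local Open Scope ring_scope.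

(** Each law acts on nonnegative functions as the operator sending g to u |-> E g(u - X); its value
    at the indicator of the negative half-line is the tail of X. By Tonelli these operators commute,
    which stands in for compound geometric sums: two renewal equations are compared by applying the
    operator of one model to the equation of the other. The Lindley fixed-point equation does not
    determine the tail, since the constant 1 solves it too. What selects the tail is that it
    vanishes at infinity; this comes from comparison with a solution of the renewal equation built
    by iteration, in place of a law of large numbers. The error is relative to psi, so psi must also
    be bounded below. That bound carries the factor k, hence the case k = 0 is settled separately,
    by positivity of the base tail. *)

(** * Convolution operators on nonnegative measurable functions *)

Definition nonneg_mfun d (T : measurableType d) (R : realType)
    (g : T -> \bar R) : Prop :=
  measurable_fun setT g /\ forall x, (0 <= g x)%E.

(* Convolution of [g] with the image under [j] of the measure with density [k]
   with respect to [m]. *)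
HB.lock Definition conv (R : realType) d (T : measurableType d)
    (m : set T -> \bar R) (j k : T -> R) (g : R -> \bar R)
    (u : R) : \bar R :=
  (\int[m]_x ((k x)%:E * g (u - j x)%R))%E.

Lemma convE (R : realType) d (T : measurableType d) (m : set T -> \bar R)
    (j k : T -> R) (g : R -> \bar R) (u : R) :
  conv m j k g u = (\int[m]_x ((k x)%:E * g (u - j x)%R))%E.
Proof. by rewrite conv.unlock. Qed.

Section conv.
Local Open Scope ereal_scope.
Context (R : realType).
Context d (T : measurableType d) (m : {sigma_finite_measure set T -> \bar R}).
Variables (j k : T -> R).
Hypothesis mj : measurable_fun setT j.
Hypothesis mk : measurable_fun setT k.
Hypothesis k0 : forall x, (0 <= k x)%R.
Implicit Types g : R -> \bar R.

Lemma measurable_shift d' (T' : measurableType d') (h : T' -> R) g u :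
  measurable_fun setT h -> nonneg_mfun g ->
  measurable_fun setT (fun x => g (u - h x)%R).
Proof.
move=> mh [mg _]; apply: measurableT_comp => //.
exact: measurable_funB.
Qed.

Lemma measurable_conv_integrand g u : nonneg_mfun g ->
  measurable_fun setT (fun x => (k x)%:E * g (u - j x)%R).
Proof.
move=> hg; apply: emeasurable_funM; first exact/measurable_EFinP.
exact: measurable_shift.
Qed.

Lemma conv_integrand_ge0 g u x : nonneg_mfun g -> 0 <= (k x)%:E * g (u - j x)%R.
Proof. by move=> hg; apply: mule_ge0; [rewrite lee_fin|case: hg]. Qed.

Lemma nonneg_conv g : nonneg_mfun g -> nonneg_mfun (conv m j k g).
Proof.
move=> hg; split; last first.
  by move=> u; rewrite convE; apply: integral_ge0 => x _; exact: conv_integrand_ge0.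
pose f (p : R * T) := (k p.2)%:E * g (p.1 - j p.2)%R.
have mf : measurable_fun setT f.
  apply: emeasurable_funM.
    by apply/measurable_EFinP; apply: measurableT_comp; [exact: mk|exact: measurable_snd].
  apply: measurableT_comp; first by case: hg.
  apply: measurable_funB; first exact: measurable_fst.
  by apply: measurableT_comp; [exact: mj|exact: measurable_snd].
rewrite (_ : conv m j k g = fubini_F m f); last by apply/funext => u; rewrite convE.
apply: (measurable_fun_fubini_tonelli_F (m2 := m) f mf).
by move=> [x y]; exact: conv_integrand_ge0.
Qed.

Lemma le_conv g1 g2 u : nonneg_mfun g1 -> nonneg_mfun g2 ->
  (forall x, g1 x <= g2 x) -> conv m j k g1 u <= conv m j k g2 u.
Proof.
move=> h1 h2 h12; rewrite !convE; apply: ge0_le_integral => //.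
- by move=> x _; exact: conv_integrand_ge0.
- exact: measurable_conv_integrand.
- exact: measurable_conv_integrand.
- by move=> x _; apply: lee_wpmul2l; [rewrite lee_fin|exact: h12].
Qed.

Lemma convD g1 g2 u : nonneg_mfun g1 -> nonneg_mfun g2 ->
  conv m j k (g1 \+ g2) u = conv m j k g1 u + conv m j k g2 u.
Proof.
move=> h1 h2; rewrite !convE -ge0_integralD//.
- apply: eq_integral => x _; rewrite ge0_muleDr//; [by case: h1|by case: h2].
- by move=> x _; exact: conv_integrand_ge0.
- exact: measurable_conv_integrand.
- by move=> x _; exact: conv_integrand_ge0.
- exact: measurable_conv_integrand.
Qed.

Lemma convZ g (c : R) u : nonneg_mfun g -> (0 <= c)%R ->
  conv m j k (fun x => c%:E * g x) u = c%:E * conv m j k g u.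
Proof.
move=> h c0; rewrite !convE -ge0_integralZl_EFin//.
- by apply: eq_integral => x _; rewrite muleCA.
- by move=> x _; exact: conv_integrand_ge0.
- exact: measurable_conv_integrand.
Qed.

Lemma conv_cvg (g_ : nat -> R -> \bar R) g u :
  (forall n, nonneg_mfun (g_ n)) ->
  (forall x, {homo g_^~ x : n n' / (n <= n')%N >-> n <= n'}) ->
  (forall x, g_ n x @[n --> \oo] --> g x) ->
  conv m j k (g_ n) u @[n --> \oo] --> conv m j k g u.
Proof.
move=> h hm hg.

have e : conv m j k g u = \int[m]_x limn (fun n => (k x)%:E * g_ n (u - j x)%R).
  rewrite convE; apply: eq_integral => x _; apply/esym/cvg_lim => //.
  by apply: cvgeZl => //; exact: hg.
under eq_fun do rewrite convE.
rewrite e; apply: cvg_monotone_convergence => //.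
- by move=> n; exact: measurable_conv_integrand.
- by move=> n x _; exact: conv_integrand_ge0.
- by move=> x _ a b ab; apply: lee_wpmul2l; [rewrite lee_fin|exact: hm].
Qed.

End conv.

(** Tonelli on the product space. The two operators may have different measures and densities, so
    this one lemma exchanges Lebesgue kernels with laws of random variables as well as laws with
    each other. *)
Lemma conv_comm (R : realType) d1 d2 (T1 : measurableType d1)
    (T2 : measurableType d2) (m1 : {sigma_finite_measure set T1 -> \bar R})
    (m2 : {sigma_finite_measure set T2 -> \bar R})
    (j1 k1 : T1 -> R) (j2 k2 : T2 -> R) (g : R -> \bar R) (u : R) :
  measurable_fun setT j1 -> measurable_fun setT k1 -> (forall x, 0 <= k1 x) ->
  measurable_fun setT j2 -> measurable_fun setT k2 -> (forall x, 0 <= k2 x) ->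
  nonneg_mfun g ->
  conv m1 j1 k1 (conv m2 j2 k2 g) u = conv m2 j2 k2 (conv m1 j1 k1 g) u.
Proof.
move=> mj1 mk1 k10 mj2 mk2 k20 [mg g0].
pose f (p : T1 * T2) := ((k1 p.1)%:E * ((k2 p.2)%:E * g (u - j1 p.1 - j2 p.2)%R))%E.
have m1' : measurable_fun setT (fst : T1 * T2 -> T1) by exact: measurable_fst.
have m2' : measurable_fun setT (snd : T1 * T2 -> T2) by exact: measurable_snd.
have mf : measurable_fun setT f.
  apply: emeasurable_funM; first by apply/measurable_EFinP; exact: measurableT_comp.
  apply: emeasurable_funM; first by apply/measurable_EFinP; exact: measurableT_comp.
  apply: measurableT_comp => //; apply: measurable_funB.
    by apply: measurable_funB => //; exact: measurableT_comp.
  exact: measurableT_comp.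
have f0 p : (0 <= f p)%E by rewrite !mule_ge0// lee_fin.
transitivity (\int[m1]_x \int[m2]_y f (x, y))%E.
  rewrite convE; apply: eq_integral => x _; rewrite convE -ge0_integralZl_EFin//.
  - by move=> y _; apply: mule_ge0 => //; rewrite lee_fin.
  - apply: emeasurable_funM; first exact/measurable_EFinP.
    by apply: measurableT_comp => //; exact: measurable_funB.
rewrite (fubini_tonelli f)// convE; apply: eq_integral => y _.
rewrite convE -ge0_integralZl_EFin//.
- apply: eq_integral => x _; rewrite /f/= muleCA; congr (_ * (_ * g _))%E.
  by rewrite addrAC.
- by move=> x _; apply: mule_ge0 => //; rewrite lee_fin.
- apply: emeasurable_funM; first exact/measurable_EFinP.
  by apply: measurableT_comp => //; exact: measurable_funB.
Qed.

(** * Lebesgue integrals and the exponential law *)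

Section lebesgue.
Local Open Scope ereal_scope.
Context (R : realType).
Local Notation RR := (measurableTypeR R).
Local Notation leb := (@lebesgue_measure R).

Lemma ge0_integral_lebesgue_shift (f : R -> \bar R) (c : R) : nonneg_mfun f ->
  \int[leb]_x f (x + c)%R = \int[leb]_x f x.
Proof.
move=> [mf f0].
have mphi : measurable_fun setT ((fun x => x + c)%R : RR -> RR).
  exact: measurable_funD.
rewrite -[LHS](@ge0_integral_pushforward _ _ RR RR R _ mphi leb setT f)//.
apply: eq_measure_integral => A mA _.
apply/esym/lebesgue_measure_unique => //= _ [[a b]] _ <-.
rewrite /pushforward (_ : _ @^-1` _ = `]a - c, b - c]%classic)%R; last first.
  by apply/seteqP; split => x /=; rewrite !in_itv/= ltrBlDr lerBrDr.
by rewrite !lebesgue_measure_itv/= !lte_fin ltrD2r -!EFinB opprD addrACA subrr addr0.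
Qed.

Lemma ge0_integral_lebesgueN (f : R -> \bar R) : nonneg_mfun f ->
  \int[leb]_x f (- x)%R = \int[leb]_x f x.
Proof.
move=> [mf f0].
have mphi : measurable_fun setT ((fun x => - x)%R : RR -> RR).
  exact: measurable_funN.
rewrite -[LHS](@ge0_integral_pushforward _ _ RR RR R _ mphi leb setT f)//.
by apply: eq_measure_integral => A mA _; exact: lebesgue_measureN.
Qed.

Import HBNNSimple.

(** Monotone approximation by simple functions reduces this to indicators, where it is the
    hypothesis on [nu]. The explicit density fits [exponential_prob], which is itself given as such
    an integral. *)
Lemma ge0_integral_density d (T : measurableType d)
    (m nu : {measure set T -> \bar R}) (h : T -> R) (f : T -> \bar R) :
  measurable_fun setT h -> (forall x, 0 <= h x)%R -> nonneg_mfun f ->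
  (forall A, measurable A -> nu A = \int[m]_(x in A) (h x)%:E) ->
  \int[nu]_x f x = \int[m]_x ((h x)%:E * f x).
Proof.
move=> mh h0 [mf f0] hnu.
pose f_ := nnsfun_approx measurableT mf.
have cf x : (f_ n x)%:E @[n --> \oo] --> f x by apply: cvg_nnsfun_approx.
have mf_ n : measurable_fun setT (fun x => (f_ n x)%:E) by exact/measurable_EFinP.
have ndf x : {homo (fun n => (f_ n x)%:E) : a b / (a <= b)%N >-> a <= b}.
  by move=> a b ab; rewrite lee_fin; exact/lefP/nd_nnsfun_approx.
have mhE : measurable_fun setT (EFin \o h) by exact/measurable_EFinP.
transitivity (limn (fun n => \int[nu]_x (f_ n x)%:E)).
  rewrite -monotone_convergence//; last by move=> n x _; rewrite lee_fin.
  by apply: eq_integral => x _; apply/esym/cvg_lim => //; exact: cf.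
transitivity (limn (fun n => \int[m]_x ((h x)%:E * (f_ n x)%:E))); last first.
  rewrite -monotone_convergence//; first last.
  - by move=> x _ a b ab; apply: lee_wpmul2l; [rewrite lee_fin|exact: ndf].
  - by move=> n x _; rewrite mule_ge0// lee_fin.
  - by move=> n; exact: emeasurable_funM.
  by apply: eq_integral => x _; apply/cvg_lim => //; apply: cvgeZl => //; exact: cf.
congr (limn _); apply/funext => n.
transitivity (\sum_(r \in range (f_ n)) \int[nu]_x (r * \1_(f_ n @^-1` [set r]) x)%:E).
  under eq_integral do rewrite fimfunE -fsumEFin//.
  rewrite ge0_integral_fsum//.
  - by move=> y; exact/measurable_EFinP/measurable_funM.
  - by move=> y x _; rewrite nnfun_muleindic_ge0.
transitivity (\sum_(r \in range (f_ n))
    \int[m]_x ((h x)%:E * (r * \1_(f_ n @^-1` [set r]) x)%:E)); last first.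
  rewrite -ge0_integral_fsum//; first last.
  - by move=> y x _; apply: mule_ge0; [rewrite lee_fin|exact: nnfun_muleindic_ge0].
  - by move=> y; apply: emeasurable_funM => //; exact/measurable_EFinP/measurable_funM.
  apply: eq_integral => x _.
  rewrite [in RHS](fimfunE (f_ n)) -fsumEFin//= ge0_mule_fsumr//.
  by move=> y; rewrite nnfun_muleindic_ge0.
apply: eq_fsbigr => r; rewrite inE => -[x0 _ <-].
set A := _ @^-1` _.
have mA : measurable A by exact: measurable_sfunP.
have r0 : (0 <= f_ n x0)%R by [].
rewrite [LHS]integralZl_indic_nnsfun//= integral_indic//= setIT hnu//.
transitivity (\int[m]_x ((f_ n x0)%:E * ((h x)%:E * (\1_A x)%:E))); last first.
  by apply: eq_integral => x _; rewrite EFinM muleCA.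
rewrite ge0_integralZl_EFin//.
- congr (_ * _); rewrite integral_mkcond; apply: eq_integral => x _.
  rewrite patchE indicE; case: ifPn => _; by rewrite ?mule1 ?mule0.
- by move=> x _; rewrite mule_ge0// lee_fin.
- by apply: emeasurable_funM => //; exact/measurable_EFinP/measurable_indic.
Qed.

(** Density of [- E] for [E] exponential of rate [l]: interarrival times enter the walk with a minus
    sign. It differs from the reflected [exponential_pdf] at 0 only, hence on a null set. *)
Definition exp_kernel (l x : R) : R := if (x < 0)%R then (l * expR (l * x))%R else 0%R.

Lemma exp_kernel_ge0 l x : (0 <= l)%R -> (0 <= exp_kernel l x)%R.
Proof. by move=> l0; rewrite /exp_kernel; case: ifP => // _; rewrite mulr_ge0// expR_ge0. Qed.

Lemma measurable_exp_kernel l : measurable_fun setT (exp_kernel l).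
Proof.
apply: measurable_fun_ifT => //; first exact: measurable_fun_ltr.
apply: measurable_funM => //; exact: measurableT_comp.
Qed.

Lemma measurable_exponential_pdf_lebesgue l :
  measurable_fun setT (exponential_pdf l : RR -> R).
Proof. exact: measurable_exponential_pdf. Qed.

Lemma integral_exp_kernel (l : R) (f : R -> \bar R) : (0 < l)%R ->
  nonneg_mfun f ->
  \int[leb]_x ((exp_kernel l x)%:E * f x) =
  \int[leb]_x ((exponential_pdf l x)%:E * f (- x)%R).
Proof.
move=> l0 [mf f0]; have mpdf := measurable_exponential_pdf_lebesgue l.
have pdf0 x : (0 <= exponential_pdf l x)%R by rewrite exponential_pdf_ge0// ltW.
rewrite -(@ge0_integral_lebesgueN (fun x => (exponential_pdf l x)%:E * f (- x)%R)); last first.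
  split; last by move=> x; apply: mule_ge0; [rewrite lee_fin|exact: f0].
  apply: emeasurable_funM; first exact/measurable_EFinP.
  by apply: measurableT_comp => //; exact: measurable_funN.
apply: ae_eq_integral => //.
- by apply: emeasurable_funM => //; apply/measurable_EFinP; exact: (measurable_exp_kernel l).
- apply: emeasurable_funM.
    by apply/measurable_EFinP; exact: (measurableT_comp mpdf).
  by apply: measurableT_comp => //; do 2 apply: measurable_funN.
- exists [set 0%R]; split => //; first exact: lebesgue_measure_set1.
  move=> x /= h; apply: contrapT => x0; apply: h => _.
  rewrite opprK; congr (_%:E * _); rewrite /exp_kernel.
  have [xl|xg|xe] := ltgtP x 0%R; last by rewrite xe in x0.
    by rewrite exponential_pdfE ?oppr_ge0 ?ltW// mulrNN.
  by rewrite lt0_exponential_pdf// oppr_lt0.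
Qed.

Lemma integral_exp_kernel1 (l : R) : (0 < l)%R ->
  \int[leb]_x (exp_kernel l x)%:E = 1.
Proof.
move=> l0; rewrite -(integral_exponential_pdf l0).
have := @integral_exp_kernel l (cst 1) l0 (conj (measurable_cst _) (fun _ => lee01)).
by under eq_integral do rewrite mule1; under [RHS]eq_integral do rewrite mule1.
Qed.

Lemma conv_exponential (l : R) d (T : measurableType d) (P : probability T R)
    (E : {RV P >-> R}) (g : R -> \bar R) (u : R) : (0 < l)%R ->
  (forall A : set R, measurable A -> P (E @^-1` A) = exponential_prob l A) ->
  nonneg_mfun g ->
  conv P (fun w => - E w)%R (cst 1%R) g u = conv leb id (exp_kernel l) g u.
Proof.
move=> l0 hE hg; have [mg g0] := hg.
pose f x := g (u + x)%R.
have mf : measurable_fun setT f by apply: measurableT_comp => //; exact: measurable_funD.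
have hf : nonneg_mfun f by split => // x; exact: g0.
transitivity (\int[P]_w f (E w)).
  by rewrite convE; apply: eq_integral => w _; rewrite mul1e opprK.
pose nu : {measure set R -> \bar R} := distribution P E.
transitivity (\int[nu]_x f x).
  by rewrite ge0_integral_distribution// => y; case: hf.
have mpdf := measurable_exponential_pdf_lebesgue l.
have pdf0 x : (0 <= exponential_pdf l x)%R by rewrite exponential_pdf_ge0// ltW.
transitivity (\int[leb]_x ((exponential_pdf l x)%:E * f x)).
  (* The law of [E] lives on [R], Lebesgue measure on [measurableTypeR R]; the pushforward under the
     identity only carries the law from one measurable structure to the other. *)
  have mid' : measurable_fun setT (id : R -> RR) by [].
  pose pf : {measure set RR -> \bar R} := pushforward nu (id : R -> RR).
  transitivity (\int[pf mid']_x f x).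
    by rewrite (@ge0_integral_pushforward _ _ R RR R id mid')// => y _; case: hf.
  have hf' : @nonneg_mfun _ RR R f by split; [exact: mf|case: hf].
  apply: (ge0_integral_density mpdf pdf0 hf') => A mA.
  exact: hE.
rewrite convE (@integral_exp_kernel l (fun x => g (u - x)%R))//; last first.
  by split => //; apply: measurableT_comp => //; exact: measurable_funB.
by apply: eq_integral => x _; rewrite opprK.
Qed.

End lebesgue.

(** * Elimination of the exponential density *)

Section balance.
Local Open Scope ereal_scope.
Context (R : realType).
Local Notation RR := (measurableTypeR R).
Local Notation leb := (@lebesgue_measure R).

(** Convolution with it is [l] times the integral over a window of length [y] to the left of [u].
    Averaging over a claim size [y] turns it into [l] P(U > s), the kernel of the renewal
    equation. *)
Definition box_kernel (l y s : R) : R := if (0 <= s < y)%R then l else 0%R.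

Lemma box_kernel_ge0 l y s : (0 <= l)%R -> (0 <= box_kernel l y s)%R.
Proof. by rewrite /box_kernel; case: ifP. Qed.

Lemma measurable_box_kernel l y : measurable_fun setT (box_kernel l y).
Proof.
apply: measurable_fun_ifT => //; apply: measurable_and.
  exact: measurable_fun_ler.
exact: measurable_fun_ltr.
Qed.

Lemma integral_expN_itv (l r a b : R) : (a < b)%R ->
  \int[leb]_(s in `]a, b[) (l * (l * expR (l * (r - s))))%:E =
  (l * expR (l * (r - a)) - l * expR (l * (r - b)))%:E.
Proof.
move=> ab.
have cf : continuous (fun s : R => l * (l * expR (l * (r - s))))%R.
  move=> s; apply: cvgM; first exact: cvg_cst.
  apply: cvgM; first exact: cvg_cst.
  apply: continuous_comp; last exact: continuous_expR.
  apply: cvgM; first exact: cvg_cst.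
  by apply: cvgB; [exact: cvg_cst|exact: cvg_id].
have cF : continuous (fun s : R => - (l * expR (l * (r - s))))%R.
  move=> s; apply: cvgN.
  apply: cvgM; first exact: cvg_cst.
  apply: continuous_comp; last exact: continuous_expR.
  apply: cvgM; first exact: cvg_cst.
  by apply: cvgB; [exact: cvg_cst|exact: cvg_id].
have dF (x : R) : is_derive x (1 : R)%R (fun s : R => - (l * expR (l * (r - s))))%R
    (l * (l * expR (l * (r - x))))%R.
  apply: is_derive_eq.
  rewrite add0r mul1r /GRing.scale/=; ring.
rewrite -(@integral_itv_bndoo _ a b (fun s => (l * (l * expR (l * (r - s))))%:E) true false); last first.
  apply/measurable_EFinP; apply: measurable_funTS.
  exact: continuous_measurable_fun.
rewrite (@continuous_FTC2 _ (fun s => l * (l * expR (l * (r - s))))%R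
  (fun s : R => - (l * expR (l * (r - s))))%R)//.
- by rewrite -EFinB opprK addrC.
- exact: continuous_subspaceT.
- split.
  + by move=> x _; apply: ex_derive.
  + by apply: cvg_at_right_filter; exact: cF.
  + by apply: cvg_at_left_filter; exact: cF.
- by move=> x _; rewrite derive1E; apply: derive_val.
Qed.

(** The kernel form of [conv_exp_balance]. On the negative half-line the kernel k satisfies k' = l
    k, which gives the exponential terms by the fundamental theorem of calculus; its jump from [l]
    to 0 at the origin is met inside the window exactly when 0 <= r < y, and produces the box on the
    right. *)
Lemma exp_kernel_balance (l y r : R) : (0 <= y)%R ->
  (exp_kernel l (r - y))%:E +
    \int[leb]_s ((box_kernel l y s)%:E * (exp_kernel l (r - s))%:E) =
  (exp_kernel l r)%:E + (box_kernel l y r)%:E.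
Proof.
(* The integrand lives on 0 <= s < y and s > r, so up to the point 0 its support is []a, y[]. *)
move=> y0; pose a := Num.max 0%R r.
have e : \int[leb]_s ((box_kernel l y s)%:E * (exp_kernel l (r - s))%:E) =
    \int[leb]_(s in `]a, y[) (l * (l * expR (l * (r - s))))%:E.
  rewrite [RHS]integral_mkcond.
  apply: ae_eq_integral => //.
  - apply: emeasurable_funM; apply/measurable_EFinP.
      exact: (measurable_box_kernel l y).
    apply: measurableT_comp; first exact: measurable_exp_kernel.
    exact: measurable_funB.
  - apply/(measurable_restrictT _ _).1 => //.
    apply/measurable_EFinP; apply: measurable_funTS; do 2 apply: measurable_funM => //.
    apply: measurableT_comp => //; apply: measurable_funM => //.
    exact: measurable_funB.
  exists [set 0%R]; split => //; first exact: lebesgue_measure_set1.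
  move=> s /= h; apply: contrapT => s0; apply: h => _.
  rewrite patchE mem_setE in_itv/= gt_max /box_kernel /exp_kernel subr_lt0 le0r.
  move/eqP/negPf : s0 => -> /=.
  have [s0|s0] := ltP 0%R s; last by rewrite mul0e.
  have [sy|sy]/= := ltP s y; last by rewrite mul0e andbF.
  by rewrite andbT; case: ifP; rewrite ?mule0// EFinM.
rewrite e; have [ay|ya] := ltP a y; last first.
  rewrite set_itv_ge ?integral_set0 ?adde0 -?leNgt ?bnd_simp//.
  have [y00|yn0] := eqVneq y 0%R.
    by rewrite y00 subr0 /box_kernel; case: andP => [[? /le_lt_trans]|_];
       [move=> /(_ _ ltac:(eassumption)); rewrite ltxx|rewrite adde0].
  have yr : (y <= r)%R.
    by move: ya; rewrite /a le_max => /orP[|//]; rewrite leNgt lt_neqAle eq_sym yn0 y0.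
  rewrite /exp_kernel /box_kernel subr_lt0 !ltNge yr (le_trans y0 yr)/=.
  by rewrite adde0.
rewrite integral_expN_itv// /exp_kernel /box_kernel subr_lt0.
move: ay; rewrite gt_max => /andP[y0' ry]; rewrite ry/=.
have [r0|r0] := leP 0%R r.
  by rewrite /a max_r// subrr mulr0 expR0 mulr1 -EFinD addrC subrK add0e.
rewrite /a max_l ?ltW// subr0 adde0.
by rewrite -EFinD addrC subrK.
Qed.

(* [G = exp_kernel l * g] solves [G' = l (G - g)]; this is the integral form,
   which needs no regularity of [g]. *)
Lemma conv_exp_balance (l : R) (g : R -> \bar R) (u y : R) :
  (0 <= l)%R -> (0 <= y)%R -> nonneg_mfun g ->
  let G := conv leb id (exp_kernel l) g in
  G (u - y)%R + conv leb id (box_kernel l y) G u =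
  G u + conv leb id (box_kernel l y) g u.
Proof.
move=> l0 y0 [mg g0] /=.
have mid : measurable_fun setT (id : RR -> R) by [].
have me : measurable_fun setT (exp_kernel l : RR -> R) by exact: measurable_exp_kernel.
have mb : measurable_fun setT (box_kernel l y : RR -> R) by exact: measurable_box_kernel.
have e0 x : (0 <= exp_kernel l x)%R by exact: exp_kernel_ge0.
have b0 x : (0 <= box_kernel l y x)%R by exact: box_kernel_ge0.
(* Translation invariance moves the shift from [g] to the kernel: all terms become integrals against
   the same g(u - r), where [exp_kernel_balance] applies pointwise. *)
have shift v s : conv leb id (exp_kernel l) g (v - s)%R =
    \int[leb]_r ((exp_kernel l (r - s))%:E * g (v - r)%R).
  rewrite convE -(@ge0_integral_lebesgue_shift R
    (fun r => (exp_kernel l (r - s))%:E * g (v - r)%R) s).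
    apply: eq_integral => x _; rewrite addrK; congr (_ * g _).
    by rewrite opprD addrA addrAC.
  split.
    apply: emeasurable_funM.
      apply/measurable_EFinP; apply: measurableT_comp; first exact: measurable_exp_kernel.
      exact: measurable_funB.
    by apply: measurableT_comp => //; exact: measurable_funB.
  by move=> x; apply: mule_ge0; [rewrite lee_fin|exact: g0].
pose W r := \int[leb]_s ((box_kernel l y s)%:E * (exp_kernel l (r - s))%:E).
have W0 r : 0 <= W r by apply: integral_ge0 => s _; rewrite mule_ge0// lee_fin.
pose f (p : RR * RR) := (box_kernel l y p.1)%:E *
  ((exp_kernel l (p.2 - p.1))%:E * g (u - p.2)%R).
have m1 : measurable_fun setT (fst : RR * RR -> RR) by exact: measurable_fst.
have m2 : measurable_fun setT (snd : RR * RR -> RR) by exact: measurable_snd.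
have mf : measurable_fun setT f.
  apply: emeasurable_funM.
    by apply/measurable_EFinP; apply: (measurableT_comp mb).
  apply: emeasurable_funM.
    apply/measurable_EFinP; apply: (measurableT_comp me).
    exact: measurable_funB.
  apply: measurableT_comp => //; exact: measurable_funB.
have f0 p : 0 <= f p by rewrite !mule_ge0// lee_fin.
have mW : measurable_fun setT (W : RR -> \bar R).
  pose h (p : RR * RR) := (box_kernel l y p.2)%:E * (exp_kernel l (p.1 - p.2))%:E.
  apply: (measurable_fun_fubini_tonelli_F (m2 := leb) h).
    apply: emeasurable_funM; apply/measurable_EFinP.
      exact: (measurableT_comp mb).
    apply: (measurableT_comp me); exact: measurable_funB.
  by move=> p; rewrite mule_ge0// lee_fin.
have mgu : measurable_fun setT (fun r : RR => g (u - r)%R).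
  by apply: measurableT_comp => //; exact: measurable_funB.
have -> : conv leb id (box_kernel l y) (conv leb id (exp_kernel l) g) u =
    \int[leb]_r (W r * g (u - r)%R).
  transitivity (\int[leb]_s \int[leb]_r f (s, r)).
    rewrite convE; apply: eq_integral => s _; rewrite shift -ge0_integralZl_EFin//.
      by move=> r _; rewrite mule_ge0// lee_fin.
    apply: emeasurable_funM => //; apply/measurable_EFinP.
    by apply: (measurableT_comp me); exact: measurable_funB.
  rewrite (fubini_tonelli f)//; apply: eq_integral => r _.
  rewrite /W -ge0_integralZr//.
  - by apply: eq_integral => s _; rewrite /f/= muleA.
  - apply: emeasurable_funM; apply/measurable_EFinP => //.
    by apply: (measurableT_comp me); exact: measurable_funB.
  - by move=> s _; rewrite mule_ge0// lee_fin.
have mel : measurable_fun setT (fun r : RR => (exp_kernel l (r - y))%:E).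
  by apply/measurable_EFinP; apply: (measurableT_comp me); exact: measurable_funB.
rewrite shift -ge0_integralD//; last 4 first.
- by move=> r _; rewrite mule_ge0// lee_fin.
- exact: emeasurable_funM.
- by move=> r _; rewrite mule_ge0.
- exact: emeasurable_funM.
rewrite !convE -ge0_integralD//; last 4 first.
- by move=> r _; rewrite mule_ge0// lee_fin.
- by apply: emeasurable_funM => //; exact/measurable_EFinP.
- by move=> r _; rewrite mule_ge0// lee_fin.
- by apply: emeasurable_funM => //; exact/measurable_EFinP.
apply: eq_integral => r _.
rewrite -ge0_muleDl ?lee_fin// exp_kernel_balance//.
by rewrite ge0_muleDl ?lee_fin.
Qed.
End balance.

(** * Tail functions, total mass and vanishing at infinity *)

(** The tail of the constant 0: every other tail arises from it by convolution, and it starts the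
    Lindley iteration. *)
Definition neg_ind (R : realType) (u : R) : \bar R := if u < 0 then 1%E else 0%E.

Section tails.
Local Open Scope ereal_scope.
Context (R : realType).
Implicit Types g h : R -> \bar R.

Lemma nonneg_neg_ind : nonneg_mfun (@neg_ind R).
Proof.
split; last by move=> u; rewrite /neg_ind; case: ifP.
by apply: measurable_fun_ifT => //; exact: measurable_fun_ltr.
Qed.

Lemma neg_ind_le1 (u : R) : neg_ind u <= 1.
Proof. by rewrite /neg_ind; case: ifP. Qed.

Lemma neg_ind_nincr (x y : R) : (x <= y)%R -> neg_ind y <= neg_ind x.
Proof.
move=> xy; rewrite /neg_ind; case: ifPn => y0; last by case: ifP.
by rewrite ifT//; lra.
Qed.

Lemma nonneg_cst (c : \bar R) : 0 <= c -> nonneg_mfun (fun _ : R => c).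
Proof. by split => //; exact: measurable_cst. Qed.

Lemma nonneg_add g h : nonneg_mfun g -> nonneg_mfun h -> nonneg_mfun (g \+ h).
Proof.
move=> [mg g0] [mh h0]; split; first exact: emeasurable_funD.
by move=> u; exact: adde_ge0.
Qed.

Lemma nonneg_scale (c : R) g : (0 <= c)%R -> nonneg_mfun g ->
  nonneg_mfun (fun u => c%:E * g u).
Proof.
move=> c0 [mg g0]; split; first exact: emeasurable_funM.
by move=> u; exact: mule_ge0.
Qed.

Lemma ge0_le_EFin (x : \bar R) (c : R) : 0 <= x -> x <= c%:E ->
  exists r : R, x = r%:E.
Proof. by case: x => // r _ _; exists r. Qed.

Lemma cvg_to0P (x_ : nat -> \bar R) : (forall n, 0 <= x_ n) ->
  (forall e : R, (0 < e)%R -> \forall n \near \oo, x_ n <= e%:E) ->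
  x_ n @[n --> \oo] --> 0.
Proof.
move=> x0 xe; apply/fine_cvgP; split.
  near=> n; have : x_ n <= 1%:E by near: n; exact: xe.
  by move/(ge0_le_EFin (x0 n)) => [r ->].
apply/cvgrPdist_le => e e0; near=> n.
have xne : x_ n <= e%:E by near: n; exact: xe.
have [r xr] := ge0_le_EFin (x0 n) xne.
have := x0 n; move: xne; rewrite /= xr /= !lee_fin => re r0.
by rewrite sub0r normrN ger0_norm.
Unshelve. all: by end_near. Qed.

Context d (T : measurableType d) (m : {sigma_finite_measure set T -> \bar R}).
Variables (j k : T -> R).
Hypothesis mj : measurable_fun setT j.
Hypothesis mk : measurable_fun setT k.
Hypothesis k0 : forall x, (0 <= k x)%R.
Variable rho : R.
Hypothesis krho : \int[m]_x (k x)%:E = rho%:E.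

Lemma conv_cst (c : R) u : (0 <= c)%R -> conv m j k (fun=> c%:E) u = (c * rho)%:E.
Proof.
move=> c0; rewrite convE EFinM -krho -ge0_integralZl_EFin//.
- by apply: eq_integral => x _; rewrite muleC.
- by move=> x _; rewrite lee_fin.
- exact/measurable_EFinP.
Qed.

Lemma conv_le_cst g (c : R) u : (0 <= c)%R -> nonneg_mfun g ->
  (forall x, g x <= c%:E) -> conv m j k g u <= (c * rho)%:E.
Proof.
move=> c0 hg gc; rewrite -(conv_cst u c0).
by apply: le_conv => //; exact: nonneg_cst.
Qed.

(** Stated along the integers, as dominated convergence is for sequences; quantifying over every
    shift [s] makes the property pass through a convolution. *)
Definition vanishes g := forall s : R, g (n%:R - s)%R @[n --> \oo] --> 0.

Lemma vanishes_conv g : nonneg_mfun g -> (forall x, g x <= 1) -> vanishes g ->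
  vanishes (conv m j k g).
Proof.
move=> hg g1 vg s; under eq_fun do rewrite convE.
rewrite (_ : 0 = \int[m]_x (cst 0 x)); last by rewrite integral0.
have mf n : measurable_fun setT (fun x => (k x)%:E * g (n%:R - s - j x)%R).
  exact: measurable_conv_integrand.
apply: (@dominated_cvg _ _ _ m _ measurableT _ _ (fun x => (k x)%:E)) => //.
- move=> x _; rewrite [X in _ --> X](_ : _ = (k x)%:E * 0); last by rewrite mule0.
  apply: cvgeZl => //.
  by under eq_fun do rewrite -addrA -opprD; exact: vg.
- apply/integrableP; split; first exact/measurable_EFinP.
  under eq_integral do rewrite gee0_abs ?lee_fin//.
  by rewrite krho ltry.
- move=> n x _; rewrite gee0_abs; last by apply: mule_ge0; [rewrite lee_fin|case: hg].
  by rewrite -[leRHS]mule1; apply: lee_wpmul2l; [rewrite lee_fin|].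
Qed.

End tails.

Lemma vanishes_neg_ind (R : realType) : vanishes (@neg_ind R).
Proof.
move=> s; apply: cvg_near_cst; near=> n; rewrite /neg_ind ifF// subr_lt0.
apply/negbTE; rewrite -leNgt; near: n; exact: nbhs_infty_ger.
Unshelve. all: by end_near. Qed.

(** * A solution of the renewal equation by monotone iteration *)

Section renewal.
Local Open Scope ereal_scope.
Context (R : realType) (b : measurableTypeR R -> R) (rho : R).
Local Notation leb := (@lebesgue_measure R).
Hypothesis mb : measurable_fun setT b.
Hypothesis b0 : forall x, (0 <= b x)%R.
Hypothesis bneg : forall x, (x < 0)%R -> b x = 0%R.
Hypothesis brho : \int[leb]_x (b x)%:E = rho%:E.
Hypothesis rho0 : (0 <= rho)%R.
Hypothesis rho1 : (rho < 1)%R.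
Let mid : measurable_fun setT (id : measurableTypeR R -> R).
Proof. by []. Qed.
Let B := conv leb id b.
Implicit Types g h : R -> \bar R.

Let nB g : nonneg_mfun g -> nonneg_mfun (B g).
Proof. exact: nonneg_conv. Qed.

Definition renewal_map g (u : R) : \bar R := (1 - rho)%:E * neg_ind u + B g u.

Let nI : nonneg_mfun (fun u => (1 - rho)%:E * @neg_ind R u).
Proof. by apply: nonneg_scale; [rewrite subr_ge0 ltW|exact: nonneg_neg_ind]. Qed.

Lemma nonneg_renewal_map g : nonneg_mfun g -> nonneg_mfun (renewal_map g).
Proof. by move=> hg; exact: nonneg_add (nI) (nB hg). Qed.

Lemma le_renewal_map g h u : nonneg_mfun g -> nonneg_mfun h ->
  (forall x, g x <= h x) -> renewal_map g u <= renewal_map h u.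
Proof. by move=> hg hh gh; apply: leeD => //; exact: le_conv. Qed.

Lemma B_neg g u : (forall x, (x < 0)%R -> g x = 1) -> (u < 0)%R -> B g u = rho%:E.
Proof.
move=> g1 u0; rewrite -brho /B convE; apply: eq_integral => x _.
have [x0|x0] := ltP x 0%R; first by rewrite bneg// mul0e.
by rewrite g1 ?mule1//; lra.
Qed.

Lemma renewal_map_neg g u : (forall x, (x < 0)%R -> g x = 1) -> (u < 0)%R ->
  renewal_map g u = 1.
Proof.
by move=> g1 u0; rewrite /renewal_map B_neg// /neg_ind u0 mule1 -EFinD subrK.
Qed.

Lemma renewal_map_le1 g u : nonneg_mfun g -> (forall x, g x <= 1) ->
  renewal_map g u <= 1.
Proof.
move=> hg g1; rewrite (_ : 1 = (1 - rho)%:E * 1 + (1 * rho)%:E); last first.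
  by rewrite mule1 mul1r -EFinD subrK.
apply: leeD; last exact: (conv_le_cst _ _ _ brho).
by apply: lee_wpmul2l; [rewrite lee_fin subr_ge0 ltW|exact: neg_ind_le1].
Qed.

Let r_ n := iter n renewal_map (@neg_ind R).

Let nr n : nonneg_mfun (r_ n).
Proof. elim: n => [|n ih] /=; [exact: nonneg_neg_ind|exact: nonneg_renewal_map]. Qed.

Let r1 n u : r_ n u <= 1.
Proof. elim: n u => [|n ih] u /=; [exact: neg_ind_le1|exact: renewal_map_le1]. Qed.

Let rneg n u : (u < 0)%R -> r_ n u = 1.
Proof.
elim: n u => [|n ih] u u0 /=; first by rewrite /neg_ind u0.
by rewrite renewal_map_neg.
Qed.

Let rS n u : r_ n u <= r_ n.+1 u.
Proof.
elim: n u => [|n ih] u; last by apply: le_renewal_map; [exact: (nr n)|exact: (nr n.+1)|exact: ih].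
have [u0|u0] := ltP u 0%R; first by rewrite !rneg.
by rewrite /r_ /= {1}/neg_ind ltNge u0/=; case: (nonneg_renewal_map (nonneg_neg_ind R)).
Qed.

Let rhomo u : {homo r_^~ u : n n' / (n <= n')%N >-> n <= n'}.
Proof. by apply/nondecreasing_seqP => n; exact: rS. Qed.

(** Constructed in order to lie above the Lindley iterates and to hand its vanishing at infinity
    over to their limit. *)
Definition renewal_sol (u : R) : \bar R := limn (r_^~ u).

Let cvg_r u : r_ n u @[n --> \oo] --> renewal_sol u.
Proof. by rewrite /renewal_sol; apply: ereal_nondecreasing_is_cvgn; exact: rhomo. Qed.

Lemma nonneg_renewal_sol : nonneg_mfun renewal_sol.
Proof.
split.
  apply: (emeasurable_fun_cvg r_) => [n|x _]; last exact: cvg_r.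
  by case: (nr n).
move=> u; apply: lime_ge; first exact: cvgP (cvg_r (u := u)).
by apply: nearW => n; case: (nr n).
Qed.

Lemma renewal_sol_le1 u : renewal_sol u <= 1.
Proof.
apply: lime_le; first exact: cvgP (cvg_r (u := u)).
by apply: nearW => n; exact: r1.
Qed.

Lemma neg_ind_le_renewal_sol u : neg_ind u <= renewal_sol u.
Proof.
apply: lime_ge; first exact: cvgP (cvg_r (u := u)).
by apply: nearW => n; exact: (rhomo u (leq0n n)).
Qed.

Lemma renewal_solE u : renewal_sol u = renewal_map renewal_sol u.
Proof.
have h1 : r_ n.+1 u @[n --> \oo] --> renewal_sol u by rewrite (cvg_shiftS (r_^~ u)).
have h2 : r_ n.+1 u @[n --> \oo] --> renewal_map renewal_sol u.
  have hB : B (r_ n) u @[n --> \oo] --> B renewal_sol u by exact: conv_cvg.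
  apply: cvgeD => //; last exact: cvg_cst.
  rewrite ge0_adde_def// inE.
    by rewrite mule_ge0//; [rewrite lee_fin subr_ge0 ltW|case: (nonneg_neg_ind R)].
  by case: (nB nonneg_renewal_sol).
by rewrite -(cvg_lim _ h1)// (cvg_lim _ h2).
Qed.

(** Each application of [renewal_map] shrinks a constant error by the factor [rho]. The iterates,
    each of which vanishes at infinity, thus approach the solution uniformly, and it vanishes
    too. *)
Let sol_le n u : renewal_sol u <= r_ n u + (rho ^+ n)%:E.
Proof.
elim: n u => [|n ih] u.
  rewrite expr0 (le_trans (renewal_sol_le1 u))// leeDr//.
  exact: (nr 0).2.
rewrite renewal_solE (_ : r_ n.+1 u = renewal_map (r_ n) u)// /renewal_map -addeA leeD2l//.
have rn0 : (0 <= rho ^+ n)%R by rewrite exprn_ge0.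
have hc := @nonneg_cst R (rho ^+ n)%:E rn0.
have := le_conv leb mid mb b0 u nonneg_renewal_sol (nonneg_add (nr n) hc) ih.
move/le_trans; apply.
by rewrite convD// (conv_cst _ _ _ brho)// exprSr.
Qed.

Lemma vanishes_renewal_sol : vanishes renewal_sol.
Proof.
have vr n : vanishes (r_ n).
  elim: n => [|n ih] /=; first exact: vanishes_neg_ind.
  move=> s; rewrite -[0%E]adde0; apply: cvgeD => //.
    rewrite -(mule0 (1 - rho)%:E); apply: cvgeZl => //; exact: vanishes_neg_ind.
  by apply: vanishes_conv => //; exact: brho.
move=> s; apply: cvg_to0P => [n|e e0]; first by case: nonneg_renewal_sol.
have : \forall n \near \oo, (rho ^+ n <= e / 2)%R.
  have /cvgrPdist_le/(_ (e / 2)%R) : (rho ^+ n)%R @[n --> \oo] --> (0 : R)%R.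
    by apply: cvg_expr; rewrite ger0_norm.
  rewrite divr_gt0// => /(_ isT); apply: filterS => n.
  by rewrite sub0r normrN ger0_norm// exprn_ge0.
move=> [n _ /(_ n (leqnn n)) hn].
have := vr n s; move=> /fine_cvgP[fr /cvgrPdist_le /(_ (e / 2)%R)].
rewrite divr_gt0// => /(_ isT) hr; near=> k.
apply: (le_trans (sol_le n _)).
have h1 : r_ n (k%:R - s)%R \is a fin_num by near: k; exact: fr.
have h2 : (`|0 - fine (r_ n (k%:R - s))| <= e / 2)%R by near: k; exact: hr.
move: h2; rewrite sub0r normrN => h2.
rewrite -(fineK h1) -EFinD lee_fin (splitr e) lerD//.
by apply: le_trans h2; rewrite ler_norm.
Unshelve. all: by end_near. Qed.

End renewal.

(** * From the Lindley fixed point to the Pollaczek-Khinchine renewal equation *)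

Section pk.
Local Open Scope ereal_scope.
Context (R : realType) d (T : measurableType d) (P : probability T R)
  (U : {RV P >-> R}) (l rho : R).
Local Notation RR := (measurableTypeR R).
Local Notation leb := (@lebesgue_measure R).

Definition claim_kernel (s : R) : R :=
  if (0 <= s)%R then (l * fine (ccdf U s))%R else 0%R.

Lemma claim_kernel_ge0 s : (0 <= l)%R -> (0 <= claim_kernel s)%R.
Proof.
by move=> l0; rewrite /claim_kernel; case: ifP => // _; rewrite mulr_ge0// fine_ge0.
Qed.

Lemma measurable_claim_kernel : measurable_fun setT claim_kernel.
Proof.
apply: measurable_fun_ifT => //; first exact: measurable_fun_ler.
apply: measurable_funM => //; apply: measurableT_comp => //.
exact: ccdf_measurable.
Qed.

Lemma claim_kernel_neg s : (s < 0)%R -> claim_kernel s = 0%R.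
Proof. by move=> s0; rewrite /claim_kernel leNgt s0. Qed.

Hypothesis l0 : (0 < l)%R.
Let l0' : (0 <= l)%R. Proof. exact: ltW. Qed.
Hypothesis U0 : {ae P, forall w, (0 <= U w)%R}.

Let mid : measurable_fun setT (id : RR -> R). Proof. by []. Qed.
Let mk : measurable_fun setT (claim_kernel : RR -> R).
Proof. exact: measurable_claim_kernel. Qed.
Let me : measurable_fun setT (exp_kernel l : RR -> R).
Proof. exact: measurable_exp_kernel. Qed.
Let e0 x : (0 <= exp_kernel l x)%R. Proof. exact: exp_kernel_ge0. Qed.
Let k0 x : (0 <= claim_kernel x)%R. Proof. exact: claim_kernel_ge0. Qed.

Let Ex := conv leb id (exp_kernel l).
Let B := conv leb id claim_kernel.
Let C1 := conv P U (cst 1%R).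

Lemma integral_box_kernel (s : R) :
  \int[P]_w (box_kernel l (U w) s)%:E = (claim_kernel s)%:E.
Proof.
rewrite /claim_kernel; case: ifP => s0; last first.
  by apply: integral0_eq => w _; rewrite /box_kernel s0.
rewrite EFinM fineK ?fin_num_measure// /ccdf /distribution /pushforward.
set A := _ @^-1` _.
have mA : measurable A by rewrite /A -[_ @^-1` _]setTI; exact: measurable_funP.
rewrite -(setIT A) -(integral_indic P measurableT mA) -ge0_integralZl_EFin//.
- apply: eq_integral => w _; rewrite /box_kernel s0/= indicE.
  rewrite /A; case: ifP => h; last first.
    by rewrite memNset ?mulr0 ?mule0//= in_itv/= andbT h.
  by rewrite mem_set ?mule1//= in_itv/= andbT h.
- exact/measurable_EFinP/measurable_indic.
Qed.

Lemma measurable_box_kernel2 :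
  measurable_fun setT (fun p : T * RR => box_kernel l (U p.1) p.2).
Proof.
have m1 : measurable_fun setT (fst : T * RR -> T) by exact: measurable_fst.
have m2 : measurable_fun setT (snd : T * RR -> RR) by exact: measurable_snd.
apply: measurable_fun_ifT => //; apply: measurable_and.
  exact: measurable_fun_ler.
by apply: measurable_fun_ltr => //; exact: measurableT_comp.
Qed.

Lemma conv_claim_kernel (f : R -> \bar R) (u : R) : nonneg_mfun f ->
  \int[P]_w conv leb id (box_kernel l (U w)) f u = B f u.
Proof.
move=> [mf f0].
have mfu : measurable_fun setT (fun s : RR => f (u - s)%R).
  by apply: measurableT_comp => //; exact: measurable_funB.
under eq_integral do rewrite convE.
rewrite /B convE (fubini_tonelli (m2 := leb)
    (fun p : T * RR => (box_kernel l (U p.1) p.2)%:E * f (u - p.2)%R)).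
- apply: eq_integral => s _; rewrite /= ge0_integralZr//.
  + by rewrite integral_box_kernel.
  + apply/measurable_EFinP.
    exact: (measurableT_comp measurable_box_kernel2 (measurable_pair2 s)).
  + by move=> w _; rewrite lee_fin box_kernel_ge0.
- apply: emeasurable_funM; first by apply/measurable_EFinP; exact: measurable_box_kernel2.
  exact: (measurableT_comp mfu measurable_snd).
- by move=> p; rewrite mule_ge0// lee_fin box_kernel_ge0.
Qed.

Lemma measurable_conv_box (f : R -> \bar R) (u : R) : nonneg_mfun f ->
  measurable_fun setT (fun w => conv leb id (box_kernel l (U w)) f u).
Proof.
move=> [mf f0].
have mfu : measurable_fun setT (fun s : RR => f (u - s)%R).
  by apply: measurableT_comp => //; exact: measurable_funB.
under eq_fun do rewrite convE.
apply: (measurable_fun_fubini_tonelli_F (m2 := leb)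
    (fun p : T * RR => (box_kernel l (U p.1) p.2)%:E * f (u - p.2)%R)).
- apply: emeasurable_funM; first by apply/measurable_EFinP; exact: measurable_box_kernel2.
  exact: (measurableT_comp mfu measurable_snd).
- by move=> p; rewrite mule_ge0// lee_fin box_kernel_ge0.
Qed.

(* [conv_exp_balance] averaged over the claim size. *)
Lemma claim_balance (g : R -> \bar R) (u : R) : nonneg_mfun g ->
  C1 (Ex g) u + B (Ex g) u = Ex g u + B g u.
Proof.
move=> hg; have hG : nonneg_mfun (Ex g) by exact: nonneg_conv.
have c0 f w v : nonneg_mfun f -> 0 <= conv leb id (box_kernel l (U w)) f v.
  move=> hf; rewrite convE; apply: integral_ge0 => s _.
  by apply: mule_ge0; [rewrite lee_fin box_kernel_ge0|case: hf].
have mC : measurable_fun setT (fun w => Ex g (u - U w)%R).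
  exact: measurable_shift.
have -> : C1 (Ex g) u = \int[P]_w Ex g (u - U w)%R.
  by rewrite /C1 convE; apply: eq_integral => w _; rewrite mul1e.
rewrite -!conv_claim_kernel// -ge0_integralD//; last 3 first.
- by move=> w _; exact: hG.2.
- by move=> w _; exact: c0.
- exact: measurable_conv_box.
have -> : Ex g u = \int[P]_w (cst (Ex g u) w).
  rewrite integral_cst// [X in _ * X](_ : _ = 1) ?mule1//; exact: probability_setT.
rewrite -ge0_integralD//; last 3 first.
- by move=> w _; exact: hG.2.
- by move=> w _; exact: c0.
- exact: measurable_conv_box.
apply: ae_eq_integral => //.
- by apply: emeasurable_funD => //; exact: measurable_conv_box.
- by apply: emeasurable_funD => //; exact: measurable_conv_box.
by apply: filterS U0 => w Uw _; exact: conv_exp_balance.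
Qed.

Hypothesis krho : \int[leb]_s (claim_kernel s)%:E = rho%:E.
Hypothesis rho1 : (rho < 1)%R.
Let rho0 : (0 <= rho)%R.
Proof. by rewrite -lee_fin -krho; apply: integral_ge0 => s _; rewrite lee_fin. Qed.

(** If [g] is the tail of V, this is the tail of max(0, U + V - E) for independent U, V, E; the
    value 1 on negative arguments is the effect of the maximum with 0. *)
Definition lindley_map (g : R -> \bar R) (u : R) : \bar R :=
  if (u < 0)%R then 1 else C1 (Ex g) u.

Let mU : measurable_fun setT U. Proof. by []. Qed.

Lemma nonneg_lindley_map g : nonneg_mfun g -> nonneg_mfun (lindley_map g).
Proof.
move=> hg.
have [mC C0] : nonneg_mfun (C1 (Ex g)) by apply: nonneg_conv => //; exact: nonneg_conv.
split; last by move=> u; rewrite /lindley_map; case: ifP.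
by apply: measurable_fun_ifT => //; exact: measurable_fun_ltr.
Qed.

Lemma le_lindley_map g h u : nonneg_mfun g -> nonneg_mfun h ->
  (forall x, g x <= h x) -> lindley_map g u <= lindley_map h u.
Proof.
move=> hg hh gh; rewrite /lindley_map; case: ifP => // _.
apply: le_conv => //; [exact: nonneg_conv..|move=> x].
exact: le_conv.
Qed.

Let Ex1 g u : nonneg_mfun g -> (forall x, g x <= 1) -> Ex g u <= 1.
Proof.
move=> hg g1.
by have := conv_le_cst mid me e0 (integral_exp_kernel1 l0) u ler01 hg g1; rewrite mulr1.
Qed.

(* The renewal solution is a fixed point of [lindley_map], hence dominates the
   iterates from [neg_ind] and forces their limit to vanish at infinity. *)
Lemma lindley_renewal_sol u :
  lindley_map (renewal_sol claim_kernel rho) u = renewal_sol claim_kernel rho u.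
Proof.
set r := renewal_sol _ _.
have hr : nonneg_mfun r by exact: (nonneg_renewal_sol mk k0 claim_kernel_neg krho rho1).
have r1 x : r x <= 1 by exact: (renewal_sol_le1 mk k0 claim_kernel_neg krho rho1).
have rE x : r x = renewal_map claim_kernel rho r x.
  by exact: (renewal_solE mk k0 claim_kernel_neg krho rho1).
have rneg x : (x < 0)%R -> r x = 1.
  move=> x0; apply/eqP; rewrite eq_le r1/=.
  have := neg_ind_le_renewal_sol mk k0 claim_kernel_neg krho rho1 x.
  by rewrite /neg_ind x0.
rewrite /lindley_map; case: ifPn => [u0|]; first by rewrite rneg.
rewrite -leNgt => u0.
have hEr : nonneg_mfun (Ex r) by exact: nonneg_conv.
have hBr : nonneg_mfun (B r) by exact: nonneg_conv.
have hI := nonneg_neg_ind R.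
have rBu : r u = B r u.
  by rewrite [LHS]rE /renewal_map /neg_ind ltNge u0/= mule0 add0e.
have r0' : (0 <= 1 - rho)%R by rewrite subr_ge0 ltW.
(* [Ex] of the indicator vanishes at u >= 0, so the renewal equation of [r] passes to [Ex r] there.
   This cancels [Ex r u] against [B (Ex r) u] in [claim_balance] and leaves C1 (Ex r) u = B r u = r
   u. *)
have Eru : Ex r u = B (Ex r) u.
  have -> : r = (fun x => (1 - rho)%:E * neg_ind x) \+ B r.
    by apply/funext => x; rewrite [LHS]rE.
  rewrite [LHS]convD//; last exact: nonneg_scale.
  rewrite convZ// [X in _ * X](_ : _ = 0); last first.
    rewrite convE; apply: integral0_eq => t _; rewrite /exp_kernel; case: ifP => t0; last by rewrite mul0e.
    rewrite /neg_ind ifF ?mule0//; apply/negbTE; rewrite -leNgt; lra.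
  rewrite mule0 add0e.
  rewrite -/B /Ex conv_comm//.
  congr (conv _ _ _ (conv _ _ _ _) _).
  by apply/funext => x; rewrite [LHS]rE.
have := claim_balance u hr.
rewrite -/B -Eru -rBu addeC.
have [x xE] := ge0_le_EFin (hEr.2 u) (Ex1 u hr r1).
by rewrite xE => /(congr1 (fun z => z - x%:E)); rewrite ![x%:E + _]addeC !addeK.
Qed.

Variable g : R -> \bar R.
Hypothesis cvg_g : forall u, iter n lindley_map (@neg_ind R) u @[n --> \oo] --> g u.

Let g_ n := iter n lindley_map (@neg_ind R).

Let ng n : nonneg_mfun (g_ n).
Proof. elim: n => [|n ih] /=; [exact: nonneg_neg_ind|exact: nonneg_lindley_map]. Qed.

Let gS n u : g_ n u <= g_ n.+1 u.
Proof.
elim: n u => [|n ih] u.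
  rewrite /g_ /= /lindley_map /neg_ind; case: ifP => // u0.
  have [] : nonneg_mfun (C1 (Ex (@neg_ind R))); last by move=> _; exact.
  by do 2 apply: nonneg_conv => //; exact: nonneg_neg_ind.
by apply: le_lindley_map; [exact: (ng n)|exact: (ng n.+1)|exact: ih].
Qed.

Let ghomo u : {homo g_^~ u : n n' / (n <= n')%N >-> n <= n'}.
Proof. by apply/nondecreasing_seqP => n; exact: gS. Qed.

Let g_le_sol n u : g_ n u <= renewal_sol claim_kernel rho u.
Proof.
have hr : nonneg_mfun (renewal_sol claim_kernel rho).
  by exact: (nonneg_renewal_sol mk k0 claim_kernel_neg krho rho1).
elim: n u => [|n ih] u.
  by exact: (neg_ind_le_renewal_sol mk k0 claim_kernel_neg krho rho1).
by rewrite -lindley_renewal_sol; exact: le_lindley_map.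
Qed.

Let hg : nonneg_mfun g.
Proof.
split.
  apply: (emeasurable_fun_cvg g_) => [n|x _]; last exact: cvg_g.
  by case: (ng n).
move=> u; rewrite -(cvg_lim _ (@cvg_g u))//; apply: lime_ge; first exact: cvgP (@cvg_g u).
by apply: nearW => n; exact: (ng n).2.
Qed.

Let g_le u : g u <= renewal_sol claim_kernel rho u.
Proof.
rewrite -(cvg_lim _ (@cvg_g u))//; apply: lime_le; first exact: cvgP (@cvg_g u).
by apply: nearW => n; exact: g_le_sol.
Qed.

Let g1 u : g u <= 1.
Proof. by apply: (le_trans (g_le u)); exact: (renewal_sol_le1 mk k0 claim_kernel_neg krho rho1). Qed.

Lemma vanishes_lindley_limit : vanishes g.
Proof.
have vr : vanishes (renewal_sol claim_kernel rho).
  by exact: (vanishes_renewal_sol mk k0 claim_kernel_neg krho rho0 rho1).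
move=> s; apply: (@squeeze_cvge _ _ _ _ (cst 0) _ (fun n => renewal_sol claim_kernel rho (n%:R - s))).
- by apply: nearW => n; rewrite g_le andbT; exact: hg.2.
- exact: cvg_cst.
- exact: vr.
Qed.

Let gneg u : (u < 0)%R -> g u = 1.
Proof.
move=> u0; rewrite -(cvg_lim _ (@cvg_g u))//; apply: cvg_lim => //.
apply: cvg_near_cst; apply: nearW => -[|n] /=.
  by rewrite /neg_ind u0.
by rewrite /lindley_map u0.
Qed.

Let gfix u : (0 <= u)%R -> g u = C1 (Ex g) u.
Proof.
move=> u0.
have h1 : g_ n.+1 u @[n --> \oo] --> g u by rewrite (cvg_shiftS (g_^~ u)); exact: cvg_g.
have h2 : g_ n.+1 u @[n --> \oo] --> C1 (Ex g) u.
  have -> : (fun n => g_ n.+1 u) = (fun n => C1 (Ex (g_ n)) u).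
    by apply/funext => n; rewrite /g_ /= /lindley_map ltNge u0.
  apply: conv_cvg => //; first by move=> n; exact: nonneg_conv.
    move=> x a b ab; apply: le_conv => // y; exact: ghomo.
  by move=> x; apply: conv_cvg.
by rewrite -(cvg_lim _ h1)// (cvg_lim _ h2).
Qed.

(** Put D = g - B g. The fixed point and [claim_balance], with [B] and [Ex] commuting, give D = Ex D
    on [0, +oo[, and (Ex D)' = l (Ex D - D) then makes D constant there. Since [g] and [B g] vanish
    at infinity, the constant is 0. *)
Lemma pollaczek_khinchine_renewal u : g u = renewal_map claim_kernel rho g u.
Proof.
have [u0|u0] := ltP u 0%R.
  rewrite (renewal_map_neg _ krho)// ?gneg//; exact: claim_kernel_neg.
rewrite /renewal_map /neg_ind ltNge u0/= mule0 add0e.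
have hG : nonneg_mfun (Ex g) by exact: nonneg_conv.
have hB : nonneg_mfun (B g) by exact: nonneg_conv.
have hBG : nonneg_mfun (B (Ex g)) by exact: nonneg_conv.
have G1 x : Ex g x <= 1 by exact: Ex1.
have B1 x : B g x <= 1.
  have := conv_le_cst mid mk k0 krho x ler01 hg g1; move/le_trans; apply.
  by rewrite lee_fin mul1r ltW.
have BG1 x : B (Ex g) x <= 1.
  have := conv_le_cst mid mk k0 krho x ler01 hG G1; move/le_trans; apply.
  by rewrite lee_fin mul1r ltW.
have bal x : (0 <= x)%R -> g x + B (Ex g) x = Ex g x + B g x.
  by move=> x0; rewrite gfix// claim_balance.
have BGE : B (Ex g) = Ex (B g) by apply/funext => x; exact: conv_comm.
(* Constancy of D, with the negative terms moved across because the functions take extended values.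
   The window from x - y to x stays in [0, +oo[, so [bal] may be used under the box integral. *)
have const y x : (0 <= y)%R -> (y <= x)%R -> g (x - y)%R + B g x = g x + B g (x - y)%R.
  move=> y0 yx.
  have mb : measurable_fun setT (box_kernel l y : RR -> R).
    exact: measurable_box_kernel.
  have bk0 s : (0 <= box_kernel l y s)%R by exact: box_kernel_ge0.
  have ib : \int[leb]_s (box_kernel l y s)%:E = (l * y)%:E.
    transitivity (\int[leb]_(s in `[0%R, y[) (cst l%:E s)).
      rewrite [RHS]integral_mkcond; apply: eq_integral => s _.
      by rewrite patchE mem_setE in_itv/= /box_kernel; case: ifP.
    rewrite integral_cst//= lebesgue_measure_itv/= lte_fin.
    case: ltP => [_|]; first by rewrite -EFinB subr0.
    by move=> y0'; rewrite mule0 (_ : y = 0%R) ?mulr0//; apply/eqP; rewrite eq_le y0 y0'.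
  have ly0 : (0 <= l * y)%R by rewrite mulr_ge0.
  have b1 f : nonneg_mfun f -> (forall z, f z <= 1) ->
      exists r : R, conv leb id (box_kernel l y) f x = r%:E.
    move=> hf f1; apply: (@ge0_le_EFin _ _ (1 * (l * y))).
      by case: (nonneg_conv leb mid mb bk0 hf).
    exact: (conv_le_cst _ _ _ ib).
  have e1 := @conv_exp_balance R l g x y l0' y0 hg.
  have e2 := @conv_exp_balance R l (B g) x y l0' y0 hB.
  rewrite /= -/Ex in e1 e2; rewrite -BGE in e2.
  have e3 : conv leb id (box_kernel l y) g x + conv leb id (box_kernel l y) (B (Ex g)) x =
      conv leb id (box_kernel l y) (Ex g) x + conv leb id (box_kernel l y) (B g) x.
    rewrite -!convD// !convE; apply: eq_integral => s _.
    rewrite /box_kernel; case: ifP => [/andP[s0 sy]|_]; last by rewrite !mul0e.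
    by congr (_ * _); rewrite /= bal//; lra.
  have b4 := bal x (le_trans y0 yx).
  have b5 : (g (x - y)%R + B (Ex g) (x - y)%R = Ex g (x - y)%R + B g (x - y)%R).
    by apply: bal; rewrite subr_ge0.
  move: e1 e2 e3 b4 b5.
  have [? ->] := b1 g hg g1.
  have [? ->] := b1 _ hG G1.
  have [? ->] := b1 _ hB B1.
  have [? ->] := b1 _ hBG BG1.
  have [? ->] := ge0_le_EFin (hg.2 x) (g1 x).
  have [? ->] := ge0_le_EFin (hg.2 (x - y)%R) (g1 (x - y)%R).
  have [? ->] := ge0_le_EFin (hG.2 x) (G1 x).
  have [? ->] := ge0_le_EFin (hG.2 (x - y)%R) (G1 (x - y)%R).
  have [? ->] := ge0_le_EFin (hB.2 x) (B1 x).
  have [? ->] := ge0_le_EFin (hB.2 (x - y)%R) (B1 (x - y)%R).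
  have [? ->] := ge0_le_EFin (hBG.2 x) (BG1 x).
  have [? ->] := ge0_le_EFin (hBG.2 (x - y)%R) (BG1 (x - y)%R).
  rewrite -!EFinD => -[] e1 [] e2 [] e3 [] e4 [] e5.
  by congr (_%:E); lra.
have vB : vanishes (B g).
  by apply: vanishes_conv => //; [exact: krho|exact: vanishes_lindley_limit].
have l1 : g u + B g n%:R @[n --> \oo] --> g u.
  rewrite -[X in _ --> X]adde0; apply: cvgeD => //.
  - by rewrite fin_num_adde_defl.
  - exact: cvg_cst.
  - by under eq_fun do rewrite -(subr0 (_%:R)); exact: vB.
have l2 : g n%:R + B g u @[n --> \oo] --> B g u.
  rewrite -[X in _ --> X]add0e; apply: cvgeD => //.
  - by under eq_fun do rewrite -(subr0 (_%:R)); exact: vanishes_lindley_limit.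
  - exact: cvg_cst.
have l12 : \forall n \near \oo, g u + B g n%:R = g n%:R + B g u.
  near=> n.
  have un : (u <= n%:R)%R by near: n; exact: nbhs_infty_ger.
  have := const (n%:R - u)%R n%:R; rewrite subr_ge0 un.
  rewrite (_ : n%:R - (n%:R - u) = u)%R; last by ring.
  by apply => //; rewrite lerBlDr lerDl.
have l3 : g u + B g n%:R @[n --> \oo] --> B g u.
  apply: cvg_trans l2; apply: near_eq_cvg.
  by apply: filterS l12 => n ->.
by rewrite -(cvg_lim _ l1)// (cvg_lim _ l3).
Unshelve. all: by end_near. Qed.

End pk.

(** * Independence and tails of sums *)

(** Makes [V] behave like a function of the [X i] with [i] in [s], through what it is independent
    of. This form grows by one index at a time and starts from a constant with [s] empty. *)
Definition indep_outside (R : realType) d dS dV (T : measurableType d)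
    (S : measurableType dS) (S' : measurableType dV) (P : probability T R)
    (I : eqType) (X : I -> T -> S) (s : seq I) (V : T -> S') : Prop :=
  forall (s' : seq I) (A : I -> set S) (B : set S'), uniq s' ->
    (forall i, i \in s' -> i \notin s) ->
    (forall i, measurable (A i)) -> measurable B ->
    P (\big[setI/setT]_(i <- s') (X i @^-1` A i) `&` V @^-1` B) =
    (\prod_(i <- s') P (X i @^-1` A i) * P (V @^-1` B))%E.

Section independence.
Local Open Scope ereal_scope.
Context (R : realType) d dS dV (T : measurableType d)
  (S : measurableType dS) (S' : measurableType dV) (P : probability T R).

Lemma measure_rect_unique (m m' : {measure set (S * S') -> \bar R}) :
  m setT < +oo ->
  (forall A B, measurable A -> measurable B -> m (A `*` B) = m' (A `*` B)) ->
  forall C, measurable C -> m C = m' C.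
Proof.
move=> mT mm' C mC.
pose G : set (set (S * S')) :=
  [set A `*` B | A in measurable & B in measurable].
apply: (g_sigma_algebra_measure_unique G _ (fun=> setT)) => //.
- by move=> _ [A mA [B mB <-]]; exact: measurableX.
- by move=> _; exists setT => //; exists setT => //; rewrite setXTT.
- by apply/seteqP; split => // x _; exists 0%N.
- move=> _ _ [A mA [B mB <-]] [A' mA' [B' mB' <-]]; rewrite -setXI.
  by exists (A `&` A'); [exact: measurableI|exists (B `&` B') => //; exact: measurableI].
- by move=> _ [A mA [B mB <-]]; exact: mm'.
- by rewrite -measurable_prod_measurableType.
Qed.

Lemma measurable_preimage d1 (S1 : measurableType d1) (f : T -> S1) A :
  measurable_fun setT f -> measurable A -> measurable (f @^-1` A).
Proof. by move=> mf mA; rewrite -[_ @^-1` _]setTI; exact: mf. Qed.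

Context (I : eqType) (X : I -> T -> S).
Hypothesis mX : forall i, measurable_fun setT (X i).
Variables (s : seq I) (V : T -> S').
Hypothesis mV : measurable_fun setT V.
Hypothesis hV : indep_outside P X s V.
Variable i : I.
Hypothesis si : i \notin s.

Let W w := (X i w, V w).
Let mW : measurable_fun setT W.
Proof. exact: measurable_fun_pair. Qed.

Let preW A B : W @^-1` (A `*` B) = X i @^-1` A `&` V @^-1` B.
Proof. by []. Qed.

Let measurable_big (s' : seq I) (A : I -> set S) : (forall j, measurable (A j)) ->
  measurable (\big[setI/setT]_(j <- s') (X j @^-1` A j)).
Proof.
by move=> mA; apply: big_ind => //; [exact: measurableI|move=> j _; exact: measurable_preimage].
Qed.

Lemma indep_outside_rect A B : measurable A -> measurable B ->
  P (W @^-1` (A `*` B)) = P (X i @^-1` A) * P (V @^-1` B).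
Proof.
move=> mA mB; rewrite preW.
have := @hV [:: i] (fun=> A) B.
rewrite !big_seq1; apply => //.
by move=> j; rewrite inE => /eqP ->.
Qed.

(** For fixed events on the other indices, both sides are finite measures in the event of the pair.
    They agree on rectangles, by independence applied to [i :: s'], hence everywhere. *)
Lemma indep_outside_pair : indep_outside P X (i :: s) W.
Proof.
move=> s' A C us' ss' mA mC.
pose D := \big[setI/setT]_(j <- s') (X j @^-1` A j).
have mD : measurable D by exact: measurable_big.
have ss j : j \in s' -> j \notin s.
  by move=> js'; have := ss' j js'; rewrite inE negb_or => /andP[].
have PD : \prod_(j <- s') P (X j @^-1` A j) = P D.
  have := hV us' ss mA (@measurableT _ S').
  by rewrite preimage_setT setIT probability_setT mule1 => ->.
rewrite PD -/D.
have PDfin : P D \is a fin_num by exact: fin_num_measure.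
pose PDn : {nonneg R} := NngNum (fine_ge0 (measure_ge0 P D)).
pose m : {measure set (S * S') -> \bar R} := pushforward (mrestr P mD) W.
pose m' : {measure set (S * S') -> \bar R} := mscale PDn (pushforward P W).
transitivity (m mW C); first by rewrite /m /pushforward /mrestr/= setIC.
transitivity (m' mW C); last by rewrite -[in RHS](fineK PDfin).
apply: measure_rect_unique => //.
  rewrite /m /pushforward /mrestr/= (le_lt_trans (probability_le1 P _))// ?ltry//.
  by rewrite preimage_setT setTI.
move=> A1 B1 mA1 mB1.
transitivity (P (W @^-1` (A1 `*` B1) `&` D)) => //.
transitivity (P D * P (W @^-1` (A1 `*` B1))); last by rewrite -[in LHS](fineK PDfin).
rewrite indep_outside_rect// preW.
pose A' j := if j == i then A1 else A j.
have is' : i \notin s'.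
  by apply/negP => /ss'; rewrite mem_head.
have := @hV (i :: s') A' B1.
rewrite !big_cons /A' eqxx.
rewrite (eq_big_seq (fun j => X j @^-1` A j)); last first.
  by move=> j js'; case: eqP => // ji; rewrite -ji js' in is'.
rewrite [X in _ * X * _](eq_big_seq (fun j => P (X j @^-1` A j))); last first.
  by move=> j js'; case: eqP => // ji; rewrite -ji js' in is'.
rewrite PD -/D muleA (muleC (P D)) => <- //.
- by congr (P _); rewrite setIAC.
- by rewrite /= is'.
- by move=> j; rewrite inE => /orP[/eqP ->//|]; exact: ss.
- by move=> j; case: ifP.
Qed.

Lemma indep_outside_comp d' (S'' : measurableType d') (f : S * S' -> S'') :
  measurable_fun setT f -> indep_outside P X (i :: s) (fun w => f (X i w, V w)).
Proof.
move=> mf s' A B us' ss' mA mB.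
apply: (@indep_outside_pair s' A (f @^-1` B)) => //.
by rewrite -[_ @^-1` _]setTI; exact: mf.
Qed.

Lemma indep_outside_product C : measurable C ->
  P (W @^-1` C) = \int[P]_w P [set w' | C (X i w, V w')].
Proof.
move=> mC.
pose mXi := isMeasurableFun.Build _ _ _ _ (X i) (mX i).
pose Xi : {mfun T >-> S} := HB.pack (X i) mXi.
pose mVi := isMeasurableFun.Build _ _ _ _ V mV.
pose Vi : {mfun T >-> S'} := HB.pack V mVi.
pose m1 : {sigma_finite_measure set S -> \bar R} := distribution P Xi.
pose m2 : {sigma_finite_measure set S' -> \bar R} := distribution P Vi.
pose m : {measure set (S * S') -> \bar R} := pushforward P W.
transitivity (m mW C) => //.
rewrite -(product_measure_unique (m1 := m1) (m2 := m2))//; last first.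
  by move=> A B mA mB; exact: indep_outside_rect.
rewrite /product_measure1.
rewrite (ge0_integral_distribution Xi)//; last exact: measurable_fun_xsection.
apply: eq_integral => w _ /=; rewrite /distribution /pushforward.
by congr (P _); apply/seteqP; split => w' /=; rewrite /xsection/= inE.
Qed.

End independence.

Section independence_tail.
Local Open Scope ereal_scope.
Context (R : realType) d dS (T : measurableType d)
  (S : measurableType dS) (P : probability T R) (I : eqType) (X : I -> T -> S).
Hypothesis mX : forall i, measurable_fun setT (X i).

(** The law of the pair is a product measure, so one integrates over [X i] last. The map [h] covers
    the identity, the negation of an interarrival time and the real part [fine] of an extended
    variable. *)
Lemma indep_outside_tail (s : seq I) (V : T -> R) i (h : S -> R) u :
  measurable_fun setT V -> indep_outside P X s V -> i \notin s ->
  measurable_fun setT h ->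
  P [set w | (u < h (X i w) + V w)%R] =
  conv P (h \o X i) (cst 1%R) (fun v => P [set w | (v < V w)%R]) u.
Proof.
move=> mV hV si mh.
pose C := [set p : S * R | (u < h p.1 + p.2)%R].
have mC : measurable C.
  have mf : measurable_fun setT (fun p : S * R => (h p.1 + p.2)%R).
    by apply: measurable_funD => //; exact: measurableT_comp.
  rewrite (_ : C = (fun p : S * R => (h p.1 + p.2)%R) @^-1` `]u, +oo[).
    by rewrite -[_ @^-1` _]setTI; exact: mf.
  by apply/seteqP; split => p /=; rewrite in_itv/= andbT.
rewrite (indep_outside_product mX mV hV si mC) convE.
apply: eq_integral => w _; rewrite mul1e; congr (P _).
by apply/seteqP; split => w' /=; rewrite /C/= ltrBlDl.
Qed.

Lemma indep_outside_cst (c : R) :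
  mutually_independent P X -> indep_outside P X [::] (cst c).
Proof.
move=> hX s' A B us' _ mA mB; rewrite preimage_cst; case: ifPn => _.
  by rewrite setIT probability_setT mule1 hX.
by rewrite setI0 measure0 mule0.
Qed.

End independence_tail.

Lemma measure_eq_on d (T : measurableType d) (R : realType)
    (P : {measure set T -> \bar R}) (Om A B : set T) :
  measurable Om -> measurable A -> measurable B -> P (~` Om) = 0%E ->
  A `&` Om = B `&` Om -> P A = P B.
Proof.
move=> mO mA mB PO AB.
have h C : measurable C -> P C = P (C `&` Om).
  move=> mC; rewrite -[in LHS](setIT C) -(setUv Om) setIUr measureU//.
  - rewrite [X in (_ + X)%E](_ : _ = 0%E) ?adde0//.
    apply/eqP; rewrite eq_le measure_ge0 andbT -PO le_measure ?inE//.
    + by apply: measurableI => //; exact: measurableC.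
    + exact: measurableC.
  - exact: measurableI.
  - by apply: measurableI => //; exact: measurableC.
  - by rewrite setIACA setICr setI0.
by rewrite h// AB -h.
Qed.

Definition lefts (I J : Type) (s : seq (I + J)) : seq I :=
  pmap (fun x => if x is inl i then Some i else None) s.
Definition rights (I J : Type) (s : seq (I + J)) : seq J :=
  pmap (fun x => if x is inr j then Some j else None) s.

Lemma lefts_uniq (I J : eqType) (s : seq (I + J)) : uniq s -> uniq (lefts s).
Proof. by apply: (@pmap_uniq _ _ _ (@inl I J)) => -[]. Qed.

Lemma rights_uniq (I J : eqType) (s : seq (I + J)) : uniq s -> uniq (rights s).
Proof. by apply: (@pmap_uniq _ _ _ (@inr I J)) => -[]. Qed.

Lemma big_lefts_rights (Z : Type) (idx : Z) (op : Monoid.com_law idx)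
    (I J : Type) (s : seq (I + J)) (F : I + J -> Z) :
  \big[op/idx]_(x <- s) F x =
  op (\big[op/idx]_(i <- lefts s) F (inl i)) (\big[op/idx]_(j <- rights s) F (inr j)).
Proof.
elim: s => [|[i|j] s ih]; first by rewrite /lefts /rights !big_nil Monoid.mulm1.
  by rewrite big_cons ih [in RHS]/lefts /= big_cons Monoid.mulmA.
by rewrite big_cons ih [in RHS]/rights /= big_cons Monoid.mulmCA.
Qed.

(** * From sample paths to the Lindley recursion *)

Section arrivals.
Local Open Scope ereal_scope.
Context (R : realType) d (T : measurableType d) (P : probability T R) (l : R)
  (claim_law : set R -> \bar R) (N : R -> T -> nat) (U E : nat -> {RV P >-> R}).
Hypothesis l0 : (0 < l)%R.
Hypothesis hE : forall k (A : set R), measurable A ->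
  P (E k @^-1` A) = exponential_prob l A.
Hypothesis iE : mutually_independent P (fun k => E k : T -> R).
Hypothesis hN : forall t w n, (0 <= t)%R ->
  (n <= N t w)%N = (\sum_(k < n) E k w <= t)%R.
Hypothesis hU : forall i (A : set R), measurable A ->
  P (U i @^-1` A) = claim_law A.
Hypothesis iU : mutually_independent P (fun i => U i : T -> R).
Hypothesis iNU : independent_classes P
        (generated_sigma_algebra [set t : R | (0 <= t)%R] N)
        (generated_sigma_algebra setT (fun i => U i : T -> R)).

Let S n w : R := (\sum_(k < n) E k w)%R.
(* The partial sums [S n] are functions of [N] only almost surely; their positive
   parts [hS n] are measurable for the sigma-algebra generated by [N]. *)
Let hS n w : R := Num.max 0%R (S n w).
Let Om : set T := \bigcap_k [set w | (0 < E k w)%R].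

Let mE k : measurable_fun setT (E k). Proof. by []. Qed.
Let mU k : measurable_fun setT (U k). Proof. by []. Qed.

Let mS n : measurable_fun setT (S n).
Proof. by apply: measurable_sum => k; exact: mE. Qed.

Let mhS n : measurable_fun setT (hS n).
Proof. exact: measurable_maxr. Qed.

Let mEpos k : measurable [set w | (0 < E k w)%R].
Proof.
rewrite (_ : [set _ | _] = E k @^-1` `]0%R, +oo[); first exact: measurable_preimage.
by apply/seteqP; split => w /=; rewrite in_itv/= andbT.
Qed.

Let mOm : measurable Om.
Proof. exact: bigcapT_measurable. Qed.

Let POm : P (~` Om) = 0.
Proof.
rewrite /Om setC_bigcap; apply/eqP; rewrite eq_le measure_ge0 andbT.
have m0 k : measurable (~` [set w | (0 < E k w)%R]) by apply: measurableC.
apply: (le_trans (measure_sigma_subadditive P m0 _ _)) => //.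
  exact: bigcupT_measurable.
rewrite eseries0// => k _ _.
rewrite (_ : ~` _ = E k @^-1` `]-oo, 0%R]); last first.
  by apply/seteqP; split => w /=; rewrite in_itv/= leNgt => /negP.
rewrite [LHS]hE//.
have mpdf := measurable_exponential_pdf_lebesgue l.
rewrite /exponential_prob (ae_eq_integral (cst 0))//.
- by rewrite integral0.
- by apply/measurable_EFinP; exact: measurable_funTS.
exists [set 0%R]; split => //; first exact: lebesgue_measure_set1.
move=> x /= h; apply: contrapT => x0; apply: h; rewrite in_itv/= => xle.
rewrite lt0_exponential_pdf// lt_neqAle xle andbT; exact/eqP.
Qed.

Let SS n w : S n.+1 w = (S n w + E n w)%R.
Proof. by rewrite /S big_ord_recr. Qed.

Let hSE n w : Om w -> hS n w = S n w.
Proof.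
move=> Ow; rewrite /hS max_r//; elim: n => [|n ih]; first by rewrite /S big_ord0.
by rewrite SS addr_ge0// ltW//; exact: Ow.
Qed.

Let hEE k w : Om w -> (hS k.+1 w - hS k w)%R = E k w.
Proof. by move=> Ow; rewrite !hSE// SS addrC addKr. Qed.

Let GN := \bigcup_(t in [set t : R | (0 <= t)%R]) preimage_set_system setT (N t) measurable.

(** For x >= 0 the event [hS n w <= x] is n <= N x w, which concerns the process at the single time
    x; for x < 0 it is empty because of the truncation at 0. *)
Let mhS_N n : measurable_fun setT (hS n : g_sigma_algebraType GN -> R).
Proof.
apply: (measurability _ (RGenOInfty.measurableE R)) => //.
move=> _ [_ [x ->] <-]; rewrite setTI.
rewrite (_ : _ @^-1` _ = ~` [set w | (hS n w <= x)%R]); last first.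
  by apply/seteqP; split => w /=; rewrite in_itv/= andbT ltNge => /negP.
apply: measurableC; have [x0|x0] := ltP x 0%R.
  rewrite (_ : [set _ | _] = set0)//; apply/seteqP; split => w //=.
  by rewrite /hS ge_max leNgt x0.
apply: sub_sigma_algebra; exists x => //; exists [set k | (n <= k)%N] => //.
rewrite setTI; apply/seteqP; split => w /=; rewrite hN// /hS ge_max x0//.
Qed.

Let pair_family (k : nat + nat) : T -> R :=
  match k with inl i => E i | inr i => U i end.

(** The model only makes the sigma-algebras of [N] and of [U] independent. On [Om] the interarrival
    times are increments of [hS], which are measurable for the former, and replacing them changes no
    probability. *)
Lemma arrivals_claims_independent : mutually_independent P pair_family.
Proof.
move=> s A us mA.
rewrite (big_lefts_rights _ s (fun x : nat + nat => pair_family x @^-1` A x)).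
rewrite (big_lefts_rights _ s (fun x : nat + nat => P (pair_family x @^-1` A x))) /=.
rewrite -(iE (lefts_uniq us) (fun i => mA (inl i))) -(iU (rights_uniq us) (fun i => mA (inr i))).
set DE := \big[setI/setT]_(i <- lefts s) _.
set DU := \big[setI/setT]_(i <- rights s) _.
pose DE' := \big[setI/setT]_(i <- lefts s)
  ((fun w => hS i.+1 w - hS i w)%R @^-1` A (inl i)).
have mDE : measurable DE.
  apply: big_ind => //; [exact: measurableI|move=> i _; exact: measurable_preimage].
have mDU : measurable DU.
  apply: big_ind => //; [exact: measurableI|move=> i _; exact: measurable_preimage].
have mDE' : measurable DE'.
  apply: big_ind => //; [exact: measurableI|move=> i _; apply: measurable_preimage => //].
  exact: measurable_funB.
have DEE : DE `&` Om = DE' `&` Om.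
  rewrite /DE /DE'; elim: (lefts s) => [|i t ih]; first by rewrite !big_nil.
  rewrite !big_cons -!setIA ih [in RHS]setIA [in LHS]setIA.
  rewrite ![_ `&` _ `&` Om]setIAC; congr (_ `&` _).
  by apply/seteqP; split => w /= [h Ow]; split => //; move: h; rewrite hEE.
have FDE' : generated_sigma_algebra [set t : R | (0 <= t)%R] N DE'.
  have : (@measurable _ (g_sigma_algebraType GN)) DE'.
    apply: big_ind => //; [exact: (@measurableI _ (g_sigma_algebraType GN))|move=> i _].
    apply: (@measurable_preimage _ (g_sigma_algebraType GN)) => //.
    by apply: measurable_funB; exact: mhS_N.
  by [].
have FDU : generated_sigma_algebra setT (fun i => U i : T -> R) DU.
  pose GU := \bigcup_(i in setT) preimage_set_system setT (U i : T -> R) measurable.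
  have : (@measurable _ (g_sigma_algebraType GU)) DU.
    apply: big_ind => //; [exact: (@measurableI _ (g_sigma_algebraType GU))|move=> i _].
    by apply: sub_sigma_algebra; exists i => //; exists (A (inr i)); rewrite ?setTI.
  by [].
have e1 : P (DE `&` DU) = P (DE' `&` DU).
  apply: (@measure_eq_on _ _ _ P Om) => //; [exact: measurableI..|].
  by rewrite setIAC DEE setIAC.
have e2 : P DE = P DE' by exact: (@measure_eq_on _ _ _ P Om).
by rewrite e1 e2; exact: iNU.
Qed.

(** The net loss decreases between claims, so the supremum over all times is one over arrival
    epochs. The first event says that [N] takes the value [n] at some time, the earliest being
    [hS n]. The equality holds for every outcome and so yields measurability. *)
Lemma net_loss_sup_gt (u : R) :
  [set w | (u%:E < net_loss_sup N U w)%E] =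
  \bigcup_n ([set w | (hS n w < hS n.+1 w)%R] `&`
             [set w | (u < \sum_(i < n) U i w - hS n w)%R]).
Proof.
apply/seteqP; split => w /=.
  move/ereal_sup_gt => [_ [t /= t0 <-]]; rewrite lte_fin => ut.
  exists (N t w) => //=.
  have h1 : (S (N t w) w <= t)%R by rewrite -hN.
  have h2 : (t < S (N t w).+1 w)%R by rewrite ltNge -hN// ltnn.
  have h3 : (hS (N t w) w <= t)%R by rewrite /hS ge_max t0.
  split; last by rewrite (lt_le_trans ut)// lerD2l lerN2.
  rewrite (le_lt_trans h3)// (lt_le_trans h2)// /hS le_max lexx orbT//.
move=> [n _ /= [h1 h2]].
have t0 : (0 <= hS n w)%R by rewrite /hS le_max lexx.
have Nn : N (hS n w) w = n.
  apply/eqP; rewrite eqn_leq; apply/andP; split; last first.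
    by rewrite hN// /hS le_max lexx orbT.
  rewrite leqNgt; apply/negP; rewrite hN// => h3.
  by move: h1; rewrite ltNge {2}/hS ge_max t0 h3.
apply: (@lt_le_trans _ _ (\sum_(i < n) U i w - hS n w)%:E); first by rewrite lte_fin.
by apply: ereal_sup_ubound; exists (hS n w) => //; rewrite Nn.
Qed.

Lemma measurable_net_loss_sup_gt (u : R) :
  measurable [set w | (u%:E < net_loss_sup N U w)%E].
Proof.
rewrite net_loss_sup_gt; apply: bigcupT_measurable => n.
apply: measurableI.
  rewrite (_ : [set _ | _] = (fun w => hS n.+1 w - hS n w)%R @^-1` `]0%R, +oo[).
    by apply: measurable_preimage => //; exact: measurable_funB.
  by apply/seteqP; split => w /=; rewrite in_itv/= andbT subr_gt0.
rewrite (_ : [set _ | _] = (fun w => \sum_(i < n) U i w - hS n w)%R @^-1` `]u, +oo[).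
  apply: measurable_preimage => //; apply: measurable_funB => //.
  by apply: measurable_sum => i; exact: mU.
by apply/seteqP; split => w /=; rewrite in_itv/= andbT.
Qed.

(** The claim and interarrival time of index [m] are peeled off first, so the rest involves only
    later indices and is independent of them. Unfolded, it is the maximum of the partial sums of
    [U - E] from index [m] with at most [n] terms ([lindley_gtP]). *)
Fixpoint lindley (n m : nat) (w : T) : R :=
  if n is n'.+1 then Num.max 0%R (U m w + (lindley n' m.+1 w - E m w))%R else 0%R.

Lemma measurable_lindley n m : measurable_fun setT (lindley n m).
Proof.
elim: n m => [|n ih] m //=.
apply: measurable_maxr => //; apply: measurable_funD => //.
exact: measurable_funB.
Qed.

Lemma lindley_gtP n m w u :
  (u < lindley n m w)%R <->
  exists2 k, (k <= n)%N & (u < \sum_(i < k) (U (m + i)%N w - E (m + i)%N w))%R.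
Proof.
elim: n m u => [|n ih] m u /=.
  split; first by move=> u0; exists 0%N => //; rewrite big_ord0.
  by move=> [k]; rewrite leqn0 => /eqP ->; rewrite big_ord0.
have shift k : (\sum_(i < k.+1) (U (m + i)%N w - E (m + i)%N w) =
    U m w - E m w + \sum_(i < k) (U (m.+1 + i)%N w - E (m.+1 + i)%N w))%R.
  rewrite big_ord_recl addn0; congr (_ + _)%R.
  by apply: eq_bigr => i _; rewrite lift0 addnS addSn.
rewrite lt_max; split.
  case/orP => [u0|]; first by exists 0%N => //; rewrite big_ord0.
  rewrite addrCA -ltrBlDr => /ih[k kn hk]; exists k.+1 => //.
  by rewrite shift -ltrBlDl.
move=> [[|k] kn]; first by rewrite big_ord0 => ->.
rewrite shift -ltrBlDl => hk; apply/orP; right.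
by rewrite addrCA -ltrBlDr; apply/ih; exists k.
Qed.

Fixpoint lindley_block (n m : nat) : seq (nat + nat) :=
  if n is n'.+1 then inr m :: inl m :: lindley_block n' m.+1 else [::].

Lemma lindley_block_notin n m k : (k < m)%N ->
  (inl k \notin lindley_block n m) /\ (inr k \notin lindley_block n m).
Proof.
elim: n m => [|n ih] m km //=.
have [h1 h2] := ih m.+1 (ltnW km); rewrite !inE (negbTE h1) (negbTE h2) !orbF.
by split; apply/eqP => -[e]; rewrite e ltnn in km.
Qed.

Let mfam k : measurable_fun setT (pair_family k).
Proof. by case: k => k /=. Qed.

Lemma lindley_indep n m : indep_outside P pair_family (lindley_block n m) (lindley n m).
Proof.
elim: n m => [|n ih] m /=; first exact: indep_outside_cst arrivals_claims_independent.
have [h1 h2] := @lindley_block_notin n m.+1 m (ltnSn m).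
have i1 : indep_outside P pair_family (inl m :: lindley_block n m.+1)
    (fun w => lindley n m.+1 w - E m w)%R.
  apply: (indep_outside_comp mfam (@measurable_lindley n m.+1) (ih m.+1) h1
    (f := fun p : R * R => (p.2 - p.1)%R)).
  exact: measurable_funB.
apply: (indep_outside_comp mfam _ i1 _ (f := fun p : R * R => Num.max 0%R (p.1 + p.2)%R)).
- by apply: measurable_funB => //; exact: measurable_lindley.
- by rewrite inE.
- by apply: measurable_maxr => //; exact: measurable_funD.
Qed.

Lemma nonneg_tail (V : T -> R) : measurable_fun setT V ->
  nonneg_mfun (fun v : R => P [set w | (v < V w)%R]).
Proof.
move=> mV.
pose mVi := isMeasurableFun.Build _ _ _ _ V mV.
pose Vi : {RV P >-> R} := HB.pack V mVi.
split; last by move=> v; exact: measure_ge0.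
apply: (eq_measurable_fun (ccdf Vi)); last exact: ccdf_measurable.
move=> v _; rewrite /ccdf /distribution /pushforward.
by congr (P _); apply/seteqP; split => w /=; rewrite in_itv/= andbT.
Qed.

Lemma conv_claim (g : R -> \bar R) m u : nonneg_mfun g ->
  conv P (U m) (cst 1%R) g u = conv P (U 0%N) (cst 1%R) g u.
Proof.
move=> [mg g0]; rewrite !convE.
have mf : measurable_fun setT (fun x : R => 1%:E * g (u - x)%R).
  apply: emeasurable_funM => //; apply: measurableT_comp => //.
  exact: measurable_funB.
have f0 (x : R) : 0 <= 1%:E * g (u - x)%R by rewrite mule_ge0.
rewrite -(ge0_integral_distribution (U m) mf f0).
rewrite -(ge0_integral_distribution (U 0%N) mf f0).
by apply: eq_measure_integral => A mA _; rewrite [LHS]hU// [RHS]hU.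
Qed.

(** The tail is the same for all [m], the variables being identically distributed; the induction
    step uses it at [m.+1] to get [m]. *)
Lemma lindley_tail n m u :
  P [set w | (u < lindley n m w)%R] = iter n (lindley_map (U 0%N) l) (@neg_ind R) u.
Proof.
elim: n m u => [|n ih] m u /=.
  rewrite /neg_ind; case: ifP => u0; last by rewrite set_false ?measure0//.
  by rewrite set_true ?probability_setT.
rewrite /lindley_map; case: ifPn => [u0|].
  rewrite [X in P X](_ : _ = setT) ?probability_setT//.
  by apply/seteqP; split => w //= _; rewrite lt_max u0.
rewrite -leNgt => u0.
have [h1 h2] := @lindley_block_notin n m.+1 m (ltnSn m).
have mL := @measurable_lindley n m.+1.
have mV : measurable_fun setT (fun w => lindley n m.+1 w - E m w)%R.
  exact: measurable_funB.
have i1 : indep_outside P pair_family (inl m :: lindley_block n m.+1)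
    (fun w => lindley n m.+1 w - E m w)%R.
  apply: (indep_outside_comp mfam mL (@lindley_indep n m.+1) h1
    (f := fun p : R * R => (p.2 - p.1)%R)).
  exact: measurable_funB.
transitivity (P [set w | (u < U m w + (lindley n m.+1 w - E m w))%R]).
  congr (P _); apply/seteqP; split => w /=; rewrite lt_max; last by move=> ->; rewrite orbT.
  by case/orP => //; rewrite ltNge u0.
have h3 : inr m \notin (inl m :: lindley_block n m.+1) by rewrite inE.
rewrite (@indep_outside_tail _ _ _ _ _ P _ pair_family mfam _ _ (inr m) id u mV i1 h3)//.
rewrite conv_claim; last exact: nonneg_tail.
congr (conv _ _ _ _ _); apply/funext => v.
have mid : measurable_fun setT (fun x : R => - x)%R by exact: measurable_funN.
have := @indep_outside_tail _ _ _ _ _ P _ pair_family mfam _ _ (inl m) (fun x => - x)%R v mL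
  (@lindley_indep n m.+1) h1 mid.
under eq_set do rewrite /= addrC.
move=> ->; rewrite (conv_exponential _ l0 (hE m)); last exact: nonneg_tail.
by congr (conv _ _ _ _ _); apply/funext => x; rewrite ih.
Qed.

(** When all interarrival times are positive, every [n] is a value of [N], so the supremum event is
    the increasing union of the Lindley events; continuity of the measure concludes. *)
Lemma cvg_lindley_tail u : (0 <= u)%R ->
  iter n (lindley_map (U 0%N) l) (@neg_ind R) u @[n --> \oo] -->
  P [set w | (u%:E < net_loss_sup N U w)%E].
Proof.
move=> u0.
have mF n : measurable [set w | (u < lindley n 0 w)%R].
  rewrite (_ : [set _ | _] = lindley n 0 @^-1` `]u, +oo[).
    by apply: measurable_preimage => //; exact: measurable_lindley.
  by apply/seteqP; split => w /=; rewrite in_itv/= andbT.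
rewrite (@measure_eq_on _ _ _ P Om _ (\bigcup_n [set w | (u < lindley n 0 w)%R]))//.
- under eq_fun do rewrite -(lindley_tail _ 0).
  apply: nondecreasing_cvg_mu => //; first exact: bigcupT_measurable.
  apply/nondecreasing_seqP => n; apply/subsetPset => w /= /lindley_gtP[k kn hk].
  suff : (u < lindley n.+1 0 w)%R by [].
  by apply/lindley_gtP; exists k => //; rewrite leqW.
- exact: measurable_net_loss_sup_gt.
- exact: bigcupT_measurable.
have sumE n w : (\sum_(i < n) (U (0 + i)%N w - E (0 + i)%N w) = \sum_(i < n) U i w - S n w)%R.
  by rewrite /S sumrB.
rewrite net_loss_sup_gt; apply/seteqP; split => w /= [[n _ /= h] Ow]; split => //.
  exists n => //=; apply/lindley_gtP; exists n => //.
  by rewrite sumE -(hSE n Ow); case: h.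
move/lindley_gtP : h => [k _]; rewrite sumE -(hSE k Ow) => h.
exists k => //; split => //=; rewrite !hSE// SS ltrDl; exact: Ow.
Qed.

Lemma net_loss_sup_neg u : (u < 0)%R -> P [set w | (u%:E < net_loss_sup N U w)%E] = 1.
Proof.
move=> u0; rewrite -(probability_setT P); apply: (@measure_eq_on _ _ _ P Om) => //.
  exact: measurable_net_loss_sup_gt.
rewrite net_loss_sup_gt; apply/seteqP; split => w /= [_ Ow]; split => //.
exists 0%N => //; rewrite /= !hSE// SS ltrDl; split; first exact: Ow.
by rewrite big_ord0 /S big_ord0 subrr.
Qed.

End arrivals.

Lemma cramer_lundberg_tail (R : realType) d (T : measurableType d)
    (P : probability T R) (l : R) (claim_law : set R -> \bar R)
    (N : R -> T -> nat) (U : nat -> {RV P >-> R}) : 0 < l ->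
  cramer_lundberg l claim_law N U ->
  (forall u, measurable [set w | (u%:E < net_loss_sup N U w)%E]) /\
  (forall u, iter n (lindley_map (U 0%N) l) (@neg_ind R) u @[n --> \oo] -->
             P [set w | (u%:E < net_loss_sup N U w)%E]).
Proof.
move=> l0 [[E [hE iE hN]] hU iU iNU]; split=> u.
  exact: measurable_net_loss_sup_gt hN u.
have [u0|u0] := ltP u 0; last exact: (cvg_lindley_tail l0 hE iE hN hU iU iNU u0).
rewrite (net_loss_sup_neg U hE hN u0); apply: cvg_near_cst; apply: nearW => -[|n] /=.
  by rewrite /neg_ind u0.
by rewrite /lindley_map u0.
Qed.

(** * Matrix exponentials by power series *)

Section matrix_exponential.
Context (R : realType) (m : nat).
Implicit Types (A G : 'M[R]_m.+1) (i j : 'I_m.+1) (x : R).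

Definition mexp_coef A i j (k : nat) : R := (A ^+ k) i j / k`!%:R.

Definition mexp_entry A i j x : R := limn (pseries (mexp_coef A i j) x).

Lemma mexpZE A i j x : mexp (x *: A) i j = mexp_entry A i j x.
Proof.
rewrite /mexp mxE /mexp_entry; congr (limn _); rewrite /pseries; congr (series _).
by apply/funext => k; rewrite /mexp_coef exprZn mxE -mulrA mulrC.
Qed.

Definition mx_bound A : R := \sum_i \sum_j `|A i j|.

Lemma mx_bound_ge0 A : 0 <= mx_bound A.
Proof. by apply: sumr_ge0 => i _; exact: sumr_ge0. Qed.

Lemma exprmx_bound A k i : \sum_j `|(A ^+ k) i j| <= mx_bound A ^+ k.
Proof.
elim: k i => [|k ih] i.
  rewrite !expr0 (bigD1 i)//= big1 ?addr0 ?mxE ?eqxx ?normr1// => j ji.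
  by rewrite mxE eq_sym (negbTE ji) normr0.
apply: (@le_trans _ _ (\sum_l `|A i l| * mx_bound A ^+ k)).
  apply: (@le_trans _ _ (\sum_j \sum_l `|A i l| * `|(A ^+ k) l j|)).
    apply: ler_sum => j _; rewrite exprS mxE (le_trans (ler_norm_sum _ _ _))//.
    by apply: ler_sum => l _; rewrite normrM.
  rewrite exchange_big/=; apply: ler_sum => l _.
  by rewrite -mulr_sumr ler_wpM2l.
rewrite -mulr_suml exprS ler_wpM2r ?exprn_ge0 ?mx_bound_ge0//.
rewrite /mx_bound [leRHS](bigD1 i)//= lerDl; apply: sumr_ge0 => l _; exact: sumr_ge0.
Qed.

Lemma exprmx_entry_bound A k i j : `|(A ^+ k) i j| <= mx_bound A ^+ k.
Proof.
rewrite (le_trans _ (exprmx_bound A k i))// [leRHS](bigD1 j)//= lerDl.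
exact: sumr_ge0.
Qed.

(* Unlike the entries of [x |-> exp(x A)] alone, this class is stable under
   termwise differentiation. *)
Definition exp_bounded (c : nat -> R) : Prop :=
  exists C M : R, [/\ 0 <= C, 0 <= M & forall k, `|c k| <= C * (M ^+ k / k`!%:R)].

Lemma exp_bounded_mexp A i j : exp_bounded (mexp_coef A i j).
Proof.
exists 1, (mx_bound A); split; rewrite ?mx_bound_ge0// => k.
rewrite mul1r /mexp_coef normrM normfV normr_nat ler_wpM2r//.
exact: exprmx_entry_bound.
Qed.

Lemma exp_bounded_diffs c : exp_bounded c -> exp_bounded (pseries_diffs c).
Proof.
move=> [C [M [C0 M0 cM]]]; exists (C * M), M; split; rewrite ?mulr_ge0// => k.
rewrite /pseries_diffs normrM normr_nat.
apply: (le_trans (ler_wpM2l _ (cM k.+1))) => //.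
rewrite le_eqVlt; apply/orP; left; apply/eqP.
rewrite factS natrM exprS.
have k0 : k.+1%:R != 0 :> R by rewrite pnatr_eq0.
have f0 : k`!%:R != 0 :> R by rewrite pnatr_eq0 -lt0n fact_gt0.
by move: (k.+1%:R) (k`!%:R) k0 f0 => a b a0 b0; field; rewrite a0 b0.
Qed.

Lemma exp_bounded_cvg c x : exp_bounded c -> cvgn (pseries c x).
Proof.
move=> [C [M [C0 M0 cM]]]; apply: normed_cvg.
apply: (@series_le_cvg _ _ (fun k => C * exp_coeff (M * `|x|) k)) => //.
- by move=> k /=; exact: normr_ge0.
- by move=> k; apply: mulr_ge0 => //; apply: exp_coeff_ge0; exact: mulr_ge0.
- move=> k /=; rewrite normrM /exp_coeff/= normrX exprMn.
  by rewrite mulrAC mulrA ler_wpM2r// exprn_ge0.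
- rewrite (_ : (fun _ => _) = C *: exp_coeff (M * `|x|)); last by apply/funext.
  by apply: is_cvg_seriesZ; exact: is_cvg_series_exp_coeff.
Qed.

Lemma is_derive_pseries c x : exp_bounded c ->
  is_derive x (1 : R) (fun x => limn (pseries c x)) (limn (pseries (pseries_diffs c) x)).
Proof.
move=> hc; apply: (@pseries_snd_diffs _ _ (`|x| + 1)).
- exact: exp_bounded_cvg.
- exact/exp_bounded_cvg/exp_bounded_diffs.
- exact/exp_bounded_cvg/exp_bounded_diffs/exp_bounded_diffs.
- by rewrite [ltRHS]ger0_norm ?addr_ge0// ltrDl.
Qed.

Lemma cvg_mexp_entry A i j x :
  pseries (mexp_coef A i j) x @ \oo --> mexp_entry A i j x.
Proof. exact/exp_bounded_cvg/exp_bounded_mexp. Qed.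

Lemma cvg_sum_ord n (u_ : 'I_n -> nat -> R) (a : 'I_n -> R) :
  (forall i : 'I_n, u_ i k @[k --> \oo] --> a i) ->
  (\sum_(i < n) u_ i k) @[k --> \oo] --> \sum_(i < n) a i.
Proof.
elim: n u_ a => [|n ih] u_ a ua.
  by rewrite big_ord0; under eq_fun do rewrite big_ord0; exact: cvg_cst.
rewrite big_ord_recl; under eq_fun do rewrite big_ord_recl.
by apply: cvgD; [exact: ua|apply: ih => i; exact: ua].
Qed.

Lemma mexp_coef_diffs A i j k :
  pseries_diffs (mexp_coef A i j) k = (A ^+ k.+1) i j / k`!%:R.
Proof.
rewrite /pseries_diffs /mexp_coef factS natrM invfM.
have k0 : k.+1%:R != 0 :> R by rewrite pnatr_eq0.
by rewrite mulrCA mulVKf.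
Qed.

Lemma is_derive_mexp_entryl A i j x :
  is_derive x (1 : R) (mexp_entry A i j) (\sum_l A i l * mexp_entry A l j x).
Proof.
have -> : \sum_l A i l * mexp_entry A l j x =
    limn (pseries (pseries_diffs (mexp_coef A i j)) x).
  apply/esym/cvg_lim => //.
  rewrite (_ : pseries _ _ = fun n => \sum_l A i l * pseries (mexp_coef A l j) x n).
    by apply: cvg_sum_ord => l; apply: cvgMr; exact: cvg_mexp_entry.
  apply/funext => n; rewrite /pseries /series/=.
  under [RHS]eq_bigr do rewrite mulr_sumr.
  rewrite exchange_big/=; apply: eq_bigr => k _.
  rewrite mexp_coef_diffs exprS mxE mulr_suml mulr_suml.
  by apply: eq_bigr => l _; rewrite /mexp_coef !mulrA.
exact/is_derive_pseries/exp_bounded_mexp.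
Qed.

Lemma is_derive_mexp_entryr A i j x :
  is_derive x (1 : R) (mexp_entry A i j) (\sum_l mexp_entry A i l x * A l j).
Proof.
have -> : \sum_l mexp_entry A i l x * A l j =
    limn (pseries (pseries_diffs (mexp_coef A i j)) x).
  apply/esym/cvg_lim => //.
  rewrite (_ : pseries _ _ = fun n => \sum_l pseries (mexp_coef A i l) x n * A l j).
    by apply: cvg_sum_ord => l; apply: cvgMl; exact: cvg_mexp_entry.
  apply/funext => n; rewrite /pseries /series/=.
  under [RHS]eq_bigr do rewrite mulr_suml.
  rewrite exchange_big/=; apply: eq_bigr => k _.
  rewrite mexp_coef_diffs exprSr mxE mulr_suml mulr_suml.
  by apply: eq_bigr => l _; rewrite /mexp_coef; ring.
exact/is_derive_pseries/exp_bounded_mexp.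
Qed.

Lemma mexp_entry0 A i j : mexp_entry A i j 0 = (i == j)%:R.
Proof.
apply: cvg_lim => //; rewrite -(cvg_shiftS (pseries _ _)).
rewrite (_ : [sequence _]_n = fun=> (i == j)%:R); first exact: cvg_cst.
apply/funext => n; rewrite /= /pseries /series/= big_nat_recl//= big1 ?addr0.
  by rewrite /mexp_coef !expr0 fact0 mxE divr1 mulr1.
by move=> k _; rewrite exprS mul0r mulr0.
Qed.

(* [y |-> exp((x - y)(G + c)) e^{cy} exp(yG) 1] has zero derivative. *)
Lemma mexp_entry_shift G (c : R) i x :
  \sum_j mexp_entry (G + c%:M) i j x = expR (c * x) * \sum_j mexp_entry G i j x.
Proof.
set A := G + c%:M.
pose f j y := \sum_k mexp_entry G j k y.
pose F j y := expR (c * y) * f j y.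
have df j y : is_derive y (1 : R) (f j) (\sum_l G j l * f l y).
  have -> : \sum_l G j l * f l y = \sum_k \sum_l G j l * mexp_entry G l k y.
    by rewrite exchange_big/=; apply: eq_bigr => l _; rewrite mulr_sumr.
  have -> : f j = \sum_k mexp_entry G j k by apply/funext => z; rewrite fct_sumE.
  by apply: is_derive_sum => k; exact: is_derive_mexp_entryl.
have de y : is_derive y (1 : R) (fun y => expR (c * y)) (c * expR (c * y)).
  apply: is_derive_eq; rewrite /GRing.scale/=; ring.
have dF j y : is_derive y (1 : R) (F j) (\sum_l A j l * F l y).
  have -> : F j = (fun y => expR (c * y)) * f j by apply/funext.
  apply: is_derive_eq; rewrite /GRing.scale/=.
  rewrite mulr_sumr.
  have -> : \sum_l A j l * F l y = \sum_l expR (c * y) * (G j l * f l y) + c * F j y.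
    transitivity (\sum_l (expR (c * y) * (G j l * f l y) + c%:M j l * F l y)).
      by apply: eq_bigr => l _; rewrite /A mxE mulrDl /F; congr (_ + _); ring.
    rewrite big_split/=; congr (_ + _).
    rewrite (bigD1 j)//= big1 ?addr0 ?mxE ?eqxx// => l lj.
    by rewrite mxE eq_sym (negbTE lj) mul0r.
  by congr (_ + _); rewrite /F; ring.
pose W y := \sum_j mexp_entry A i j (x - y) * F j y.
have dE j y : is_derive y (1 : R) (fun y => mexp_entry A i j (x - y))
    (- \sum_l mexp_entry A i l (x - y) * A l j).
  have h := is_derive_mexp_entryr A i j (x - y).
  have hs : is_derive y (1 : R) (fun y => x - y) (-1).
    have := is_deriveB (is_derive_cst (x : R^o) (y : R^o) 1) (is_derive_id (y : R^o) 1).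
    by rewrite sub0r.
  have := @is_derive1_comp R (mexp_entry A i j) (fun y => x - y) y _ _ h hs.
  by rewrite mulrN1.
have dW y : is_derive y (1 : R) W 0.
  have -> : W = \sum_j ((fun y => mexp_entry A i j (x - y)) * F j).
    by apply/funext => z; rewrite fct_sumE.
  have -> : 0 = \sum_j (mexp_entry A i j (x - y) *: (\sum_l A j l * F l y) +
     F j y *: (- \sum_l mexp_entry A i l (x - y) * A l j)).
    rewrite big_split/= /GRing.scale/=.
    under [X in _ = X + _]eq_bigr do rewrite mulr_sumr.
    under [X in _ = _ + X]eq_bigr do rewrite mulrN mulr_sumr.
    rewrite sumrN exchange_big/= -sumrB big1// => j _.
    rewrite -sumrB big1// => l _; ring.
  by apply: is_derive_sum => j; exact: is_deriveM.
have := @is_derive_0_is_cst _ W 0 x dW.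
rewrite /W subr0 subrr /F mulr0 expR0.
have f0 j : f j 0 = 1.
  rewrite /f (bigD1 j)//= mexp_entry0 eqxx big1 ?addr0// => k kj.
  by rewrite mexp_entry0 eq_sym (negbTE kj).
under eq_bigr do rewrite mul1r f0 mulr1.
move=> ->; rewrite (bigD1 i)//= mexp_entry0 eqxx mul1r big1 ?addr0// => k ki.
by rewrite mexp_entry0 eq_sym (negbTE ki) mul0r.
Qed.

Lemma sum_mexp_entry_le A (C r : R) i x :
  (forall k, \sum_j (A ^+ k) i j <= C * r ^+ k) -> 0 <= x ->
  \sum_j mexp_entry A i j x <= C * expR (r * x).
Proof.
move=> hA x0.
have cl := @cvg_sum_ord m.+1 (fun j => pseries (mexp_coef A i j) x) _
  (fun j => @cvg_mexp_entry A i j x).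
have cr : C * series (exp_coeff (r * x)) n @[n --> \oo] --> C * expR (r * x).
  by apply: cvgMr; exact: is_cvg_series_exp_coeff.
rewrite -(cvg_lim _ cl)// -(cvg_lim _ cr)//.
apply: ler_lim; [by apply: cvgP cl|by apply: cvgP cr|].
apply: nearW => n; rewrite /pseries /series/= mulr_sumr exchange_big/=.
apply: ler_sum => k _; rewrite /mexp_coef -!mulr_suml /exp_coeff/= exprMn.
have -> : C * (r ^+ k * x ^+ k / k`!%:R) = C * r ^+ k / k`!%:R * x ^+ k by ring.
by apply: ler_wpM2r; [exact: exprn_ge0|apply: ler_wpM2r; [rewrite invr_ge0|exact: hA]].
Qed.

End matrix_exponential.

(** * Exponential decay of phase-type tails *)

Section substochastic.
Context (R : realType) (m : nat) (G : 'M[R]_m.+1) (c : R).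
Hypothesis c0 : 0 < c.
Hypothesis A0 : forall i j, 0 <= (G + c%:M) i j.
Hypothesis G0 : forall i, \sum_j G i j <= 0.
Hypothesis Gu : G \in unitmx.

Let P : 'M[R]_m.+1 := c^-1 *: (G + c%:M).
Let one : 'cV[R]_m.+1 := const_mx 1.
Let b k := P ^+ k *m one.
(* [v = \sum_k P ^+ k *m one], so that [P *m v = v - one] makes [v] a weight
   contracted by [P]; convergence of the series is not known beforehand. *)
Let v : 'cV[R]_m.+1 := - c *: (invmx G *m one).
Let K := c * mx_bound (invmx G).

Let P0 i j : 0 <= P i j.
Proof. by rewrite mxE mulr_ge0// ?A0// invr_ge0 ltW. Qed.

Let PE : P = 1 + c^-1 *: G.
Proof.
by rewrite /P scalerDr addrC scale_scalar_mx mulVf ?gt_eqF.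
Qed.

Let le_P (u w : 'cV[R]_m.+1) : (forall i, u i 0 <= w i 0) ->
  forall i, (P *m u) i 0 <= (P *m w) i 0.
Proof. by move=> uw i; rewrite !mxE; apply: ler_sum => j _; rewrite ler_wpM2l. Qed.

Let bS k : b k.+1 = P *m b k.
Proof. by rewrite /b exprS -mulmxE mulmxA. Qed.

Let b_0 i : b 0 i 0 = 1.
Proof. by rewrite /b expr0 mul1mx mxE. Qed.

Let b_ge0 k i : 0 <= b k i 0.
Proof.
elim: k i => [|k ih] i; first by rewrite b_0.
by rewrite bS mxE; apply: sumr_ge0 => j _; rewrite mulr_ge0.
Qed.

Let b1_le i : b 1 i 0 <= 1.
Proof.
rewrite bS; have -> : P *m b 0 = one + c^-1 *: (G *m one).
  by rewrite /b expr0 mul1mx PE mulmxDl mul1mx scalemxAl.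
rewrite !mxE gerDl pmulr_rle0 ?invr_gt0//.
by under eq_bigr do rewrite mxE mulr1.
Qed.

Let b_dec k i : b k.+1 i 0 <= b k i 0.
Proof.
elim: k i => [|k ih] i; first by rewrite b_0; exact: b1_le.
by have := le_P ih i; rewrite -!bS.
Qed.

Let b_mono k k' i : (k <= k')%N -> b k' i 0 <= b k i 0.
Proof.
move=> /subnK <-; elim: (k' - k)%N => [|n ih]; first by rewrite add0n.
by rewrite addSn (le_trans _ ih).
Qed.

Let b_le1 k i : b k i 0 <= 1.
Proof. by rewrite -(b_0 i) b_mono. Qed.

Let Ginv_le (u : 'cV[R]_m.+1) i : (forall j, `|u j 0| <= 1) ->
  `|(c *: (invmx G *m u)) i 0| <= K.
Proof.
move=> u1; rewrite mxE normrM (gtr0_norm c0) ler_pM2l//.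
rewrite mxE (le_trans (ler_norm_sum _ _ _))// /mx_bound [leRHS](bigD1 i)//=.
apply: (@le_trans _ _ (\sum_j `|invmx G i j|)).
  by apply: ler_sum => j _; rewrite normrM ler_piMr.
by rewrite lerDl; apply: sumr_ge0 => l _; exact: sumr_ge0.
Qed.

Let v_le i : `|v i 0| <= K.
Proof.
rewrite /v scaleNr mxE normrN; apply: Ginv_le => j.
by rewrite mxE normr1.
Qed.

Let Pv : P *m v = v - one.
Proof.
rewrite PE mulmxDl mul1mx; congr (_ + _).
rewrite /v -scalemxAl -scalemxAr scalerA mulrN mulVf ?gt_eqF//.
by rewrite mulmxA mulmxV// mul1mx scaleN1r.
Qed.

Let S n := \sum_(k < n) b k.

Let vS n : v = S n + P ^+ n *m v.
Proof.
elim: n => [|n ih]; first by rewrite /S big_ord0 add0r expr0 mul1mx.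
rewrite [LHS]ih /S big_ord_recr/= -addrA; congr (_ + _).
by rewrite exprSr -mulmxE -mulmxA Pv mulmxBr addrC subrK.
Qed.

(** Since G = c (P - 1), multiplying [S n] by [G] telescopes. Inverting [G] then bounds [S n]
    uniformly before the series is known to converge. *)
Let SE n : S n = c *: (invmx G *m (b n - one)).
Proof.
have h : G *m S n = c *: (b n - one).
  have -> : G = c *: (P - 1).
    by rewrite PE addrC addKr scalerA divff ?gt_eqF// scale1r.
  rewrite -scalemxAl; congr (_ *: _); rewrite mulmxBl mul1mx /S.
  elim: n => [|n ih]; first by rewrite !big_ord0 mulmx0 subr0 /b expr0 mul1mx subrr.
  rewrite !big_ord_recr/= mulmxDr opprD addrACA ih -bS.
  by rewrite addrC addrA subrK.
by rewrite -[LHS]mul1mx -(mulVmx Gu) -mulmxA h scalemxAr.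
Qed.

Let S_le n i : S n i 0 <= K.
Proof.
rewrite (le_trans (ler_norm _))// SE; apply: Ginv_le => j.
rewrite [X in `|X|](_ : _ = b n j 0 - 1); last by rewrite !mxE.
by rewrite distrC ger0_norm ?subr_ge0// gerBl.
Qed.

Let nb_le n i : n%:R * b n i 0 <= K.
Proof.
apply: le_trans (S_le n i); rewrite /S summxE.
rewrite mulr_natl -[X in _ *+ X]card_ord -sumr_const.
by apply: ler_sum => k _; apply: b_mono; exact: ltnW.
Qed.

Let Pnv_le n i : - (K * b n i 0) <= (P ^+ n *m v) i 0.
Proof.
have K0 : 0 <= K by rewrite mulr_ge0 ?(ltW c0)// mx_bound_ge0.
have h : forall i, (P ^+ n *m (- K *: one)) i 0 <= (P ^+ n *m v) i 0.
  elim: n => [|n ih] j.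
    rewrite expr0 !mul1mx [leLHS](_ : _ = - K); last by rewrite !mxE mulr1.
    by have := v_le j; rewrite ler_norml => /andP[].
  by rewrite exprS -mulmxE -!mulmxA; exact: le_P.
by apply: le_trans (h i); rewrite -scalemxAr -/(b n) [leRHS]mxE mulNr.
Qed.

(** As [b] decreases, n b(n) <= S(n) <= K, so b(n) is at most K / n. The remainder of [v] after
    [S n] is at least - K b(n), which tends to 0, while S(n) >= 1. *)
Let v_ge1 i : 1 <= v i 0.
Proof.
rewrite leNgt; apply/negP => v1.
have K0 : 0 <= K by rewrite mulr_ge0 ?(ltW c0)// mx_bound_ge0.
have d0 : 0 < 1 - v i 0 by rewrite subr_gt0.
(* For this [n], K ^+ 2 / n is below the supposed gap [1 - v i 0]. *)
pose n := (Num.truncn (K ^+ 2 / (1 - v i 0))).+1.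
have hn : K ^+ 2 / (1 - v i 0) < n%:R by exact: truncnS_gt.
have n0 : 0 < n%:R :> R by rewrite ltr0n.
have h1 : 1 <= S n i 0.
  rewrite /S summxE big_ord_recl b_0 lerDl.
  by apply: sumr_ge0 => k _; exact: b_ge0.
have h2 := Pnv_le n i.
have h3 : v i 0 = S n i 0 + (P ^+ n *m v) i 0 by rewrite [in LHS](vS n) [LHS]mxE.
have h4 := nb_le n i.
have h5 : K ^+ 2 < n%:R * (1 - v i 0) by rewrite -ltr_pdivrMr.
have h6 : 1 - v i 0 <= K * b n i 0 by lra.
have h7 : n%:R * (1 - v i 0) <= n%:R * (K * b n i 0) by rewrite ler_pM2l.
have h8 : n%:R * (K * b n i 0) <= K * K by rewrite mulrCA ler_wpM2l.
move: h5; rewrite expr2 ltNge => /negP; apply.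
exact: le_trans h7 h8.
Qed.

(** From P v = v - 1 and 1 <= v <= K follows P v <= (1 - 1/K) v. Iterating from 1 <= v, the row sums
    of the k-th power of P are at most K (1 - 1/K)^k; no spectral theory enters. *)
Lemma substochastic_decay : exists C r : R, [/\ 0 <= C, r < c &
  forall k i, \sum_j ((G + c%:M) ^+ k) i j <= C * r ^+ k].
Proof.
have K1 : 1 <= K.
  by rewrite (le_trans (v_ge1 0))// (le_trans _ (v_le 0))// ler_norm.
have K0 : 0 < K by exact: lt_le_trans K1.
pose q := 1 - K^-1.
have q0 : 0 <= q by rewrite subr_ge0 invf_le1.
exists K, (c * q); split; first exact: ltW.
  by rewrite gtr_pMr// gtrDl oppr_lt0 invr_gt0.
move=> k i.
have Pvq j : (P *m v) j 0 <= (q *: v) j 0.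
  rewrite Pv [leLHS](_ : _ = v j 0 - 1); last first.
    by rewrite [LHS]mxE; congr (_ + _); rewrite !mxE.
  rewrite [leRHS]mxE /q mulrBl mul1r lerD2l lerN2 -ler_pdivlMl ?invr_gt0//.
  by rewrite invrK mulr1 (le_trans _ (v_le j))// ler_norm.
have h : forall j, b k j 0 <= (q ^+ k *: v) j 0.
  elim: k => [|k ih] j; first by rewrite b_0 expr0 scale1r.
  rewrite bS (le_trans (le_P ih j))// -scalemxAr mxE.
  rewrite [leRHS]mxE exprSr -mulrA ler_wpM2l ?exprn_ge0//.
  by have := Pvq j; rewrite [in X in _ <= X]mxE.
have -> : G + c%:M = c *: P by rewrite /P scalerA divff ?gt_eqF// scale1r.
rewrite exprZn; under eq_bigr do rewrite mxE.
rewrite -mulr_sumr exprMn mulrCA ler_pM2l ?exprn_gt0//.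
have -> : \sum_j (P ^+ k) i j = b k i 0.
  by rewrite /b mxE; apply: eq_bigr => j _; rewrite mxE mulr1.
rewrite (le_trans (h i))// [leLHS]mxE mulrC ler_wpM2r ?exprn_ge0//.
by rewrite (le_trans _ (v_le i))// ler_norm.
Qed.

End substochastic.

Lemma phase_type_decay (R : realType) d (T : measurableType d)
    (P : probability T R) (X : {RV P >-> R}) : phase_type X ->
  exists D s : R, [/\ 0 <= D, 0 < s &
    forall x, 0 <= x -> fine (ccdf X x) <= D * expR (- s * x)].
Proof.
move=> [m [alpha [G [[a0 a1] Goff Grow Gu hX]]]].
(* Uniformization: this [c] makes the entries of [G + c%:M] nonnegative, and exp(xG) is exp(-cx)
   exp(x(G + c)), where the powers of G + c grow only like r^k with r < c. *)
pose c := 1 + \sum_i `|G i i|.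
have c0 : 0 < c by rewrite ltr_pwDl// sumr_ge0.
have A0 i j : 0 <= (G + c%:M) i j.
  rewrite !mxE; have [->|ij] := eqVneq i j; last by rewrite mulr0n addr0 Goff.
  rewrite mulr1n /c (bigD1 j)//=.
  have s0 : 0 <= \sum_(k < m.+1 | k != j) `|G k k| by exact: sumr_ge0.
  by have := ler_norm (- G j j); rewrite normrN; lra.
have [C [r [C0 rc hA]]] := substochastic_decay c0 A0 Grow Gu.
exists C, (c - r); split => //; first by rewrite subr_gt0.
move=> x x0; rewrite hX//=.
have f_le j : \sum_k mexp_entry G j k x <= C * expR (- (c - r) * x).
  have h := @sum_mexp_entry_le _ _ (G + c%:M) C r j x (fun k => hA k j) x0.
  rewrite mexp_entry_shift in h.
  rewrite (_ : - (c - r) * x = - (c * x) + r * x); last by ring.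
  rewrite expRD expRN mulrCA -ler_pdivrMl ?invr_gt0 ?expR_gt0//.
  by rewrite invrK.
have -> : \sum_i (alpha *m mexp (x *: G)) 0 i =
    \sum_j alpha 0 j * \sum_k mexp_entry G j k x.
  under eq_bigr do rewrite mxE.
  rewrite exchange_big/=; apply: eq_bigr => j _.
  by rewrite mulr_sumr; apply: eq_bigr => k _; rewrite mexpZE.
apply: (@le_trans _ _ (\sum_j alpha 0 j * (C * expR (- (c - r) * x)))).
  by apply: ler_sum => j _; rewrite ler_wpM2l.
by rewrite -mulr_suml ler_piMl// mulr_ge0// expR_ge0.
Qed.

(** * Subexponential laws: convolution bound and long tails *)

Section subexponential.
Context (R : realType) d (T : measurableType d) (P : probability T R)
  (X : {RV P >-> R}).
Let mu : probability R R := distribution P X.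
Hypothesis hX : subexponential mu.

Definition fccdf (u : R) : R := fine (ccdf X u).

Lemma fccdfE u : (fccdf u)%:E = ccdf X u.
Proof. by rewrite fineK// fin_num_measure. Qed.

Lemma fccdf_ge0 u : 0 <= fccdf u.
Proof. by rewrite fine_ge0. Qed.

Lemma fccdf_le1 u : fccdf u <= 1.
Proof. by rewrite -lee_fin fccdfE; exact: probability_le1. Qed.

Lemma fccdf_nincr u v : u <= v -> fccdf v <= fccdf u.
Proof. by move=> uv; rewrite -lee_fin !fccdfE; exact: ccdf_nonincreasing. Qed.

Lemma fccdf_neg u : u < 0 -> fccdf u = 1.
Proof.
move=> u0; apply/eqP; rewrite eq_le fccdf_le1 -lee_fin fccdfE ccdf_1_cdf.
have -> : cdf X u = 0%E.
  apply/eqP; rewrite eq_le cdf_ge0 andbT -hX.1 le_measure ?inE//.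
  by apply: subset_itvl; rewrite bnd_simp.
by rewrite sube0 lexx.
Qed.

Lemma nonneg_ccdf : nonneg_mfun (ccdf X).
Proof. by split; [exact: ccdf_measurable|move=> u; exact: measure_ge0]. Qed.

Lemma conv_cdf1 u : conv_cdf mu 1 u = cdf X u.
Proof.
have mu1 : measurable (`]-oo, u] : set R) by exact: measurable_itv.
have -> : cdf X u = (\int[mu]_y (\1_(`]-oo, u] : set R) y)%:E)%E.
  by rewrite integral_indic// setIT.
apply: eq_integral => y _; rewrite diracE indicE; congr (_%:R%:E).
by apply: congr1; apply/idP/idP; rewrite !inE/= !in_itv/= subr_ge0.
Qed.

Definition fconv2 (u : R) : R := fine (conv P X (cst 1) (ccdf X) u).

Let mX : measurable_fun setT X. Proof. by []. Qed.

Lemma conv2_le1 u : (conv P X (cst 1%R) (ccdf X) u <= 1)%E.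
Proof.
rewrite convE; apply: (@le_trans _ _ (\int[P]_w (cst 1%E w))%E).
  apply: ge0_le_integral => //.
  - by move=> w _; rewrite mul1e; exact: nonneg_ccdf.2.
  - have h : measurable_fun setT (fun w => ccdf X (u - X w)).
      exact: (measurable_shift u mX nonneg_ccdf).
    by apply: emeasurable_funM => //; exact/measurable_EFinP.
  - by move=> w _; rewrite mul1e; exact: probability_le1.
by rewrite integral_cst// mul1e; exact: probability_le1.
Qed.

Lemma fconv2E u : (fconv2 u)%:E = conv P X (cst 1) (ccdf X) u.
Proof.
rewrite fineK// ge0_fin_numE; first by rewrite (le_lt_trans (conv2_le1 u))// ltry.
by apply: (nonneg_conv P mX _ _ nonneg_ccdf).2.
Qed.

Lemma conv_cdf2 u : 1 - fine (conv_cdf mu 2 u) = fconv2 u.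
Proof.
have mc : measurable_fun setT (fun y : R => cdf X (u - y)).
  by apply: measurableT_comp; [exact: cdf_measurable|exact: measurable_funB].
have mcc : measurable_fun setT (fun y : R => ccdf X (u - y)).
  by apply: measurableT_comp; [exact: ccdf_measurable|exact: measurable_funB].
have e : conv_cdf mu 2 u = (\int[mu]_y cdf X (u - y))%E.
  by apply: eq_integral => y _; exact: conv_cdf1.
have h : (\int[mu]_y cdf X (u - y)%R + conv P X (cst 1%R) (ccdf X) u = 1)%E.
  have -> : conv P X (cst 1%R) (ccdf X) u = (\int[mu]_y ccdf X (u - y)%R)%E.
    rewrite convE (ge0_integral_distribution X)//.
    by apply: eq_integral => w _; rewrite mul1e.
  rewrite -ge0_integralD//.
  - under eq_integral do rewrite cdf_ccdf_1.
    by rewrite integral_cst// mul1e; exact: probability_setT.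
rewrite e; move: h; rewrite -fconv2E.
have : (0 <= \int[mu]_y cdf X (u - y)%R)%E by apply: integral_ge0 => y _; exact: cdf_ge0.
by case: (integral _ _ _) => [r|//|//] _ [] <-; rewrite /= addrAC subrr add0r.
Qed.

Lemma fcdfE u : 1 - fine (mu `]-oo, u]%classic) = fccdf u.
Proof.
have e : (fccdf u)%:E = (1 - mu `]-oo, u]%classic)%E by rewrite fccdfE ccdf_1_cdf.
move: e; have : mu `]-oo, u]%classic \is a fin_num by exact: fin_num_measure.
by case: (mu _) => // r _ [] ->.
Qed.

Lemma subexponential_ratio2 : fconv2 u / fccdf u @[u --> +oo] --> (2 : R).
Proof.
have := hX.2 2 isT; apply: cvg_trans; apply: near_eq_cvg; apply: nearW => u.
by rewrite conv_cdf2 fcdfE.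
Qed.

(** If the tail vanished from some point on, the ratio would be a division by 0, which is 0 here,
    and could not tend to 2. *)
Lemma subexponential_fccdf_gt0 u : 0 < fccdf u.
Proof.
rewrite lt_neqAle fccdf_ge0 andbT eq_sym; apply/negP => /eqP fu.
have /cvgrPdist_lt/(_ 1 ltr01) h := subexponential_ratio2.
have : \forall v \near pinfty_nbhs R, False.
  near=> v.
  have : `|2 - fconv2 v / fccdf v| < 1 by near: v.
  have uv : u <= v by near: v; apply: nbhs_pinfty_ge; exact: num_real.
  have -> : fccdf v = 0.
    by apply/eqP; rewrite eq_le fccdf_ge0 andbT -fu; exact: fccdf_nincr.
  by rewrite invr0 mulr0 subr0 ger0_norm// ltrn1.
by case=> M [_ /(_ (M + 1))]; apply; rewrite ltrDl.
Unshelve. all: by end_near. Qed.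

Lemma subexponential_conv_le : exists2 A : R, 1 <= A &
  forall u, (conv P X (cst 1%R) (ccdf X) u <= A%:E * ccdf X u)%E.
Proof.
have /cvgrPdist_lt/(_ 1 ltr01) := subexponential_ratio2.
move=> [M [_ hM]].
have fM := subexponential_fccdf_gt0 (M + 1).
(* Beyond M the ratio is below 3; up to M + 1 the convolution is at most 1, which is at most fccdf u
   / fccdf (M + 1). *)
exists (3 + (fccdf (M + 1))^-1); first by have := fM; rewrite -invr_gt0; lra.
move=> u; rewrite -fccdfE -EFinM -fconv2E lee_fin mulrDl.
have [uM|Mu] := leP u (M + 1).
  have h1 : fconv2 u <= 1 by rewrite -lee_fin fconv2E conv2_le1.
  have h2 : 1 <= (fccdf (M + 1))^-1 * fccdf u.
    by rewrite mulrC ler_pdivlMr// mul1r fccdf_nincr.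
  have h3 := fccdf_ge0 u; lra.
have fu := subexponential_fccdf_gt0 u.
have : `|2 - fconv2 u / fccdf u| < 1.
  by apply: hM; apply: lt_trans Mu; rewrite ltrDl.
rewrite ltr_norml ltrBrDl => /andP[h _].
have h3 : fconv2 u / fccdf u <= 3 by lra.
rewrite -[leLHS]addr0 lerD//; first by rewrite -ler_pdivrMr.
by rewrite mulr_ge0 ?invr_ge0 ?fccdf_ge0.
Qed.

(** The law is split at 1 and [u]: for y in [0, 1] the tail at u - y is at least [fccdf u], for y in
    ]1, u] at least [fccdf (u - 1)], and for y beyond [u] it is 1. *)
Lemma fconv2_ge u : 1 <= u ->
  (1 - fccdf 1) * fccdf u + (fccdf 1 - fccdf u) * fccdf (u - 1) + fccdf u <= fconv2 u.
Proof.
move=> u1.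
have d1 : mu `[0%R, 1%R]%classic = (1 - fccdf 1)%:E.
  have e : cdf X 1 = mu `[0%R, 1%R]%classic.
    transitivity (mu (`]-oo, 0%R[ `|` `[0%R, 1%R])).
      by congr (mu _); rewrite -itv_bndbnd_setU// bnd_simp.
    rewrite measureU//; first by rewrite [X in (X + _)%E](hX.1) add0e.
    apply/seteqP; split => x //=; rewrite !in_itv/= => -[x0 /andP[x1 _]].
    by move: x0; rewrite ltNge x1.
  by rewrite -e cdf_1_ccdf -fccdfE -EFinB.
have d2 : mu `]1%R, u]%classic = (fccdf 1 - fccdf u)%:E.
  have e : (fccdf 1)%:E = (mu `]1%R, u]%classic + (fccdf u)%:E)%E.
    rewrite !fccdfE; transitivity (mu (`]1%R, u] `|` `]u, +oo[)).
      by congr (mu _); rewrite -itv_bndbnd_setU// bnd_simp.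
    rewrite measureU//.
    apply/seteqP; split => x //=; rewrite !in_itv/= andbT => -[/andP[_ xu]].
    by rewrite ltNge xu.
  by rewrite EFinB e addeK.
have d3 : mu `]u, +oo[%classic = (fccdf u)%:E by rewrite fccdfE.
rewrite -lee_fin fconv2E convE.
have mcc : measurable_fun setT (fun y : R => ccdf X (u - y)).
  by apply: measurableT_comp; [exact: ccdf_measurable|exact: measurable_funB].
have -> : (\int[P]_w ((cst 1 w)%:E * ccdf X (u - X w)%R) = \int[mu]_y ccdf X (u - y)%R)%E.
  rewrite (ge0_integral_distribution X)//.
  by apply: eq_integral => w _; rewrite mul1e.
have c0 y : (0 <= ccdf X y)%E by exact: measure_ge0.
have fc y : (0 <= (fccdf y)%:E)%E by rewrite fccdfE.
rewrite (_ : (_ + _)%:E = (\int[mu]_(y in `[0%R, 1%R]) (cst (fccdf u)%:E y) +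
   \int[mu]_(y in `]1%R, u]) (cst (fccdf (u - 1))%:E y) +
   \int[mu]_(y in `]u, +oo[) (cst 1%:E y))%E); last first.
  rewrite !integral_cst//= d1 d2 d3 mul1e -!EFinM -!EFinD.
  by congr (_%:E); ring.
have mm (A : set R) : measurable A -> measurable_fun A (fun y : R => ccdf X (u - y)).
  by move=> mA; exact: measurable_funTS.
apply: (@le_trans _ _ (\int[mu]_(y in `[0%R, 1%R]) ccdf X (u - y)%R +
   \int[mu]_(y in `]1%R, u]) ccdf X (u - y)%R +
   \int[mu]_(y in `]u, +oo[) ccdf X (u - y)%R)%E).
  apply: leeD; [apply: leeD|]; apply: ge0_le_integral => //.
  - by move=> y _; exact: fc.
  - exact: mm.
  - move=> y /=; rewrite in_itv/= => /andP[y0 y1].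
    by rewrite fccdfE; apply: ccdf_nonincreasing; lra.
  - by move=> y _; exact: fc.
  - exact: mm.
  - move=> y /=; rewrite in_itv/= => /andP[y0 y1].
    by rewrite fccdfE; apply: ccdf_nonincreasing; lra.
  - exact: mm.
  - move=> y /=; rewrite in_itv/= andbT => uy.
    by rewrite -fccdfE fccdf_neg//; lra.
rewrite -ge0_integral_setU//; last 2 first.
- by apply: measurable_funTS.
- rewrite disj_set2E; apply/eqP/seteqP; split => x //=.
  by rewrite !in_itv/= => -[/andP[_ h1] /andP[h2 _]]; lra.
rewrite -ge0_integral_setU//; last 3 first.
- exact: measurableU.
- by apply: measurable_funTS.
- rewrite disj_set2E; apply/eqP/seteqP; split => x //=.
  by rewrite !in_itv/= andbT => -[[/andP[_ h1]|/andP[_ h1]] h2]; lra.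
apply: ge0_subset_integral => //.
by apply: measurableU => //; exact: measurableU.
Qed.

Lemma fccdf_cvg0 : fccdf u @[u --> +oo] --> (0 : R).
Proof. by have /fine_cvgP[] := cvg_ccdfy0 X. Qed.

Lemma long_tailed (r : R) : 0 < r ->
  \forall u \near pinfty_nbhs R, fccdf (u - 1) <= expR r * fccdf u.
Proof.
move=> r0; pose q := fccdf 1.
have q0 : 0 < q by exact: subexponential_fccdf_gt0.
have er1 : 1 < expR r by rewrite expR_gt1.
(* The solution of q + eta = expR r * (q - eta), the two coefficients of the bound [b1] below. *)
pose eta := q * (expR r - 1) / (expR r + 1).
have er : 0 < expR r + 1 by lra.
have eta0 : 0 < eta by rewrite divr_gt0// mulr_gt0// subr_gt0.
have etaE : eta * (expR r + 1) = q * (expR r - 1) by rewrite divfK// gt_eqF.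
have /cvgrPdist_lt/(_ _ eta0) h1 := subexponential_ratio2.
have /cvgrPdist_lt/(_ _ eta0) h2 := fccdf_cvg0.
near=> u.
have u1 : 1 <= u by near: u; apply: nbhs_pinfty_ge; exact: num_real.
have fu := subexponential_fccdf_gt0 u.
have a1 : `|2 - fconv2 u / fccdf u| < eta by near: u.
have a2 : `|0 - fccdf u| < eta by near: u.
have a3 := fconv2_ge u1.
move: a1; rewrite ltr_norml => /andP[a1 _].
have {}a1 : fconv2 u < (2 + eta) * fccdf u.
  by rewrite -ltr_pdivrMr//; lra.
move: a2; rewrite sub0r normrN gtr0_norm// => a2.
rewrite -/q in a3.
have f1 : 0 < fccdf (u - 1) by exact: subexponential_fccdf_gt0.
have b1 : (q - eta) * fccdf (u - 1) <= (q + eta) * fccdf u.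
  have : (q - eta) * fccdf (u - 1) <= (q - fccdf u) * fccdf (u - 1).
    by rewrite ler_pM2r// lerD2l lerN2 ltW.
  lra.
have qe : 0 < q - eta.
  rewrite subr_gt0 /eta ltr_pdivrMr// ltr_pM2l//; lra.
rewrite -(ler_pM2l qe); apply: (le_trans b1).
rewrite mulrA ler_pM2r//; lra.
Unshelve. all: by end_near. Qed.

(** By [long_tailed], each unit step far enough out costs at most a factor [expR (- r)]. *)
Lemma subexponential_exp_lower (r : R) : 0 < r ->
  exists2 c : R, 0 < c & forall u, 0 <= u -> c * expR (- r * u) <= fccdf u.
Proof.
move=> r0; have [M [_ hM]] := long_tailed r0.
pose v := Num.max 0 (M + 1).
have fv := subexponential_fccdf_gt0 v.
(* The extra factor [expR (- r)] pays for rounding [u] up to an integer [n <= u + 1]. *)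
exists (expR (- r) * fccdf v); first by rewrite mulr_gt0// expR_gt0.
have h n : expR (- r * n%:R) * fccdf v <= fccdf (v + n%:R).
  elim: n => [|n ih]; first by rewrite mulr0 expR0 mul1r addr0.
  have := hM (v + n.+1%:R).
  have -> : v + n.+1%:R - 1 = v + n%:R by rewrite -natr1; lra.
  have Mv : M < v + n.+1%:R.
    rewrite (@lt_le_trans _ _ (M + 1))// ?ltrDl//.
    by rewrite (@le_trans _ _ v)// ?lerDl// /v le_max lexx orbT.
  move=> /(_ Mv) h.
  have -> : expR (- r * n.+1%:R) = (expR r)^-1 * expR (- r * n%:R).
    by rewrite -expRN -expRD -natr1; congr expR; ring.
  by rewrite -mulrA ler_pdivrMl ?expR_gt0//; exact: le_trans ih h.
move=> u u0; pose n := (Num.truncn u).+1.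
have un : u < n%:R by exact: truncnS_gt.
have nu : n%:R <= u + 1 by rewrite /n -natr1 lerD2r truncn_le.
apply: (@le_trans _ _ (fccdf (v + n%:R))); last first.
  have v0 : 0 <= v by rewrite /v le_max lexx.
  apply: fccdf_nincr; lra.
apply: le_trans (h n).
rewrite mulrAC ler_pM2r// -expRD ler_expR.
by have := ler_wpM2l (ltW r0) nu; lra.
Qed.

End subexponential.

(** * Tails of random variables and their expectations *)

Section tail_functions.
Local Open Scope ereal_scope.
Context (R : realType) d (T : measurableType d) (P : probability T R).

Lemma conv_neg_ind (X : T -> R) u : measurable_fun setT X ->
  conv P X (cst 1%R) (@neg_ind R) u = P [set w | (u < X w)%R].
Proof.
move=> mX; rewrite convE.
have mA : measurable [set w | (u < X w)%R].
  rewrite (_ : [set _ | _] = X @^-1` `]u, +oo[); first exact: measurable_preimage.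
  by apply/seteqP; split => w /=; rewrite in_itv/= andbT.
rewrite -[X in _ = P X]setIT -(integral_indic P measurableT mA).
apply: eq_integral => w _; rewrite mul1e /neg_ind indicE subr_lt0.
case: ifPn => h; first by rewrite mem_set.
by rewrite memNset//=; apply/negP.
Qed.

Lemma conv_same_law d' (T' : measurableType d') (P' : probability T' R)
    (X : T -> R) (X' : T' -> R) (g : R -> \bar R) u :
  measurable_fun setT X -> measurable_fun setT X' ->
  (forall A : set R, measurable A -> P (X @^-1` A) = P' (X' @^-1` A)) ->
  nonneg_mfun g ->
  conv P X (cst 1%R) g u = conv P' X' (cst 1%R) g u.
Proof.
move=> mX mX' XX' [mg g0]; rewrite !convE.
pose aX := isMeasurableFun.Build _ _ _ _ X mX.
pose Y : {mfun T >-> R} := HB.pack X aX.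
pose aX' := isMeasurableFun.Build _ _ _ _ X' mX'.
pose Y' : {mfun T' >-> R} := HB.pack X' aX'.
have mf : measurable_fun setT (fun x : R => 1%:E * g (u - x)%R).
  apply: emeasurable_funM => //; apply: measurableT_comp => //.
  exact: measurable_funB.
have f0 (x : R) : 0 <= 1%:E * g (u - x)%R by rewrite mule_ge0.
rewrite -(ge0_integral_distribution (P := P) Y mf f0).
rewrite -(ge0_integral_distribution (P := P') Y' mf f0).
by apply: eq_measure_integral => A mA _; exact: XX'.
Qed.

Lemma conv_ge (X : T -> R) (g : R -> \bar R) u : measurable_fun setT X ->
  {ae P, forall w, (0 <= X w)%R} -> nonneg_mfun g ->
  (forall x y, (x <= y)%R -> g y <= g x) ->
  g u <= conv P X (cst 1%R) g u.
Proof.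
move=> mX X0 hg gd; have [mg g0] := hg; rewrite convE.
have e : g u = \int[P]_w (cst (g u) w).
  rewrite integral_cst// [X in _ * X](_ : _ = 1) ?mule1//; exact: probability_setT.
rewrite [leLHS]e; apply: ae_ge0_le_integral => //.
- by move=> w _; exact: g0.
- by move=> w _; rewrite mul1e; exact: g0.
- have h : measurable_fun setT (fun w => g (u - X w)%R).
    exact: (measurable_shift u mX hg).
  by apply: emeasurable_funM => //; exact/measurable_EFinP.
apply: filterS X0 => w Xw _; rewrite mul1e; apply: gd.
by rewrite gerBl.
Qed.

Lemma ae_ge0_tail (X : T -> R) : measurable_fun setT X ->
  (forall u, (u < 0)%R -> P [set w | (u < X w)%R] = 1) ->
  {ae P, forall w, (0 <= X w)%R}.
Proof.
move=> mX h.
have m z : measurable [set w | (z < X w)%R].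
  rewrite (_ : [set _ | _] = X @^-1` `]z, +oo[); first exact: measurable_preimage.
  by apply/seteqP; split => w /=; rewrite in_itv/= andbT.
have : {ae P, forall w, forall n : nat, (- n.+1%:R^-1 < X w)%R}.
  apply: ae_foralln => n.
  have n0 : (- n.+1%:R^-1 < 0 :> R)%R by rewrite oppr_lt0 invr_gt0.
  have P0 : P (~` [set w | (- n.+1%:R^-1 < X w)%R]) = 0.
    by rewrite probability_setC// h// subee.
  by exists (~` [set w | (- n.+1%:R^-1 < X w)%R]); split => //; exact: measurableC.
apply: filterS => w hw; rewrite leNgt; apply/negP => Xw.
have X0 : (0 < - X w)%R by rewrite oppr_gt0.
have := hw (Num.truncn (- X w)^-1).
have hn : ((- X w)^-1 < (Num.truncn (- X w)^-1).+1%:R)%R by exact: truncnS_gt.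
rewrite ltrNl => h1.
move: hn; rewrite invf_plt ?posrE// => h2.
by have := lt_trans h1 h2; rewrite ltxx.
Qed.

(** The mass at +oo is at most the tail at every integer, which tends to 0, and the mass at -oo at
    most the complement of the tail at -1. So the extended supremum can be traded for its real
    part. *)
Lemma fine_tail (Z : T -> \bar R) :
  (forall u : R, measurable [set w | u%:E < Z w]) ->
  (forall u : R, (u < 0)%R -> P [set w | u%:E < Z w] = 1) ->
  vanishes (fun u => P [set w | u%:E < Z w]) ->
  [/\ measurable_fun setT Z, P (~` [set w | Z w \is a fin_num]) = 0 &
      forall u : R, P [set w | u%:E < Z w] = P [set w | (u < fine (Z w))%R]].
Proof.
move=> mZ Z1 Zv.
have mZf : measurable_fun setT Z.
  apply: (measurability _ (ErealGenOInfty.measurableE R)) => //.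
  move=> _ [_ [y ->] <-]; rewrite setTI.
  rewrite (_ : _ @^-1` _ = [set w | y%:E < Z w]); first exact: mZ.
  by apply/seteqP; split => w /=; rewrite in_itv/= andbT.
have mfin : measurable [set w | Z w \is a fin_num].
  by rewrite -[X in measurable X]setTI; exact: emeasurable_fin_num.
have P0 : P (~` [set w | Z w \is a fin_num]) = 0.
  have A0 : P (Z @^-1` [set +oo]) = 0.
    have mA : measurable (Z @^-1` [set +oo]) by apply: measurable_preimage.
    apply/eqP; rewrite eq_le measure_ge0 andbT.
    rewrite -(cvg_lim _ (Zv 0%R))//; apply: lime_ge; first exact: cvgP (Zv 0%R).
    apply: nearW => n; apply: le_measure; rewrite ?inE// => w /= ->.
    by rewrite ltry.
  have B0 : P (Z @^-1` [set -oo]) = 0.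
    have mA : measurable (Z @^-1` [set -oo]) by apply: measurable_preimage.
    have m1 := mZ (-1)%R.
    apply/eqP; rewrite eq_le measure_ge0 andbT.
    have <- : P (~` [set w | (-1)%:E < Z w]) = 0.
      by rewrite probability_setC// Z1 ?subee// oppr_lt0.
    by apply: le_measure; rewrite ?inE//; [exact: measurableC|move=> w /= ->].
  rewrite (_ : ~` _ = Z @^-1` [set +oo] `|` Z @^-1` [set -oo]).
    apply/eqP; rewrite eq_le measure_ge0 andbT.
    apply: (@le_trans _ _ (P (Z @^-1` [set +oo]) + P (Z @^-1` [set -oo]))).
      by apply: measureU2; exact: measurable_preimage.
    by rewrite A0 B0 adde0.
  apply/seteqP; split => w /=.
    by case: (Z w) => [r| |] // _; [left|right].
  by case => ->.
split => // u.
apply: (@measure_eq_on _ _ _ P [set w | Z w \is a fin_num]) => //.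
  rewrite (_ : [set _ | _] = (fine \o Z) @^-1` `]u, +oo[).
    apply: measurable_preimage => //; exact: measurableT_comp.
  by apply/seteqP; split => w /=; rewrite in_itv/= andbT.
by apply/seteqP; split => w /= [h f]; split => //; move: h f; case: (Z w).
Qed.

Lemma integral_claim_kernel (X : {RV P >-> R}) (l : R) : (0 <= l)%R ->
  {ae P, forall w, (0 <= X w)%R} -> 'E_P[X] < +oo ->
  \int[lebesgue_measure]_s (claim_kernel X l s)%:E = (l * fine 'E_P[X])%:E.
Proof.
move=> l0 X0 EX.
(* The tail formula is applied to a variable that is nonnegative at every outcome, while [X] is so
   almost surely. *)
pose Y w := Num.max (X w) 0%R.
have mY : measurable_fun setT Y by exact: measurable_maxr.
pose aY := isMeasurableFun.Build _ _ _ _ Y mY.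
pose Yr : {RV P >-> R} := HB.pack Y aY.
have EXY : 'E_P[X] = 'E_P[Yr].
  rewrite !expectation_def; apply: ae_eq_integral => //.
  - by apply/measurable_EFinP.
  - by apply/measurable_EFinP.
  apply: filterS X0 => w Xw _; congr (_%:E); rewrite /= /Y max_l//.
have Y0 w : (0 <= Yr w)%R by rewrite /= /Y le_max lexx orbT.
have ccE s : (0 <= s)%R -> ccdf X s = ccdf Yr s.
  move=> s0; rewrite /ccdf /distribution /pushforward; congr (P _).
  apply/seteqP; split => w /=; rewrite !in_itv/= !andbT /Y lt_max; first by move=> ->.
  by case/orP => //; rewrite ltNge s0.
have E0 : 0 <= 'E_P[Yr] by exact: expectation_ge0.
have Efin : 'E_P[X] \is a fin_num by rewrite EXY ge0_fin_numE// -EXY.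
rewrite EFinM fineK// EXY ge0_expectation_ccdf//.
rewrite -ge0_integralZl_EFin//; last exact: measurable_funTS (ccdf_measurable Yr).
rewrite integral_mkcond; apply: eq_integral => s _.
rewrite patchE mem_setE in_itv/= andbT /claim_kernel.
by case: ifP => // s0; rewrite EFinM -ccE// fineK// fin_num_measure.
Qed.

End tail_functions.

(** * Exponential bounds and positivity for renewal equations *)

Section renewal_bounds.
Local Open Scope ereal_scope.
Context (R : realType).
Local Notation RR := (measurableTypeR R).
Local Notation leb := (@lebesgue_measure R).

Let mid : measurable_fun setT (id : RR -> R). Proof. by []. Qed.

(** At r = 0 the integral is [delta], which leaves room for a small [r]: expR (r x) <= 1 + r x expR
    (r x), and the exponential bound on the tail dominates the second term by [r * M] times an
    exponential density. *)
Lemma light_tail_rate d (T : measurableType d) (P : probability T R)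
    (X : {RV P >-> R}) (l D s delta : R) :
  (0 <= l)%R -> (0 <= D)%R -> (0 < s)%R ->
  (forall x, (0 <= x)%R -> (fine (ccdf X x) <= D * expR (- s * x))%R) ->
  \int[leb]_x (claim_kernel X l x)%:E = delta%:E -> (delta < 1)%R ->
  exists2 r : R, (0 < r)%R &
    \int[leb]_x ((claim_kernel X l x)%:E * (expR (r * x))%:E) <= 1.
Proof.
move=> l0 D0 s0 hD hdelta delta1.
(* With q = s / 4 this makes M q = l D / q: bounding x by expR (q x) / q and expR (r x) by expR (s x
   / 2) leaves expR (- q x). *)
pose M := (16 * l * D / s ^+ 2)%R.
have M0 : (0 <= M)%R by rewrite divr_ge0 ?exprn_ge0 ?(ltW s0)// !mulr_ge0.
have M1 : (0 < M + 1)%R by rewrite ltr_wpDl.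
pose r := (Num.min (s / 2) ((1 - delta) / (M + 1)))%R.
have r0 : (0 < r)%R by rewrite lt_min !divr_gt0// subr_gt0.
exists r => //.
have rs : (r <= s / 2)%R by rewrite /r ge_min lexx.
have rM : (r * M <= 1 - delta)%R.
  have : (r <= (1 - delta) / (M + 1))%R by rewrite /r ge_min lexx orbT.
  rewrite ler_pdivlMr// => h; apply: le_trans h; rewrite ler_pM2l// lerDl//.
pose q := (s / 4)%R.
have q0 : (0 < q)%R by rewrite divr_gt0.
have mk : measurable_fun setT (claim_kernel X l : RR -> R).
  exact: measurable_claim_kernel.
have mpdf := measurable_exponential_pdf_lebesgue q.
have k0 x : (0 <= claim_kernel X l x)%R by exact: claim_kernel_ge0.
have p0 x : (0 <= exponential_pdf q x)%R by rewrite exponential_pdf_ge0// ltW.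
have rM0 : (0 <= r * M)%R by rewrite mulr_ge0// ltW.
have me : measurable_fun setT (fun x : RR => expR (r * x)).
  by apply: measurableT_comp => //; exact: measurable_funM.
apply: (@le_trans _ _ (\int[leb]_x ((claim_kernel X l x)%:E +
    (r * M)%:E * (exponential_pdf q x)%:E))).
  apply: ge0_le_integral => //.
  - by move=> x _; rewrite mule_ge0// lee_fin ?expR_ge0.
  - by apply: emeasurable_funM; exact/measurable_EFinP.
  - apply: emeasurable_funD; first exact/measurable_EFinP.
    by apply: emeasurable_funM => //; exact/measurable_EFinP.
  move=> x _; rewrite -!EFinM -EFinD lee_fin /claim_kernel.
  case: ifP => x0; last by rewrite mul0r add0r mulr_ge0.
  rewrite exponential_pdfE//.
  set f := fine _; have f0 : (0 <= f)%R by rewrite fine_ge0.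
  have f1 : (f <= D * expR (- s * x))%R by exact: hD.
  have e1 : (expR (r * x) <= 1 + r * x * expR (r * x))%R.
    have := expR_ge1Dx (- (r * x)); have := expR_gt0 (r * x).
    rewrite expRN => h1; rewrite -(ler_pM2r h1) mulVf ?gt_eqF//; lra.
  have e2 : (expR (r * x) <= expR (s / 2 * x))%R by rewrite ler_expR ler_wpM2r.
  have e3 : (q * x <= expR (q * x))%R.
    by have := expR_ge1Dx (q * x); lra.
  have e4 : (expR (- s * x) * (expR (q * x) * expR (s / 2 * x)) = expR (- q * x))%R.
    by rewrite -!expRD; congr expR; rewrite /q; field.
  have h1 : (l * f * expR (r * x) <= l * f + l * f * (r * x * expR (s / 2 * x)))%R.
    have : (l * f * expR (r * x) <= l * f * (1 + r * x * expR (s / 2 * x)))%R.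
      apply: ler_wpM2l; first by rewrite mulr_ge0.
      apply: (le_trans e1); rewrite lerD2l ler_wpM2l// mulr_ge0// ltW//.
    by rewrite mulrDr mulr1.
  apply: (le_trans h1); rewrite lerD2l.
  have -> : (r * M * (q * expR (- q * x)) =
      l * (D * expR (- s * x)) * (r * (q^-1 * expR (q * x)) * expR (s / 2 * x)))%R.
    rewrite -e4 /M /q; field; lra.
  apply: ler_pM.
  - by rewrite mulr_ge0.
  - by rewrite !mulr_ge0 ?expR_ge0// ltW.
  - by rewrite ler_wpM2l.
  apply: ler_wpM2r; first exact: expR_ge0.
  apply: ler_wpM2l; first exact: ltW.
  by rewrite ler_pdivlMl.
rewrite ge0_integralD//; last 4 first.
- by move=> x _; rewrite lee_fin.
- exact/measurable_EFinP.
- by move=> x _; rewrite mule_ge0// lee_fin.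
- by apply: emeasurable_funM => //; exact/measurable_EFinP.
rewrite ge0_integralZl_EFin//; last 2 first.
- by move=> x _; rewrite lee_fin.
- exact/measurable_EFinP.
by rewrite integral_exponential_pdf// hdelta mule1 -EFinD lee_fin; lra.
Qed.

Section kernel.
Variables (b : RR -> R) (rho : R) (g : R -> \bar R).
Hypothesis mb : measurable_fun setT b.
Hypothesis b0 : forall x, (0 <= b x)%R.
Hypothesis brho : \int[leb]_x (b x)%:E = rho%:E.
Hypothesis rho1 : (rho < 1)%R.
Hypothesis hg : nonneg_mfun g.
Hypothesis g1 : forall u, g u <= 1.
Hypothesis gE : forall u, g u = renewal_map b rho g u.

Let rho0 : (0 <= rho)%R.
Proof. by rewrite -lee_fin -brho; apply: integral_ge0 => s _; rewrite lee_fin. Qed.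

(** Lundberg's inequality: by the moment condition, convolution with [b] maps the exponential below
    itself. Iterating the equation shrinks the initial slack 1 to rho ^+ n. *)
Lemma renewal_exp_bound (r : R) : (0 < r)%R ->
  \int[leb]_x ((b x)%:E * (expR (r * x))%:E) <= 1 ->
  forall u, g u <= (expR (- r * u))%:E.
Proof.
move=> r0 hb.
pose ex (u : R) : \bar R := (expR (- r * u))%:E.
have mex : measurable_fun setT (fun x : R => expR (- r * x)).
  by apply: measurableT_comp => //; exact: measurable_funM.
have hex : nonneg_mfun ex.
  by split; [exact/measurable_EFinP|move=> u; rewrite lee_fin expR_ge0].
have Bex u : conv leb id b ex u <= ex u.
  rewrite convE.
  have -> : (\int[leb]_x ((b x)%:E * ex (u - x)%R) =
      ex u * \int[leb]_x ((b x)%:E * (expR (r * x))%:E)).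
    rewrite -ge0_integralZl_EFin ?expR_ge0//.
    - apply: eq_integral => x _; rewrite muleCA; congr (_ * _).
      by rewrite -EFinM -expRD; congr (expR _)%:E; ring.
    - by move=> x _; rewrite mule_ge0// lee_fin ?expR_ge0.
    - apply: emeasurable_funM; first exact/measurable_EFinP.
      apply/measurable_EFinP; apply: measurableT_comp => //; exact: measurable_funM.
  by rewrite -[leRHS]mule1; apply: lee_wpmul2l => //; case: hex.
have h n u : g u <= ex u + (rho ^+ n)%:E.
  elim: n u => [|n ih] u; first by rewrite expr0 (le_trans (g1 u))// leeDr//; case: hex.
  have rn0 : (0 <= rho ^+ n)%R by exact: exprn_ge0.
  have [u0|u0] := ltP u 0%R.
    apply: (le_trans (g1 u)); rewrite -[1]adde0; apply: leeD; last by rewrite lee_fin exprn_ge0.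
    rewrite lee_fin -expR0 ler_expR mulNr -mulrN mulr_ge0// ?ltW// oppr_gt0//.
  rewrite gE /renewal_map /neg_ind ltNge u0/= mule0 add0e.
  have hc := @nonneg_cst R (rho ^+ n)%:E rn0.
  have := le_conv leb mid mb b0 u hg (nonneg_add hex hc) ih.
  move/le_trans; apply; rewrite convD// (conv_cst _ mb b0 brho)// exprSr.
  by apply: leeD.
move=> u.
have cv : (ex u + (rho ^+ n)%:E) @[n --> \oo] --> ex u.
  rewrite -[X in _ --> X]adde0; apply: cvgeD => //; first exact: cvg_cst.
  by apply: cvg_EFin; [exact: nearW|apply: cvg_expr; rewrite ger0_norm].
rewrite -/(ex u) -(cvg_lim _ cv)//; apply: lime_ge; first exact: cvgP cv.
exact: nearW.
Qed.

(** Integrating over [h, 2h] alone gives g u >= beta h g(u - h) for u >= 0, so positivity spreads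
    from the negative half-line in steps of [h]. *)
Lemma renewal_pos (h beta : R) : (0 < h)%R -> (0 < beta)%R ->
  (forall x, (h <= x <= 2 * h)%R -> (beta <= b x)%R) ->
  (forall x y, (x <= y)%R -> g y <= g x) ->
  (forall u, (u < 0)%R -> g u = 1) ->
  forall u, 0 < g u.
Proof.
move=> h0 beta0 hb gd gneg.
have step u : (0 <= u)%R -> (beta * h)%:E * g (u - h)%R <= g u.
  move=> u0; rewrite [leRHS]gE /renewal_map /neg_ind ltNge u0/= mule0 add0e convE.
  apply: (@le_trans _ _ (\int[leb]_(x in `[h, (2 * h)%R]) ((b x)%:E * g (u - x)%R))); last first.
    apply: ge0_subset_integral => //.
      apply: emeasurable_funM; first exact/measurable_EFinP.
      exact: (measurable_shift u mid hg).
    by move=> x _; apply: mule_ge0; [rewrite lee_fin|case: hg].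
  have [r gr] := ge0_le_EFin (hg.2 (u - h)%R) (g1 (u - h)%R).
  have r0 : (0 <= r)%R by rewrite -lee_fin -gr; exact: hg.2.
  apply: (@le_trans _ _ (\int[leb]_(x in `[h, (2 * h)%R]) (cst (beta * r)%:E x))).
    rewrite integral_cst//= lebesgue_measure_itv/= lte_fin ifT; last by lra.
    by rewrite gr -EFinB -!EFinM lee_fin; lra.
  apply: ge0_le_integral => //.
  - by move=> x _; rewrite lee_fin mulr_ge0// ltW.
  - apply: measurable_funTS; apply: emeasurable_funM; first exact/measurable_EFinP.
    exact: (measurable_shift u mid hg).
  move=> x /=; rewrite in_itv/= => hx; rewrite EFinM -gr.
  apply: lee_pmul; [by rewrite lee_fin ltW|exact: hg.2|by rewrite lee_fin; exact: hb|].
  by apply: gd; move/andP: hx => [? _]; lra.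
have pos n u : (u < n%:R * h)%R -> 0 < g u.
  elim: n u => [|n ih] u; first by rewrite mul0r => /gneg ->.
  have [u0|u0] := ltP u 0%R; first by rewrite gneg.
  move=> un; apply: lt_le_trans (step u u0).
  apply: mule_gt0; first by rewrite lte_fin mulr_gt0.
  by apply: ih; rewrite -natr1 mulrDl mul1r in un; lra.
move=> u; apply: (pos (Num.truncn (u / h)).+1).
by rewrite -ltr_pdivrMr//; exact: truncnS_gt.
Qed.

End kernel.

(** The tail of [C] integrated beyond [u] is its mean times the tail of the excess law. From
    [neg_ind] one reaches a general tail by commuting this convolution with the law of the
    variable. *)
Lemma conv_claim_excess d (T : measurableType d) (P : probability T R)
    (C Ce : {RV P >-> R}) (l : R) u :
  (0 <= l)%R -> {ae P, forall w, (0 <= C w)%R} -> 0 < 'E_P[C] < +oo ->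
  has_stationary_excess_law C Ce -> (forall u, (u < 0)%R -> ccdf Ce u = 1) ->
  conv leb id (claim_kernel C l) (@neg_ind R) u = (l * fine 'E_P[C])%:E * ccdf Ce u.
Proof.
move=> l0 C0 /andP[EC0 EC] hCe Ceneg.
have mk : measurable_fun setT (claim_kernel C l : RR -> R).
  exact: measurable_claim_kernel.
have k0 x : (0 <= claim_kernel C l x)%R by exact: claim_kernel_ge0.
have ik := integral_claim_kernel l0 C0 EC.
have Efin : 'E_P[C] \is a fin_num by rewrite ge0_fin_numE// ltW.
have e0 : (0 < fine 'E_P[C])%R by rewrite fine_gt0// EC0.
have mI : measurable_fun setT (fun x : RR => @neg_ind R (u - x)).
  exact: (measurable_shift u mid (nonneg_neg_ind R)).
rewrite convE; have [u0|u0] := ltP u 0%R.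
  rewrite Ceneg// mule1 -ik; apply: eq_integral => x _.
  have [x0|x0] := ltP x 0%R; first by rewrite claim_kernel_neg// mul0e.
  by rewrite /neg_ind ifT ?mule1//; lra.
have J : l%:E * \int[leb]_(t in `[0%R, u]) (1 - cdf C t) = (l * fine 'E_P[C])%:E * cdf Ce u.
  rewrite hCe// muleA -EFinM -mulrA mulfV ?gt_eqF// mulr1//.
have split1 : \int[leb]_x ((claim_kernel C l x)%:E * neg_ind (u - x)%R) +
    (l * fine 'E_P[C])%:E * cdf Ce u = (l * fine 'E_P[C])%:E.
  rewrite -J -ik -ge0_integralZl_EFin//; last 2 first.
  - by move=> x _; rewrite -ccdf_1_cdf; exact: measure_ge0.
  - apply: measurable_funTS; apply: (eq_measurable_fun (ccdf C)); last exact: ccdf_measurable.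
    by move=> x _; rewrite ccdf_1_cdf.
  rewrite [X in _ + X]integral_mkcond -ge0_integralD//.
  - apply: eq_integral => x _; rewrite patchE mem_setE in_itv/=.
    rewrite /claim_kernel; have [x0|x0] := leP 0%R x; last by rewrite mul0e add0e.
    rewrite /neg_ind subr_lt0; have [ux|xu] /= := ltP u x; first by rewrite mule1 adde0.
    by rewrite mule0 add0e -ccdf_1_cdf EFinM fineK// fin_num_measure.
  - by move=> x _; apply: mule_ge0; [rewrite lee_fin|exact: (nonneg_neg_ind R).2].
  - by apply: emeasurable_funM => //; exact/measurable_EFinP.
  - move=> x _; rewrite patchE; case: ifP => // _.
    by rewrite mule_ge0//; rewrite -ccdf_1_cdf; exact: measure_ge0.
  - apply/(measurable_restrictT _ _).1 => //; apply: measurable_funTS.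
    apply: emeasurable_funM => //.
    apply: (eq_measurable_fun (ccdf C)); last exact: ccdf_measurable.
    by move=> x _; rewrite ccdf_1_cdf.
have cfin : cdf Ce u \is a fin_num by exact: fin_num_measure.
rewrite ccdf_1_cdf; move: split1; rewrite -(fineK cfin).
case: (integral _ _ _) => [r|//|//].
by rewrite -EFinB -!EFinM -EFinD => -[] h; congr (_%:E); lra.
Qed.

End renewal_bounds.

(** * Convolution with a probability law *)

Section probability_conv.
Local Open Scope ereal_scope.
Context (R : realType) d (T : measurableType d) (P : probability T R) (X : T -> R).
Hypothesis mX : measurable_fun setT X.
Implicit Types g h : R -> \bar R.

Let m1 : measurable_fun setT (cst 1%R : T -> R). Proof. exact: measurable_cst. Qed.
Let P1 : \int[P]_x ((cst 1%R : T -> R) x)%:E = 1%:E.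
Proof.
rewrite (_ : (fun x => _) = cst 1%:E)// integral_cst// mul1e.
exact: probability_setT.
Qed.

Definition pconv g := conv P X (cst 1%R) g.

Lemma nonneg_pconv g : nonneg_mfun g -> nonneg_mfun (pconv g).
Proof. exact: nonneg_conv. Qed.

Lemma pconv_le1 g u : nonneg_mfun g -> (forall x, g x <= 1) -> pconv g u <= 1.
Proof.
by move=> hg g1; have := conv_le_cst mX m1 (fun=> ler01) P1 u ler01 hg g1; rewrite mulr1.
Qed.

Lemma le_pconv g h u : nonneg_mfun g -> nonneg_mfun h -> (forall x, g x <= h x) ->
  pconv g u <= pconv h u.
Proof. exact: le_conv. Qed.

Lemma pconvZ g (c : R) u : nonneg_mfun g -> (0 <= c)%R ->
  pconv (fun x => c%:E * g x) u = c%:E * pconv g u.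
Proof. exact: convZ. Qed.

Lemma pconvD g h u : nonneg_mfun g -> nonneg_mfun h ->
  pconv (g \+ h) u = pconv g u + pconv h u.
Proof. exact: convD. Qed.

Lemma pconv_cst (c : R) u : (0 <= c)%R -> pconv (fun=> c%:E) u = c%:E.
Proof.
by move=> c0; rewrite /pconv (conv_cst X m1 (fun=> ler01) P1)// mulr1.
Qed.

Lemma pconv_nincr g : nonneg_mfun g -> (forall x y, (x <= y)%R -> g y <= g x) ->
  forall x y, (x <= y)%R -> pconv g y <= pconv g x.
Proof.
move=> hg gd x y xy; rewrite /pconv !convE; apply: ge0_le_integral => //.
- by move=> w _; apply: mule_ge0 => //; exact: hg.2.
- exact: measurable_conv_integrand.
- exact: measurable_conv_integrand.
- by move=> w _; rewrite !mul1e; apply: gd; rewrite lerB.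
Qed.

Hypothesis X0 : {ae P, forall w, (0 <= X w)%R}.

Lemma pconv_ge g u : nonneg_mfun g -> (forall x y, (x <= y)%R -> g y <= g x) ->
  g u <= pconv g u.
Proof. exact: conv_ge. Qed.

End probability_conv.

Lemma pconvC (R : realType) d (T : measurableType d) (P : probability T R) (X : T -> R)
    d' (T' : measurableType d') (P' : probability T' R) (X' : T' -> R)
    (g : R -> \bar R) :
  measurable_fun setT X -> measurable_fun setT X' -> nonneg_mfun g ->
  pconv P X (pconv P' X' g) = pconv P' X' (pconv P X g).
Proof. by move=> mX mX' hg; apply/funext => u; exact: conv_comm. Qed.

(** * Perturbation identity and the error bound *)

Section perturbation.
Local Open Scope ereal_scope.
Context (R : realType).
Local Notation RR := (measurableTypeR R).
Local Notation leb := (@lebesgue_measure R).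
Context d1 (T1 : measurableType d1) (P1 : probability T1 R) (X1 : T1 -> R).
Context d2 (T2 : measurableType d2) (P2 : probability T2 R) (X2 : T2 -> R).
Context d3 (T3 : measurableType d3) (P3 : probability T3 R) (X3 : T3 -> R).
Hypothesis mX1 : measurable_fun setT X1.
Hypothesis mX2 : measurable_fun setT X2.
Hypothesis mX3 : measurable_fun setT X3.
Hypothesis X10 : {ae P1, forall w, (0 <= X1 w)%R}.
Hypothesis X30 : {ae P3, forall w, (0 <= X3 w)%R}.
Variables (b : RR -> R) (rho kap : R).
Hypothesis mb : measurable_fun setT b.
Hypothesis b0 : forall x, (0 <= b x)%R.
Hypothesis brho : \int[leb]_x (b x)%:E = rho%:E.
Hypothesis rho1 : (rho < 1)%R.
Hypothesis kap0 : (0 <= kap)%R.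
Hypothesis kap1 : (kap < 1)%R.

Let I := @neg_ind R.
Let M := pconv P1 X1.
Let Psi := pconv P2 X2.
Let C := pconv P3 X3.
Let p0 := M I.
Let psi := Psi I.
Let CM g := C (M g).

Hypothesis p0E : forall u, p0 u = renewal_map b rho p0 u.
Hypothesis psiE : forall u, psi u = ((1 - rho) * (1 - kap))%:E * I u +
  conv leb id b psi u + ((1 - rho) * kap)%:E * C psi u.

Let mid : measurable_fun setT (id : RR -> R). Proof. by []. Qed.
Let hI : nonneg_mfun I := nonneg_neg_ind R.
Let I1 u : I u <= 1. Proof. exact: neg_ind_le1. Qed.
Let hM g : nonneg_mfun g -> nonneg_mfun (M g). Proof. exact: nonneg_pconv. Qed.
Let hC g : nonneg_mfun g -> nonneg_mfun (C g). Proof. exact: nonneg_pconv. Qed.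
Let hP g : nonneg_mfun g -> nonneg_mfun (Psi g). Proof. exact: nonneg_pconv. Qed.
Let hCM g : nonneg_mfun g -> nonneg_mfun (CM g).
Proof. by move=> hg; apply: hC; exact: hM. Qed.
Let hp0 : nonneg_mfun p0. Proof. exact: hM. Qed.
Let hpsi : nonneg_mfun psi. Proof. exact: hP. Qed.
Let M1 g u : nonneg_mfun g -> (forall x, g x <= 1) -> M g u <= 1.
Proof. exact: pconv_le1. Qed.
Let C1 g u : nonneg_mfun g -> (forall x, g x <= 1) -> C g u <= 1.
Proof. exact: pconv_le1. Qed.
Let CM1 g u : nonneg_mfun g -> (forall x, g x <= 1) -> CM g u <= 1.
Proof. by move=> hg g1; apply: C1; [exact: hM|move=> x; exact: M1]. Qed.
Let p01 u : p0 u <= 1. Proof. exact: M1. Qed.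
Let psi1 u : psi u <= 1. Proof. exact: pconv_le1. Qed.

(* Convolving the equation of [psi] with the base law, and the equation of [p0]
   with the perturbed law, gives two expressions of the same function whose
   terms [b * M * psi] cancel. *)
Lemma perturbation_identity u :
  psi u = (1 - kap)%:E * p0 u + kap%:E * CM psi u.
Proof.
have a0 : (0 < 1 - rho)%R by rewrite subr_gt0.
have c1 : (0 <= (1 - rho) * (1 - kap))%R by rewrite mulr_ge0// ?ltW// subr_gt0.
have c2 : (0 <= (1 - rho) * kap)%R by rewrite mulr_ge0// ltW.
pose Bo := conv leb id b.
have hB g : nonneg_mfun g -> nonneg_mfun (Bo g) by exact: nonneg_conv.
have rho0 : (0 <= rho)%R.
  by rewrite -lee_fin -brho; apply: integral_ge0 => s _; rewrite lee_fin.
have F1 : M psi u = ((1 - rho) * (1 - kap))%:E * p0 u + Bo (M psi) u +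
    ((1 - rho) * kap)%:E * CM psi u.
  have e : psi = ((fun u => ((1 - rho) * (1 - kap))%:E * I u) \+ Bo psi) \+
     (fun u => ((1 - rho) * kap)%:E * C psi u) by apply/funext => v; exact: psiE.
  rewrite [in LHS]e /M pconvD//; last 2 first.
  - by apply: nonneg_add; [exact: nonneg_scale|exact: hB].
  - by apply: nonneg_scale => //; exact: hC.
  rewrite pconvD//; [|exact: nonneg_scale|exact: hB].
  rewrite pconvZ// pconvZ//; last exact: hC.
  rewrite -/M -/p0; congr (_ + _ + _ * _).
    by rewrite /M /Bo /pconv conv_comm.
  by rewrite /CM /C /M pconvC.
have F2 : M psi u = (1 - rho)%:E * psi u + Bo (M psi) u.
  have e1 : M psi = Psi p0 by rewrite /M /psi /Psi pconvC.
  have e2 : p0 = (fun v => (1 - rho)%:E * I v) \+ Bo p0.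
    by apply/funext => v; exact: p0E.
  rewrite {1}e1 [in LHS]e2 /Psi pconvD//; [|by apply: nonneg_scale => //; exact: ltW|exact: hB].
  rewrite pconvZ//; last exact: ltW.
  by congr (_ + _); rewrite e1 /Psi /pconv /Bo conv_comm.
move: F1 F2.
have [x ->] := ge0_le_EFin ((hM hpsi).2 u) (M1 u hpsi psi1).
have [p ->] := ge0_le_EFin (hp0.2 u) (p01 u).
have [s ->] := ge0_le_EFin (hpsi.2 u) (psi1 u).
have [z ->] := ge0_le_EFin ((hCM hpsi).2 u) (CM1 u hpsi psi1).
have [y ->] : exists y, Bo (M psi) u = y%:E.
  apply: ge0_le_EFin; first exact: (hB _ (hM hpsi)).2.
  by apply: (conv_le_cst mid mb b0 brho u ler01 (hM hpsi)) => v; exact: M1.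
rewrite -!EFinM -!EFinD => -[] h1 [] h2; congr (_%:E).
apply: (mulfI (lt0r_neq0 a0)); lra.
Qed.

Let nd (g : R -> \bar R) := forall x y : R, (x <= y)%R -> g y <= g x.
Let ndI : nd I. Proof. exact: neg_ind_nincr. Qed.
Let ndM g : nonneg_mfun g -> nd g -> nd (M g). Proof. exact: pconv_nincr. Qed.
Let ndpsi : nd psi. Proof. exact: pconv_nincr. Qed.
Let ndp0 : nd p0. Proof. exact: ndM. Qed.

Let CM_ge g u : nonneg_mfun g -> nd g -> g u <= CM g u.
Proof.
move=> hg ng; apply: (@le_trans _ _ (M g u)); first exact: pconv_ge.
by apply: pconv_ge => //; [exact: hM|exact: ndM].
Qed.

Let le_CM g h u : nonneg_mfun g -> nonneg_mfun h -> (forall x, g x <= h x) ->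
  CM g u <= CM h u.
Proof.
by move=> hg hh gh; apply: le_pconv => //; [exact: hM|exact: hM|move=> x; exact: le_pconv].
Qed.

Let CMZ g (c : R) u : nonneg_mfun g -> (0 <= c)%R ->
  CM (fun x => c%:E * g x) u = c%:E * CM g u.
Proof.
move=> hg c0; rewrite /CM -pconvZ//; last exact: hM.
by congr (C _ u); apply/funext => x; exact: pconvZ.
Qed.

Let CMD g h u : nonneg_mfun g -> nonneg_mfun h -> CM (g \+ h) u = CM g u + CM h u.
Proof.
move=> hg hh; rewrite /CM -pconvD//; [|exact: hM|exact: hM].
by congr (C _ u); apply/funext => x; exact: pconvD.
Qed.

(** Adding nonnegative variables raises a tail, so CM psi >= psi; put into [perturbation_identity],
    this leaves (1 - kap) psi >= (1 - kap) p0. *)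
Lemma base_le_perturbed u : p0 u <= psi u.
Proof.
have := perturbation_identity u.
have := CM_ge u hpsi ndpsi.
have [p ->] := ge0_le_EFin (hp0.2 u) (p01 u).
have [s ->] := ge0_le_EFin (hpsi.2 u) (psi1 u).
have [z ->] := ge0_le_EFin ((hCM hpsi).2 u) (CM1 u hpsi psi1).
rewrite -!EFinM -!EFinD !lee_fin => sz [] e.
have h : (kap * s <= kap * z)%R by exact: ler_wpM2l.
have k1 : (0 < 1 - kap)%R by rewrite subr_gt0.
rewrite -(ler_pM2l k1); lra.
Qed.

Let F := C I.
Variables K A2 : R.
Hypothesis K1 : (1 <= K)%R.
Hypothesis A21 : (1 <= A2)%R.
Hypothesis p0F : forall u, p0 u <= K%:E * F u.
Hypothesis CF : forall u, C F u <= A2%:E * F u.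
Let A := (K * A2 ^+ 2)%R.
Hypothesis kapA : (2 * kap * A <= 1)%R.

Let hF : nonneg_mfun F. Proof. exact: hC. Qed.
Let F1 u : F u <= 1. Proof. exact: C1. Qed.
Let K0 : (0 <= K)%R. Proof. exact: le_trans K1. Qed.
Let A20 : (0 <= A2)%R. Proof. exact: le_trans A21. Qed.
Let A1 : (1 <= A)%R.
Proof. by rewrite /A mulr_ege1// exprn_ege1. Qed.
Let A0 : (0 <= A)%R. Proof. exact: le_trans A1. Qed.

(** Commuting, M F = C p0 <= K C F <= K A2 F; the outer [C] costs another [A2], whence the value of
    [A]. *)
Let CMF u : CM F u <= A%:E * F u.
Proof.
have h v : M F v <= (K * A2)%:E * F v.
  have -> : M F v = C p0 v by rewrite /M /F /C /p0 pconvC.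
  apply: (@le_trans _ _ (C (fun x => K%:E * F x) v)).
    by apply: le_pconv => //; exact: nonneg_scale.
  by rewrite /C pconvZ// EFinM -muleA; apply: lee_wpmul2l.
have KA : (0 <= K * A2)%R by rewrite mulr_ge0.
apply: (@le_trans _ _ (C (fun x => (K * A2)%:E * F x) u)).
  by apply: le_pconv => //; [exact: hM|exact: nonneg_scale].
have -> : A%:E * F u = (K * A2)%:E * (A2%:E * F u).
  by rewrite muleA -EFinM /A expr2 mulrA.
rewrite /C pconvZ//.
by apply: lee_wpmul2l => //; exact: CF.
Qed.

Let p0AF u : p0 u <= A%:E * F u.
Proof.
apply: (le_trans (p0F u)); apply: lee_wpmul2r; first exact: hF.2.
by rewrite lee_fin /A ler_peMr// exprn_ege1.
Qed.

(** The bound 2 A F reproduces itself in the identity: [p0] contributes at most A F, and kap (2 A) A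
    F is at most A F by [kapA]. The slack starts from psi <= 1 and is multiplied by [kap] in each
    round. *)
Lemma perturbed_tail_le u : psi u <= (2 * A)%:E * F u.
Proof.
have c0 : (0 <= 2 * A)%R by rewrite mulr_ge0.
have h n v : psi v <= (2 * A)%:E * F v + (kap ^+ n)%:E.
  elim: n v => [|n ih] v.
    by rewrite expr0 (le_trans (psi1 v))// leeDr// mule_ge0//; exact: hF.2.
  have kn0 : (0 <= kap ^+ n)%R by exact: exprn_ge0.
  have hc := @nonneg_cst R (kap ^+ n)%:E kn0.
  have h2 := nonneg_scale c0 hF.
  have e1 : CM psi v <= (2 * A)%:E * (A%:E * F v) + (kap ^+ n)%:E.
    apply: (le_trans (le_CM v hpsi (nonneg_add h2 hc) ih)).
    rewrite CMD// CMZ//; apply: leeD; first by apply: lee_wpmul2l.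
    rewrite /CM (_ : M _ = fun=> (kap ^+ n)%:E) /C ?pconv_cst//.
    by apply/funext => x; exact: pconv_cst.
  rewrite perturbation_identity.
  move: e1 (p0AF v).
  have [p pE] := ge0_le_EFin (hp0.2 v) (p01 v).
  have p0' : (0 <= p)%R by rewrite -lee_fin -pE; exact: hp0.2.
  rewrite pE; have [f fE] := ge0_le_EFin (hF.2 v) (F1 v).
  have [z ->] := ge0_le_EFin ((hCM hpsi).2 v) (CM1 v hpsi psi1).
  have f0 : (0 <= f)%R by rewrite -lee_fin -fE; exact: hF.2.
  rewrite fE -!EFinM -!EFinD !lee_fin => e1 e2.
  have e3 : (kap * z <= kap * (2 * A * (A * f) + kap ^+ n))%R by exact: ler_wpM2l.
  have e4 : (2 * kap * A * (A * f) <= 1 * (A * f))%R by apply: ler_wpM2r => //; exact: mulr_ge0.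
  have e5 : (0 <= kap * p)%R by exact: mulr_ge0.
  rewrite exprS; lra.
have cv : ((2 * A)%:E * F u + (kap ^+ n)%:E) @[n --> \oo] --> (2 * A)%:E * F u.
  rewrite -[X in _ --> X]adde0; apply: cvgeD => //.
  - by rewrite fin_num_adde_defl.
  - exact: cvg_cst.
  - by apply: cvg_EFin; [exact: nearW|apply: cvg_expr; rewrite ger0_norm].
rewrite -(cvg_lim _ cv)//; apply: lime_ge; first exact: cvgP cv.
exact: nearW.
Qed.

Lemma perturbation_error u (p q1 q2 s f : R) :
  p0 u = p%:E -> CM p0 u = q1%:E -> CM (CM p0) u = q2%:E -> psi u = s%:E ->
  F u = f%:E -> (0 < f)%R -> (0 < kap)%R ->
  (1 - (p + kap * (q1 - p)) / s <= kap * (q2 / q1 - 1) + kap ^+ 2 * (2 * A ^+ 4))%R.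
Proof.
move=> pE q1E q2E sE fE f0 k0.
have h1 := hCM hp0; have h2 := hCM h1.
have hc1 := hCM hpsi; have hc2 := hCM hc1; have hc3 := hCM hc2.
have c11 v : CM psi v <= 1 by exact: CM1.
have c21 v : CM (CM psi) v <= 1 by exact: CM1.
have k1' : (0 <= 1 - kap)%R by rewrite subr_ge0 ltW.
have c0 : (0 <= 2 * A)%R by rewrite mulr_ge0.
have E0 : psi = (fun v => (1 - kap)%:E * p0 v) \+ (fun v => kap%:E * CM psi v).
  by apply/funext => v; exact: perturbation_identity.
have E1 v : CM psi v = (1 - kap)%:E * CM p0 v + kap%:E * CM (CM psi) v.
  by rewrite {1}E0 CMD//; [rewrite !CMZ|exact: nonneg_scale|exact: nonneg_scale].
have E1' : CM psi = (fun v => (1 - kap)%:E * CM p0 v) \+ (fun v => kap%:E * CM (CM psi) v).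
  by apply/funext => v; exact: E1.
have E2 : CM (CM psi) u = (1 - kap)%:E * CM (CM p0) u + kap%:E * CM (CM (CM psi)) u.
  by rewrite {1}E1' CMD//; [rewrite !CMZ|exact: nonneg_scale|exact: nonneg_scale].
have leF g (c : R) : nonneg_mfun g -> (0 <= c)%R -> (forall v, g v <= c%:E * F v) ->
    forall v, CM g v <= (c * A)%:E * F v.
  move=> hg cc gF v; apply: (le_trans (le_CM v hg (nonneg_scale cc hF) gF)).
  by rewrite CMZ// EFinM -muleA; apply: lee_wpmul2l.
have B1 := leF _ _ hpsi c0 perturbed_tail_le.
have B2 := leF _ _ hc1 (mulr_ge0 c0 A0) B1.
have B3 := leF _ _ hc2 (mulr_ge0 (mulr_ge0 c0 A0) A0) B2 u.
have L1 := le_CM u hp0 hpsi base_le_perturbed.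
have L2 := le_CM u hp0 h1 (fun v => CM_ge v hp0 ndp0).
have L3 : F u <= CM p0 u.
  apply: le_pconv => //; first exact: hM.
  move=> v; apply: (@le_trans _ _ (p0 v)); first exact: pconv_ge.
  exact: pconv_ge.
have p0' : (0 <= p)%R by rewrite -lee_fin -pE; exact: hp0.2.
have := perturbation_identity u; have := E1 u; move: E2 B3 L1 L2 L3.
rewrite pE q1E q2E sE fE.
have [c1 ->] := ge0_le_EFin (hc1.2 u) (c11 u).
have [c2 ->] := ge0_le_EFin (hc2.2 u) (c21 u).
have [c3 ->] := ge0_le_EFin (hc3.2 u) (CM1 u hc2 c21).
rewrite -!EFinM -!EFinD !lee_fin => -[] e2 b3 l1 l2 l3 [] e1 [] e0.
have q10 : (0 < q1)%R by exact: lt_le_trans l3.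
have kq : (0 < kap * q1)%R by exact: mulr_gt0.
have sge : (kap * q1 <= s)%R.
  have : (kap * q1 <= kap * c1)%R by exact: ler_wpM2l.
  have : (0 <= (1 - kap) * p)%R by exact: mulr_ge0.
  lra.
have s0 : (0 < s)%R by exact: lt_le_trans sge.
have A4 : (0 <= 2 * A ^+ 4)%R by rewrite mulr_ge0// exprn_ge0.
(* Three applications of [CM] to psi <= 2 A F give 2 A ^+ 4 F, and F <= CM p0, whence the constant
   in front of [q1]. As [N] is nonnegative, the denominator [s] may be replaced by its lower bound
   [kap * q1]. *)
pose N := (kap ^+ 2 * (q2 - q1) + kap ^+ 3 * (2 * A ^+ 4 * q1))%R.
have N0 : (0 <= N)%R.
  by rewrite addr_ge0// mulr_ge0 ?exprn_ge0 ?subr_ge0// mulr_ge0// ltW.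
have num : (s - (p + kap * (q1 - p)) <= N)%R.
  have -> : (s - (p + kap * (q1 - p)) = kap ^+ 2 * (q2 - q1) + kap ^+ 3 * (c3 - q2))%R.
    by rewrite e0 e1 e2; ring.
  rewrite lerD2l; apply: ler_wpM2l; first exact: exprn_ge0.
  have c3q : (c3 <= 2 * A ^+ 4 * q1)%R.
    apply: (le_trans b3); apply: (@le_trans _ _ (2 * A ^+ 4 * f)%R); last exact: ler_wpM2l.
    by rewrite le_eqVlt; apply/orP; left; apply/eqP; ring.
  lra.
have -> : (1 - (p + kap * (q1 - p)) / s = (s - (p + kap * (q1 - p))) / s)%R.
  by field; rewrite gt_eqF.
apply: (@le_trans _ _ (N / s)%R); first by rewrite ler_pM2r// invr_gt0.
apply: (@le_trans _ _ (N / (kap * q1))%R).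
  by rewrite ler_wpM2l// lef_pV2 ?posrE.
rewrite le_eqVlt; apply/orP; left; apply/eqP; rewrite /N; field.
by rewrite !gt_eqF.
Qed.

End perturbation.

(** * Tails of sums of the independent copies *)

Section copies.
Local Open Scope ereal_scope.
Context (R : realType) dq (Tq : measurableType dq) (Q : probability Tq R)
  (M : nat -> Tq -> \bar R) (Ce : nat -> {RV Q >-> R}).
Hypothesis mM : forall i, measurable_fun setT (M i).
Hypothesis finM : forall i, Q (~` [set w | M i w \is a fin_num]) = 0.
Let X (k : nat + nat) (w : Tq) : \bar R :=
  match k with inl i => M i w | inr i => (Ce i w)%:E end.
Hypothesis iX : mutually_independent Q X.
Variable C : (R -> \bar R) -> (R -> \bar R).
Hypothesis lawM : forall i g, nonneg_mfun g ->
  pconv Q (fine \o M i) g = pconv Q (fine \o M 0%N) g.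
Hypothesis lawCe : forall i g, nonneg_mfun g -> pconv Q (Ce i : Tq -> R) g = C g.
Let Mo := pconv Q (fine \o M 0%N).

Let mX k : measurable_fun setT (X k).
Proof. by case: k => i; [exact: mM|exact/measurable_EFinP]. Qed.

Let mfine : measurable_fun setT (fine : \bar R -> R).
Proof. exact: fine_measurable. Qed.

(** Invariant for adding one summand at a time. The sums are formed from real parts and compared
    with the extended sums at the end, on the event that the copies of the supremum are finite. *)
Let good (s : seq (nat + nat)) (V : Tq -> R) (g : R -> \bar R) :=
  [/\ measurable_fun setT V, indep_outside Q X s V &
      (fun u : R => Q [set w | (u < V w)%R]) = g].

Let good_step s V g k : good s V g -> k \notin s ->
  good (k :: s) (fun w => fine (X k w) + V w)%R (pconv Q (fine \o X k) g).
Proof.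
move=> [mV iV gV] ks; split.
- by apply: measurable_funD => //; exact: measurableT_comp.
- apply: (indep_outside_comp mX mV iV ks (f := fun p : \bar R * R => (fine p.1 + p.2)%R)).
  by apply: measurable_funD => //; exact: measurableT_comp.
- apply/funext => u.
  by rewrite (indep_outside_tail mX u mV iV ks mfine) gV.
Qed.

Let good0 : good [:: inl 0%N] (fun w => fine (M 0%N w)) (Mo (@neg_ind R)).
Proof.
have m0 : measurable_fun setT (fine \o M 0%N) by exact: measurableT_comp.
split.
- exact: m0.
- have iV : indep_outside Q X [::] (cst 0%R : Tq -> R) := indep_outside_cst 0%R iX.
  have mV : measurable_fun setT (cst 0%R : Tq -> R) by exact: measurable_cst.
  apply: (indep_outside_comp mX mV iV (isT : (inl 0%N : nat + nat) \notin [::])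
     (f := fun p : \bar R * R => fine p.1)).
  exact: measurableT_comp.
- by apply/funext => u; rewrite /Mo /pconv conv_neg_ind.
Qed.

Let p0 := Mo (@neg_ind R).
Let hp0 : nonneg_mfun p0.
Proof. by apply: nonneg_pconv; [exact: measurableT_comp|exact: nonneg_neg_ind]. Qed.
Let hMo g : nonneg_mfun g -> nonneg_mfun (Mo g).
Proof. by apply: nonneg_pconv; exact: measurableT_comp. Qed.
Let hC g : nonneg_mfun g -> nonneg_mfun (C g).
Proof. by move=> hg; rewrite -(lawCe 0%N hg); exact: nonneg_pconv. Qed.

Let fineX i : fine \o X (inr i) = (Ce i : Tq -> R). Proof. by []. Qed.

Let V1 w := (Ce 1%N w + (fine (M 1%N w) + fine (M 0%N w)))%R.
Let V2 w := (Ce 2%N w + (fine (M 2%N w) + V1 w))%R.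

Let good1 : good [:: inr 1%N; inl 1%N; inl 0%N] V1 (C (Mo p0)).
Proof.
have g1 := good_step good0 (isT : (inl 1%N : nat + nat) \notin [:: inl 0%N]).
have g2 := good_step g1 (isT : (inr 1%N : nat + nat) \notin [:: inl 1%N; inl 0%N]).
move: g2; rewrite fineX lawCe; last by apply: nonneg_pconv => //; exact: measurableT_comp.
by rewrite (lawM 1%N hp0).
Qed.

Let good2 : good [:: inr 2%N; inl 2%N; inr 1%N; inl 1%N; inl 0%N] V2 (C (Mo (C (Mo p0)))).
Proof.
have g1 := good_step good1 (isT : (inl 2%N : nat + nat) \notin [:: inr 1%N; inl 1%N; inl 0%N]).
have g2 := good_step g1
  (isT : (inr 2%N : nat + nat) \notin [:: inl 2%N; inr 1%N; inl 1%N; inl 0%N]).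
move: g2; rewrite fineX.
have h : nonneg_mfun (C (Mo p0)) by apply: hC; exact: hMo.
rewrite lawCe; last by apply: nonneg_pconv => //; exact: measurableT_comp.
by rewrite (lawM 2%N h).
Qed.

Let fin_Om i : measurable [set w | M i w \is a fin_num].
Proof. by rewrite -[X in measurable X]setTI; exact: emeasurable_fin_num. Qed.

Let Om := [set w | M 0%N w \is a fin_num] `&`
  ([set w | M 1%N w \is a fin_num] `&` [set w | M 2%N w \is a fin_num]).

Let mOm : measurable Om. Proof. by do 2 apply: measurableI => //. Qed.

Let Om0 : Q (~` Om) = 0.
Proof.
have nul A B : measurable A -> measurable B -> Q (~` A) = 0 -> Q (~` B) = 0 ->
    Q (~` (A `&` B)) = 0.
  move=> mA mB A0 B0; rewrite setCI; apply/eqP; rewrite eq_le measure_ge0 andbT.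
  apply: (@le_trans _ _ (Q (~` A) + Q (~` B))).
    by apply: measureU2; exact: measurableC.
  by rewrite A0 B0 adde0.
have n12 := nul _ _ (fin_Om 1%N) (fin_Om 2%N) (finM 1%N) (finM 2%N).
by apply: nul => //; exact: measurableI.
Qed.

Let mgt (V : Tq -> R) (u : R) : measurable_fun setT V -> measurable [set w | (u < V w)%R].
Proof.
move=> mV; rewrite (_ : [set _ | _] = V @^-1` `]u, +oo[).
  exact: measurable_preimage.
by apply/seteqP; split => w /=; rewrite in_itv/= andbT.
Qed.

Let megt (V : Tq -> \bar R) (u : R) : measurable_fun setT V ->
  measurable [set w | u%:E < V w].
Proof. by move=> mV; rewrite -[X in measurable X]setTI; exact: emeasurable_fun_o_infty. Qed.

Lemma tail_copies1 u :
  tail Q (fun w => M 0%N w + M 1%N w + (Ce 1%N w)%:E) u = fine (C (Mo p0) u).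
Proof.
have [mV _ <-] := good1; rewrite /tail; congr fine.
have mS : measurable_fun setT (fun w => M 0%N w + M 1%N w + (Ce 1%N w)%:E).
  by apply: emeasurable_funD; [exact: emeasurable_funD|exact/measurable_EFinP].
apply: (@measure_eq_on _ _ _ Q Om) => //; [exact: megt|exact: mgt|].
apply/seteqP; split => w /= [h [f0 [f1 f2]]]; split => //; move: h;
  rewrite /V1 -(fineK f0) -(fineK f1) /= -!EFinD lte_fin => h;
  apply: (lt_le_trans h); rewrite le_eqVlt; apply/orP; left; apply/eqP; ring.
Qed.

Lemma tail_copies2 u :
  tail Q (fun w => M 0%N w + M 1%N w + M 2%N w + (Ce 1%N w)%:E + (Ce 2%N w)%:E) u =
  fine (C (Mo (C (Mo p0))) u).
Proof.
have [mV _ <-] := good2; rewrite /tail; congr fine.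
have mS : measurable_fun setT
    (fun w => M 0%N w + M 1%N w + M 2%N w + (Ce 1%N w)%:E + (Ce 2%N w)%:E).
  apply: emeasurable_funD; last exact/measurable_EFinP.
  apply: emeasurable_funD; last exact/measurable_EFinP.
  by apply: emeasurable_funD => //; exact: emeasurable_funD.
apply: (@measure_eq_on _ _ _ Q Om) => //; [exact: megt|exact: mgt|].
apply/seteqP; split => w /= [h [f0 [f1 f2]]]; split => //; move: h;
  rewrite /V2 /V1 -(fineK f0) -(fineK f1) -(fineK f2) /= -!EFinD lte_fin => h;
  apply: (lt_le_trans h); rewrite le_eqVlt; apply/orP; left; apply/eqP; ring.
Qed.

End copies.

(** * Renewal equation of a claim model *)

Section ruin.
Local Open Scope ereal_scope.
Context (R : realType).
Local Notation leb := (@lebesgue_measure R).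

Lemma cramer_lundberg_renewal d (T : measurableType d) (P : probability T R)
    (l rho : R) (claim_law : set R -> \bar R) (N : R -> T -> nat)
    (U : nat -> {RV P >-> R}) :
  (0 < l)%R -> cramer_lundberg l claim_law N U -> claim_law `]-oo, 0%R[%classic = 0 ->
  \int[leb]_s (claim_kernel (U 0%N) l s)%:E = rho%:E -> (rho < 1)%R ->
  let g (u : R) := P [set w | u%:E < net_loss_sup N U w] in
  [/\ forall u, g u = renewal_map (claim_kernel (U 0%N) l) rho g u,
      measurable_fun setT (net_loss_sup N U),
      P (~` [set w | net_loss_sup N U w \is a fin_num]) = 0,
      {ae P, forall w, (0 <= fine (net_loss_sup N U w))%R} &
      g = pconv P (fine \o net_loss_sup N U) (@neg_ind R)].
Proof.
move=> l0 hCL law0 krho rho1 g.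
have [mg cg] := cramer_lundberg_tail l0 hCL.
have U0 : {ae P, forall w, (0 <= U 0%N w)%R}.
  have [_ hU _ _] := hCL.
  exists (U 0%N @^-1` `]-oo, 0%R[); split.
  - exact: measurable_preimage.
  - by rewrite hU.
  - by move=> w /= /negP; rewrite -ltNge in_itv.
have gneg u : (u < 0)%R -> g u = 1.
  move=> u0; rewrite /g -(cvg_lim _ (cg u))//; apply: cvg_lim => //.
  apply: cvg_near_cst; apply: nearW => -[|n] /=; first by rewrite /neg_ind u0.
  by rewrite /lindley_map u0.
have vg : vanishes g := vanishes_lindley_limit l0 U0 krho rho1 cg.
have [mZ Zfin Zt] := fine_tail mg gneg vg.
have mf : measurable_fun setT (fine \o net_loss_sup N U) by exact: measurableT_comp.
split => //.
- exact: (pollaczek_khinchine_renewal l0 U0 krho rho1 cg).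
- apply: (ae_ge0_tail mf) => u u0; rewrite -Zt; exact: gneg.
- by apply/funext => u; rewrite /pconv conv_neg_ind// -Zt.
Qed.

End ruin.

(** * Kernels of the claim size laws *)

Section claim_laws.
Local Open Scope ereal_scope.
Context (R : realType).
Local Notation RR := (measurableTypeR R).
Local Notation leb := (@lebesgue_measure R).

Lemma conv_kernelD (b c : RR -> R) (g : R -> \bar R) u :
  measurable_fun setT b -> (forall x, 0 <= b x)%R ->
  measurable_fun setT c -> (forall x, 0 <= c x)%R -> nonneg_mfun g ->
  conv leb id (b \+ c)%R g u = conv leb id b g u + conv leb id c g u.
Proof.
move=> mb b0 mc c0 hg.
have mid : measurable_fun setT (id : RR -> R) by [].
rewrite !convE -ge0_integralD//.
- by apply: eq_integral => x _; rewrite EFinD ge0_muleDl ?lee_fin.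
- by move=> x _; apply: mule_ge0; [rewrite lee_fin|exact: hg.2].
- exact: measurable_conv_integrand.
- by move=> x _; apply: mule_ge0; [rewrite lee_fin|exact: hg.2].
- exact: measurable_conv_integrand.
Qed.

Lemma ae_ge0_null d (T : measurableType d) (P : probability T R) (X : T -> R) :
  measurable_fun setT X -> {ae P, forall w, (0 <= X w)%R} ->
  P (X @^-1` `]-oo, 0%R[) = 0.
Proof.
move=> mX [A [mA A0 hA]]; apply/eqP; rewrite eq_le measure_ge0 andbT -A0.
apply: le_measure; rewrite ?inE//; first exact: measurable_preimage.
by move=> w /=; rewrite in_itv/= => Xw; apply: hA => /=; apply/negP; rewrite -ltNge.
Qed.

Lemma null_ae_ge0 d (T : measurableType d) (P : probability T R) (X : T -> R) :
  measurable_fun setT X -> P (X @^-1` `]-oo, 0%R[) = 0 ->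
  {ae P, forall w, (0 <= X w)%R}.
Proof.
move=> mX X0; exists (X @^-1` `]-oo, 0%R[); split => //.
  exact: measurable_preimage.
by move=> w /= /negP; rewrite -ltNge in_itv.
Qed.

(** A positive integral forces a positive tail at some s > 0; by monotonicity the kernel is bounded
    below on [s / 2, s]. This is the input of [renewal_pos]. *)
Lemma claim_kernel_support d (T : measurableType d) (P : probability T R)
    (X : {RV P >-> R}) (l delta : R) : (0 < l)%R ->
  \int[leb]_s (claim_kernel X l s)%:E = delta%:E -> (0 < delta)%R ->
  exists h beta : R, [/\ (0 < h)%R, (0 < beta)%R &
    forall x, (h <= x <= 2 * h)%R -> (beta <= claim_kernel X l x)%R].
Proof.
move=> l0 hd d0.
have [s [s0 Xs]] : exists s : R, (0 < s)%R /\ (0 < fccdf X s)%R.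
  apply: contrapT => hn.
  have h s : (0 < s)%R -> fccdf X s = 0%R.
    move=> s0; apply/eqP; rewrite eq_le fccdf_ge0 andbT leNgt; apply/negP => Xs.
    by apply: hn; exists s.
  have : \int[leb]_s (claim_kernel X l s)%:E = \int[leb]_s (cst 0 s).
    apply: ae_eq_integral => //.
    - by apply/measurable_EFinP; exact: (measurable_claim_kernel X l).
    exists [set 0%R]; split => //; first exact: lebesgue_measure_set1.
    move=> x /= hx; apply: contrapT => x0; apply: hx => _.
    rewrite /claim_kernel; case: ifP => // xge.
    by rewrite -/(fccdf X x) h ?mulr0// lt_neqAle xge andbT eq_sym; apply/eqP.
  by rewrite integral0 hd => -[] e; rewrite e ltxx in d0.
exists (s / 2)%R, (l * fccdf X s)%R; split; rewrite ?divr_gt0// ?mulr_gt0//.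
move=> x /andP[x1 x2]; rewrite /claim_kernel ifT; last by lra.
by rewrite ler_pM2l//; apply: fccdf_nincr; lra.
Qed.

End claim_laws.

Theorem theorem8 (R : realType) (lambda : R)
    (d0 : measure_display) (T0 : measurableType d0) (P0 : probability T0 R)
    (B C Ce0 : {RV P0 >-> R})
    (hlambda : 0 < lambda)
    (hB0 : {ae P0, forall w, 0 <= B w})
    (hBph : phase_type B)
    (hBmean : (0 < 'E_P0[B] < +oo)%E)
    (hC0 : {ae P0, forall w, 0 <= C w})
    (hCheavy : heavy_tailed C)
    (hCmean : (0 < 'E_P0[C] < +oo)%E)
    (hCe : has_stationary_excess_law C Ce0) :
  let delta := lambda * fine 'E_P0[B] in
  let theta := lambda * fine 'E_P0[C] in
  delta < 1 ->
  subexponential (distribution P0 Ce0) ->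
  exists eta K : R, 0 < eta /\
    forall eps : R, 0 <= eps <= 1 ->
      (1 - eps) * delta + eps * theta < 1 ->
      eps < eta ->
    forall (d : measure_display) (T : measurableType d) (P : probability T R)
      (N : R -> T -> nat) (U : nat -> {RV P >-> R}),
      cramer_lundberg lambda
        (mixture eps (distribution P0 B) (distribution P0 C)) N U ->
    forall (db : measure_display) (Tb : measurableType db)
      (Pb : probability Tb R) (Nb : R -> Tb -> nat) (Ub : nat -> {RV Pb >-> R}),
      cramer_lundberg ((1 - eps) * lambda) (distribution P0 B) Nb Ub ->
    forall (dq : measure_display) (Tq : measurableType dq)
      (Q : probability Tq R) (M : nat -> Tq -> \bar R)
      (Ce : nat -> {RV Q >-> R}),
      discard_copies Pb (net_loss_sup Nb Ub) Ce0 M Ce ->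
    forall u : R, 0 <= u ->
      1 - corrected_discard Pb Q delta theta eps (net_loss_sup Nb Ub) M Ce u
          / tail P (net_loss_sup N U) u
      <= discard_coef delta theta eps * discard_H Q M Ce u + eps ^+ 2 * K.
Proof.
move=> delta theta delta1 hsub.
have l0' := ltW hlambda.
have [/andP[EB0 EB] /andP[EC0 EC]] := conj hBmean hCmean.
have EBfin : ('E_P0[B] \is a fin_num)%E by rewrite ge0_fin_numE// ltW.
have ECfin : ('E_P0[C] \is a fin_num)%E by rewrite ge0_fin_numE// ltW.
have d_gt0 : 0 < delta by rewrite mulr_gt0// fine_gt0// EB0.
have th_gt0 : 0 < theta by rewrite mulr_gt0// fine_gt0// EC0.
have kB := integral_claim_kernel l0' hB0 EB.
rewrite -/delta in kB.
have [D [s [D0 s0 hD]]] := phase_type_decay hBph.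
have [r r0 hr] := light_tail_rate l0' D0 s0 hD kB delta1.
have [A2 A21 hA2] := subexponential_conv_le hsub.
have [c c0 hc] := subexponential_exp_lower hsub r0.
(* The base tail is at most expR (- r * v) <= c^-1 F(v) for v >= 0; the value 1 covers v < 0, where
   F is 1. *)
pose K := Num.max 1 c^-1.
have K1 : 1 <= K by rewrite /K le_max lexx.
pose A := K * A2 ^+ 2.
have A1 : 1 <= A by rewrite /A mulr_ege1// exprn_ege1.
have A0 : 0 < A by exact: lt_le_trans A1.
have dd : 0 < 1 - delta by rewrite subr_gt0.
(* The bound 1 gives eps < 1, so the base arrival rate stays positive; the other one yields
   [2 * kap * A <= 1] through kap <= eps theta / (1 - delta). The same estimate turns the kap ^+ 2
   of the error bound into eps ^+ 2. *)
exists (Num.min 1 ((1 - delta) / (2 * A * theta))), (2 * A ^+ 4 * (theta / (1 - delta)) ^+ 2).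
have At0 : 0 < 2 * A * theta by apply: mulr_gt0 => //; exact: mulr_gt0.
split; first by rewrite lt_min ltr01 divr_gt0.
move=> eps /andP[eps0 eps1] rho1; rewrite lt_min => /andP[eps_lt1 eps_lt].
move=> d T P N U hCL db Tb Pb Nb Ub hCLb dq Tq Q M Ce [mM lawM lawCe iMC] u u0.
pose l1 := (1 - eps) * lambda.
have l1_gt0 : 0 < l1 by rewrite mulr_gt0// subr_gt0.
pose rhob := (1 - eps) * delta.
pose kap := discard_coef delta theta eps.
have et0 : 0 <= eps * theta by rewrite mulr_ge0// ltW.
have ed0 : 0 <= eps * delta by rewrite mulr_ge0// ltW.
have aE : 1 - delta + eps * delta = 1 - rhob by rewrite /rhob; ring.
have a0 : 0 < 1 - rhob by rewrite -aE; lra.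
have kapE : (1 - rhob) * kap = eps * theta.
  by rewrite /kap /discard_coef aE mulrC divfK// gt_eqF.
have kap0 : 0 <= kap by rewrite /kap /discard_coef aE divr_ge0// ltW.
have kap1 : kap < 1.
  by rewrite /kap /discard_coef aE ltr_pdivrMr// mul1r; rewrite /rhob; lra.
have kap_le : kap <= eps * (theta / (1 - delta)).
  rewrite mulrA /kap /discard_coef ler_wpM2l// lef_pV2 ?posrE//; lra.
have kapA : 2 * kap * A <= 1.
  have h : 2 * A * kap <= 2 * A * (eps * (theta / (1 - delta))).
    by apply: ler_wpM2l => //; rewrite mulr_ge0// ltW.
  have h2 : eps * (2 * A * theta) < 1 - delta by rewrite -ltr_pdivlMr.
  have h3 : 2 * A * (eps * (theta / (1 - delta))) <= 1.
    have -> : 2 * A * (eps * (theta / (1 - delta))) = eps * (2 * A * theta) / (1 - delta) by ring.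
    by rewrite ler_pdivrMr// mul1r ltW.
  by rewrite (le_trans _ h3)// (le_trans _ h)// le_eqVlt; apply/orP; left; apply/eqP; ring.
pose b := claim_kernel B l1.
have mB : measurable_fun setT (B : T0 -> R) by [].
have mC : measurable_fun setT (C : T0 -> R) by [].
have lawB0 : distribution P0 B `]-oo, 0%R[%classic = 0%E := ae_ge0_null mB hB0.
have lawC0 : distribution P0 C `]-oo, 0%R[%classic = 0%E := ae_ge0_null mC hC0.
have bE : claim_kernel (Ub 0%N) l1 = b.
  apply/funext => x; rewrite /b /claim_kernel; case: ifP => // _; congr (_ * fine _).
  have [_ hUb _ _] := hCLb; exact: hUb.
have kb : (\int[lebesgue_measure]_x (b x)%:E = rhob%:E)%E.
  by rewrite (integral_claim_kernel (ltW l1_gt0) hB0 EB) /rhob /l1 /delta mulrA.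
have mb : measurable_fun setT (b : measurableTypeR R -> R).
  exact: measurable_claim_kernel.
have b0 x : 0 <= b x by exact: (claim_kernel_ge0 B x (ltW l1_gt0)).
have rhob1 : rhob < 1 by lra.
have kb' : (\int[lebesgue_measure]_x (claim_kernel (Ub 0%N) l1 x)%:E = rhob%:E)%E.
  by rewrite bE.
have [gbE mMb Mbfin Mb0 gbT] :=
  cramer_lundberg_renewal l1_gt0 hCLb lawB0 kb' rhob1.
rewrite bE in gbE.
have hU := let: And4 _ h _ _ := hCL in h.
pose cC := claim_kernel C (eps * lambda).
have el0 : 0 <= eps * lambda by rewrite mulr_ge0.
have mcC : measurable_fun setT (cC : measurableTypeR R -> R).
  exact: measurable_claim_kernel.
have cC0 x : 0 <= cC x by exact: claim_kernel_ge0.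
have kC : (\int[lebesgue_measure]_x (cC x)%:E = (eps * theta)%:E)%E.
  by rewrite (integral_claim_kernel el0 hC0 EC) /theta mulrA.
have bVE : claim_kernel (U 0%N) lambda = b \+ cC.
  apply/funext => x; rewrite /b /cC /claim_kernel/=; case: ifP => _; last by rewrite addr0.
  have -> : ccdf (U 0%N) x = ((1 - eps)%:E * ccdf B x + eps%:E * ccdf C x)%E.
    exact: (hU 0%N `]x, +oo[%classic).
  rewrite -(fccdfE B) -(fccdfE C) /= /l1 -/(fccdf B x) -/(fccdf C x); ring.
have kV : (\int[lebesgue_measure]_x (claim_kernel (U 0%N) lambda x)%:E =
    (rhob + eps * theta)%:E)%E.
  rewrite bVE; under eq_integral do rewrite /= EFinD.
  rewrite ge0_integralD//=.
  - by rewrite kb kC EFinD.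
  - by move=> x _; rewrite lee_fin.
  - exact/measurable_EFinP.
  - by move=> x _; rewrite lee_fin.
  - exact/measurable_EFinP.
have lawV0 : mixture eps (distribution P0 B) (distribution P0 C) `]-oo, 0%R[%classic = 0%E.
  by rewrite /mixture lawB0 lawC0 !mule0 adde0.
have [psiE mMe Mefin Me0 psiT] := cramer_lundberg_renewal hlambda hCL lawV0 kV rho1.
have mfine : measurable_fun setT (fine : \bar R -> R) by exact: fine_measurable.
have mfM i : measurable_fun setT (fine \o M i) by exact: measurableT_comp.
have mfMb : measurable_fun setT (fine \o net_loss_sup Nb Ub) by exact: measurableT_comp.
have mfMe : measurable_fun setT (fine \o net_loss_sup N U) by exact: measurableT_comp.
have lawfM i (S : set R) : measurable S ->
    Q ((fine \o M i) @^-1` S) = Pb ((fine \o net_loss_sup Nb Ub) @^-1` S).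
  move=> mS; have mS' : measurable ((fine : \bar R -> R) @^-1` S).
    exact: measurable_preimage.
  exact: (lawM i _ mS').
have finM i : Q (~` [set w | M i w \is a fin_num]) = 0%E.
  have mF : measurable (~` [set x : \bar R | x \is a fin_num]).
    apply: measurableC; rewrite -[X in measurable X]setTI.
    by apply: emeasurable_fin_num.
  by rewrite -Mbfin; exact: (lawM i _ mF).
have pM i g : nonneg_mfun g -> pconv Q (fine \o M i) g = pconv Q (fine \o M 0%N) g.
  move=> hg; apply/funext => v; apply: conv_same_law => // S mS.
  by rewrite !lawfM.
have mCe0 : measurable_fun setT (Ce0 : T0 -> R) by [].
have pCe i g : nonneg_mfun g -> pconv Q (Ce i : Tq -> R) g = pconv P0 Ce0 g.
  by move=> hg; apply/funext => v; apply: conv_same_law => // S mS; exact: lawCe.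
have hI := nonneg_neg_ind R.
set p0 := pconv Q (fine \o M 0%N) (@neg_ind R).
have p0gb : (fun v : R => Pb [set w | (v%:E < net_loss_sup Nb Ub w)%E]) = p0.
  rewrite gbT; apply/funext => v; apply/esym; apply: conv_same_law => // S mS.
  exact: lawfM.
rewrite p0gb in gbE.
have p0E v : p0 v = renewal_map b rhob p0 v by rewrite -gbE -p0gb.
set psi := pconv P (fine \o net_loss_sup N U) (@neg_ind R).
rewrite psiT -/psi in psiE.
have hpsi : nonneg_mfun psi by exact: nonneg_pconv.
have hp0 : nonneg_mfun p0 by exact: nonneg_pconv.
have FE : pconv P0 Ce0 (@neg_ind R) = ccdf Ce0.
  apply/funext => v; rewrite /pconv conv_neg_ind// /ccdf /distribution /pushforward.
  by congr (P0 _); apply/seteqP; split => w /=; rewrite in_itv/= andbT.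
have M00 : {ae Q, forall w, 0 <= (fine \o M 0%N) w}.
  by apply: null_ae_ge0 => //; rewrite lawfM//; exact: ae_ge0_null.
have Ce00 : {ae P0, forall w, 0 <= Ce0 w}.
  by apply: null_ae_ge0 => //; exact: hsub.1.
have ccneg v : v < 0 -> ccdf Ce0 v = 1%E.
  by move=> v0; rewrite -fccdfE (fccdf_neg hsub v0).
(* The kernel of [C] is commuted past the law of the perturbed supremum, so that it acts on the
   indicator, where [conv_claim_excess] identifies it. *)
have cpsi v : conv (@lebesgue_measure R) id cC psi v = ((eps * theta)%:E * pconv P0 Ce0 psi v)%E.
  have mid : measurable_fun setT (id : measurableTypeR R -> R) by [].
  have -> : conv (@lebesgue_measure R) id cC psi v =
      pconv P (fine \o net_loss_sup N U) (conv (@lebesgue_measure R) id cC (@neg_ind R)) v.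
    by rewrite /psi /pconv conv_comm.
  have -> : conv (@lebesgue_measure R) id cC (@neg_ind R) =
      (fun x => (eps * theta)%:E * pconv P0 Ce0 (@neg_ind R) x)%E.
    apply/funext => x; rewrite FE /cC (conv_claim_excess x el0 hC0 hCmean hCe ccneg).
    by rewrite /theta mulrA.
  rewrite pconvZ//; last exact: nonneg_pconv.
  by rewrite pconvC.
(* The traffic intensities combine: (1 - rhob) kap = eps theta, so 1 minus the perturbed intensity
   factors as (1 - rhob) (1 - kap). *)
have psiE' v : (psi v = ((1 - rhob) * (1 - kap))%:E * @neg_ind R v +
    conv (@lebesgue_measure R) id b psi v + ((1 - rhob) * kap)%:E * pconv P0 Ce0 psi v)%E.
  transitivity (renewal_map (claim_kernel (U 0%N) lambda) (rhob + eps * theta) psi v).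
    by rewrite -psiE /psi -psiT.
  rewrite /renewal_map bVE conv_kernelD// cpsi kapE addeA.
  by congr (_%:E * _ + _ + _)%E; rewrite mulrBr mulr1 kapE; ring.
have p01 v : (p0 v <= 1)%E by apply: pconv_le1 => //; exact: neg_ind_le1.
(* The rate [r] was found for arrival rate [lambda]; the base kernel is smaller for every [eps], so
   the same [r] serves uniformly. *)
have hrb : (\int[lebesgue_measure]_x ((b x)%:E * (expR (r * x))%:E) <= 1)%E.
  apply: le_trans hr; apply: ge0_le_integral => //.
  - by move=> x _; rewrite mule_ge0// lee_fin ?expR_ge0.
  - apply: emeasurable_funM; first exact/measurable_EFinP.
    by apply/measurable_EFinP; apply: measurableT_comp => //; exact: measurable_funM.
  - apply: emeasurable_funM; apply/measurable_EFinP.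
      exact: (measurable_claim_kernel B lambda).
    by apply: measurableT_comp => //; exact: measurable_funM.
  - move=> x _; apply: lee_wpmul2r; first by rewrite lee_fin expR_ge0.
    rewrite lee_fin /b /claim_kernel; case: ifP => // _.
    rewrite ler_wpM2r ?fine_ge0// /l1 ler_piMl//; lra.
have p0exp := renewal_exp_bound mb b0 kb rhob1 hp0 p01 p0E r0 hrb.
have p0F v : (p0 v <= K%:E * pconv P0 Ce0 (@neg_ind R) v)%E.
  rewrite FE; have [v0|v0] := ltP v 0.
    by rewrite ccneg// mule1 (le_trans (p01 v))// lee_fin.
  apply: (le_trans (p0exp v)); rewrite -fccdfE -EFinM lee_fin.
  apply: (@le_trans _ _ (c^-1 * fccdf Ce0 v)); first by rewrite ler_pdivlMl//; exact: hc.
  by rewrite ler_wpM2r ?fccdf_ge0// /K le_max lexx orbT.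
have CF v : (pconv P0 Ce0 (pconv P0 Ce0 (@neg_ind R)) v <= A2%:E * pconv P0 Ce0 (@neg_ind R) v)%E.
  by rewrite FE; exact: hA2.
have tP : tail P (net_loss_sup N U) u = fine (psi u) by rewrite /psi -psiT.
have tPb : tail Pb (net_loss_sup Nb Ub) u = fine (p0 u) by rewrite -p0gb.
have tQ : tail Q (M 0%N) u = fine (p0 u).
  rewrite -p0gb /tail; congr fine.
  have -> : [set w | (u%:E < M 0%N w)%E] = M 0%N @^-1` `]u%:E, +oo[%classic.
    by apply/seteqP; split => w /=; rewrite in_itv/= andbT.
  have mS : measurable (`]u%:E, +oo[%classic : set (\bar R)) by exact: emeasurable_itv.
  transitivity (Pb (net_loss_sup Nb Ub @^-1` `]u%:E, +oo[%classic)); first exact: (lawM 0%N _ mS).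
  congr (Pb _).
  by apply/seteqP; split => w /=; rewrite in_itv/= andbT.
have t1 := tail_copies1 mM finM iMC pM pCe u.
have t2 := tail_copies2 mM finM iMC pM pCe u.
rewrite /corrected_discard /discard_H t1 t2 tP tPb tQ -/kap -/p0.
set CM := fun g => pconv P0 Ce0 (pconv Q (fine \o M 0%N) g).
have hCM g : nonneg_mfun g -> nonneg_mfun (CM g).
  by move=> hg; do 2 apply: nonneg_pconv => //.
have CM1 g v : nonneg_mfun g -> (forall x, g x <= 1)%E -> (CM g v <= 1)%E.
  move=> hg g1; apply: pconv_le1 => //; first exact: nonneg_pconv.
  by move=> x; exact: pconv_le1.
have psi1 v : (psi v <= 1)%E by apply: pconv_le1 => //; exact: neg_ind_le1.
have [p pE] := ge0_le_EFin (hp0.2 u) (p01 u).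
have [q1 q1E] := ge0_le_EFin ((hCM _ hp0).2 u) (CM1 _ u hp0 p01).
have [q2 q2E] := ge0_le_EFin ((hCM _ (hCM _ hp0)).2 u)
  (CM1 _ u (hCM _ hp0) (fun v => CM1 _ v hp0 p01)).
have [z zE] := ge0_le_EFin (hpsi.2 u) (psi1 u).
rewrite -/(CM p0) -/(CM (CM p0)) pE q1E q2E zE /=.
(* If [kap] is 0 then so is [eps], and psi = p0. The relative error is then 1 - p / p, which is 0
   only for nonzero p because division by 0 gives 0; [renewal_pos] excludes p = 0. *)
have [k0|kn0] := eqVneq kap 0.
  have e0 : eps = 0.
    move: kapE; rewrite k0 mulr0 => /esym/eqP; rewrite mulf_eq0 => /orP[/eqP//|].
    by rewrite gt_eqF.
  have := perturbation_identity (mfM 0%N) mfMe mCe0 mb b0 kb rhob1 kap0 kap1 p0E psiE' u.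
  rewrite -/p0 -/psi pE zE k0 subr0 mul1e mul0e adde0 => -[zp].
  have p_gt0 : 0 < p.
    have bpos : 0 < rhob by rewrite mulr_gt0// subr_gt0.
    have [h [beta [h0 beta0 hbeta]]] := claim_kernel_support l1_gt0 kb bpos.
    have p0neg v : v < 0 -> p0 v = 1%E.
      move=> v0; apply/eqP; rewrite eq_le p01/=.
      have := pconv_ge (mfM 0%N) M00 v hI (@neg_ind_nincr R).
      by rewrite -/p0 /neg_ind v0.
    have := renewal_pos mb b0 hp0 p01 p0E h0 beta0 hbeta
      (pconv_nincr Q (mfM 0%N) hI (@neg_ind_nincr R)) p0neg u.
    by rewrite pE lte_fin.
  by rewrite zp e0 expr0n !mul0r !addr0 divff ?gt_eqF// subrr.
have kgt0 : 0 < kap by rewrite lt_neqAle eq_sym kn0.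
have err := perturbation_error (mfM 0%N) mfMe mCe0 M00 Ce00 mb b0 kb rhob1 kap0 kap1 p0E psiE'
  K1 A21 p0F CF kapA pE q1E q2E zE.
have fE : pconv P0 Ce0 (@neg_ind R) u = (fccdf Ce0 u)%:E by rewrite FE fccdfE.
apply: le_trans (err _ fE (subexponential_fccdf_gt0 hsub u) kgt0) _.
rewrite lerD2l.
have -> : eps ^+ 2 * (2 * A ^+ 4 * (theta / (1 - delta)) ^+ 2) =
   (eps * (theta / (1 - delta))) ^+ 2 * (2 * A ^+ 4) by ring.
apply: ler_wpM2r; first by rewrite mulr_ge0// exprn_ge0// ltW.
by rewrite lerXn2r// ?nnegrE// mulr_ge0// divr_ge0// ltW.
Qed.
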